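(* The four following statements hold. (i) If $0\leq t\leq\alpha_{2,\infty}^-$ or $0.5<t\leq\alpha_{2,3}^+$, then the maximum of $I_d(t)$ when $d$ ranges over the positive integers is equal to $I_2(t)$, where $\alpha_{2,\infty}^-$ is the solution of $$ \sqrt{2}-2t=\sqrt{\frac{6}{\pi}}\,e^{-6t^2} $$ that satisfies $0.0173679<\alpha_{2,\infty}^-<0.017368$, while $\alpha_{2,3}^+$ is equal to $$ \frac{5+2\sqrt{6\sqrt{6}-14}}{6\sqrt{3}} $$ and satisfies $0.641788<\alpha_{2,3}^+<0.641789$. (ii) If $\alpha_{3,\infty}^-\leq t\leq0.20916$, or $\delta\leq t\leq\alpha_{1,3}$, or $\alpha_{2,3}^+\leq t\leq0.64607$, then the maximum of $I_d(t)$ when $d$ ranges over the positive integers is equal to $I_3(t)$, where $\alpha_{3,\infty}^-$ is the solution of the equation $$ \frac{3\sqrt{3}}{4}-3\sqrt{3}\,t^2=\sqrt{\frac{6}{\pi}}\,e^{-6t^2} $$ that satisfies $0.192472<\alpha_{3,\infty}^-<0.192473$, while $\alpha_{1,3}$ is equal to $$ \frac{\sqrt{9-4\sqrt{3}}}{6} $$ and satisfies $0.239895<\alpha_{1,3}<0.239896$. (iii) If $\alpha_{1,3}\leq t\leq0.5$, then the maximum of $I_d(t)$ when $d$ ranges over the positive integers is equal to $I_1(t)$. (iv) If $\alpha_{2,\infty}^-\leq t\leq\alpha_{3,\infty}^-$, then the supremum of $I_d(t)$ when $d$ ranges over the positive integers is equal to $\sqrt{6/\pi}\,e^{-6t^2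}$.
   Context: For a positive integer $d$ and a non-negative real number $t$, $I_d(t)$ denotes the $(d-1)$-dimensional volume of $H\cap[0,1]^d$ where $H$ is a hyperplane of $\mathbb{R}^d$ that is orthogonal to a diagonal of the hypercube $[0,1]^d$ (a segment joining two opposite vertices) and whose Euclidean distance to the center of $[0,1]^d$ is equal to $t$. By symmetry, this does not depend on the choice of such an $H$. The volume is $0$ when the intersection is empty. When $d=1$, the $0$-dimensional volume is the counting measure, so that $I_1(t)=1$ if $0\leq t\leq1/2$ and $I_1(t)=0$ if $t>1/2$. The number $\delta$ is the root of $$ 575\sqrt{5}-528\sqrt{6}-120\bigl(25\sqrt{5}-24\sqrt{6}\bigr)t^2+240\bigl(25\sqrt{5}-36\sqrt{6}\bigr)t^4+17280t^5 $$ that satisfies $0.222924<\delta<0.222925$. *)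

(* Defs.v *)
From HB Require Import structures.
From mathcomp Require Import all_boot all_order all_algebra.
From mathcomp Require Import all_classical all_reals all_analysis.

Set Implicit Arguments.
Unset Strict Implicit.
Unset Printing Implicit Defensive.

Import Order.TTheory GRing.Theory Num.Theory.

Local Open Scope classical_set_scope.
Local Open Scope ring_scope.

(* The library norm on row vectors is the sup norm, so the Euclidean structure
   of R^n is introduced here. *)
Definition dotrV {R : realType} {n : nat} (u v : 'rV[R]_n) : R :=
  \sum_(i < n) u 0 i * v 0 i.

Definition enorm {R : realType} {n : nat} (u : 'rV[R]_n) : R :=
  Num.sqrt (dotrV u u).

Definition edist_to {R : realType} {n : nat} (x : 'rV[R]_n) (A : set 'rV[R]_n)
    : R :=
  inf [set enorm (x - y) | y in A].

(* Lebesgue measure of R^n as the n-fold product of the one-dimensional Lebesgue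
   measure, with the formula of [product_measure1]; R^0 is a point, which
   carries the counting measure. Meaningful on Borel sets only. *)
Fixpoint lebesgue_rV {R : realType} (n : nat) : set 'rV[R]_n -> \bar R :=
  match n with
  | 0%N => fun A => (\1_A (0 : 'rV[R]_0))%:E
  | m.+1 => fun A =>
      (\int[@lebesgue_measure R]_x
         lebesgue_rV [set v : 'rV[R]_m |
           A (row_mx (x%:M : 'rV[R]_1) v : 'rV[R]_m.+1)])%E
  end.

Definition is_hyperplane {R : realType} {d : nat} (H : set 'rV[R]_d) : Prop :=
  exists a : 'rV[R]_d, exists c : R, a != 0 /\ H = [set x | dotrV a x = c].

Definition cube (R : realType) (d : nat) : set 'rV[R]_d :=
  [set x | forall i, 0 <= x 0 i <= 1].

Definition cube_center (R : realType) (d : nat) : 'rV[R]_d := const_mx 2^-1.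

Definition cube_vertex {R : realType} {d : nat} (p : 'rV[R]_d) : Prop :=
  forall i, p 0 i = 0 \/ p 0 i = 1.

Definition opposite_vertex {R : realType} {d : nat} (p : 'rV[R]_d) : 'rV[R]_d :=
  const_mx 1 - p.

Definition orthogonal_to_diagonal {R : realType} {d : nat} (H : set 'rV[R]_d)
    : Prop :=
  exists p : 'rV[R]_d, cube_vertex p /\
    forall x y, H x -> H y -> dotrV (x - y) (opposite_vertex p - p) = 0.

(* v is the (d-1)-dimensional volume of the part of A lying in the hyperplane H:
   its Lebesgue measure once H is identified isometrically with R^(d-1). *)
Definition is_hyperplane_volume {R : realType} {d : nat}
    (H A : set 'rV[R]_d) (v : \bar R) : Prop :=
  exists f : 'rV[R]_d.-1 -> 'rV[R]_d,
    [/\ forall x y, enorm (f x - f y) = enorm (x - y),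
        range f = H
      & v = lebesgue_rV (f @^-1` A)].

Definition is_diag_section_volume {R : realType} (d : nat) (t : R) (v : \bar R)
    : Prop :=
  exists H : set 'rV[R]_d,
    [/\ is_hyperplane H,
        orthogonal_to_diagonal H,
        edist_to (@cube_center R d) H = t
      & is_hyperplane_volume H (H `&` @cube R d) v].

(* I_d(t), for d >= 1 and t >= 0. The volume depends neither on the hyperplane H
   nor on the isometry f above, so the chosen value is the only one. *)
Definition diag_volume {R : realType} (d : nat) (t : R) : \bar R :=
  xget 0%E [set v | is_diag_section_volume d t v].

Definition diag_volumes {R : realType} (t : R) : set (\bar R) :=
  [set diag_volume d t | d in [set d : nat | (0 < d)%N]].

Definition is_maximum {R : realType} (S : set (\bar R)) (m : \bar R) : Prop :=
  S m /\ ubound S m.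

Definition gauss_limit {R : realType} (t : R) : R :=
  Num.sqrt (6 / pi) * expR (- (6 * t ^+ 2)).

(* The decimal number 0.abc, where a, b, c are groups of three digits (large
   literals in ring_scope are unary and overflow the stack). *)
Definition dec {R : realType} (a b c : nat) : R :=
  a%:R / 10 ^+ 3 + b%:R / 10 ^+ 6 + c%:R / 10 ^+ 9.

Definition is_alpha2inf {R : realType} (a : R) : Prop :=
  Num.sqrt 2 - 2 * a = gauss_limit a /\ dec 017 367 900 < a < dec 017 368 000.

Definition is_alpha3inf {R : realType} (a : R) : Prop :=
  3 * Num.sqrt 3 / 4 - 3 * Num.sqrt 3 * a ^+ 2 = gauss_limit a /\
  dec 192 472 000 < a < dec 192 473 000.

Definition is_delta {R : realType} (t : R) : Prop :=
  575 * Num.sqrt 5 - 528 * Num.sqrt 6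
    - 120 * (25 * Num.sqrt 5 - 24 * Num.sqrt 6) * t ^+ 2
    + 240 * (25 * Num.sqrt 5 - 36 * Num.sqrt 6) * t ^+ 4
    + 17280 * t ^+ 5 = 0 /\
  dec 222 924 000 < t < dec 222 925 000.

Definition alpha23 (R : realType) : R :=
  (5 + 2 * Num.sqrt (6 * Num.sqrt 6 - 14)) / (6 * Num.sqrt 3).

Definition alpha13 (R : realType) : R := Num.sqrt (9 - 4 * Num.sqrt 3) / 6.

(* Main.v *)
(* A section of the d-cube by a hyperplane orthogonal to a diagonal at distance t
   from the centre has volume sqrt d * g_d (sqrt d * t), where g_d is the centred
   density of a sum of d uniform variables on [0, 1]. By Fourier inversion g_d is
   the integral of sinc^d against a cosine; comparing sinc^d with
   e^(- d u^2 / 6) (1 - d u^4 / 180) gives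
     I_d(t) = phi(t) (1 - (3 - 72 t^2 + 144 t^4) / (20 d)) + O(1 / d^2)
   with an explicit error term, phi being the Gaussian limit. This settles the
   dimensions d >= 21, as well as the supremum in (iv). For 4 <= d <= 20 the
   density is piecewise polynomial and every required bound is a polynomial
   inequality on an interval, certified by the signs of Bernstein coefficients
   computed over Z. I_1, I_2, I_3 are explicit; they are compared with each other
   and with phi, whose increments are squeezed between those of multiples of
   t^2. *)
Require Import Defs.
From HB Require Import structures.
From mathcomp Require Import all_boot all_order all_algebra.
From mathcomp Require Import all_classical all_reals all_analysis.
From mathcomp Require Import measurable_realfun lebesgue_integral_under.
From mathcomp Require Import ring lra.

Set Implicit Arguments.
Unset Strict Implicit.
Unset Printing Implicit Defensive.

Import Order.TTheory GRing.Theory Num.Theory.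
Import numFieldNormedType.Exports.

Local Open Scope classical_set_scope.
Local Open Scope ring_scope.

(** * Iterated integrals and linear changes of variables *)

(** [diag_volume] is a choice with default value 0, so the formula for I_d needs two halves: all
    admissible hyperplanes and isometries give the same value, and one such pair exists. An isometry
    onto the hyperplane is affine with orthonormal rows; forgetting one coordinate maps the section
    onto the slab of the (d-1)-cube measured by [slice_volume], and sqrt d is the inverse Jacobian
    of that projection. Fourier inversion is reached by recursion: the density and the cosine
    integral both pass to the next dimension by averaging over a unit interval, and they agree for
    two variables because the integral of sinc^2 is pi. The coefficients 1/6 and 1/180 are those of
    - log sinc. The correction 3 - 72 t^2 + 144 t^4 changes sign near t = 0.214. For t <= 0.194 high
    dimensions stay below phi; further right they may exceed it, and are beaten by I_1, I_2 or I_3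
    through margins over phi (0.0004, 0.0035, 0.0085). Since I_3 - phi increases up to 0.24, its
    positive margins are checked at two points only. *)

Lemma lebesgue_measure_itv_oc (R : realType) (a b : R) :
  a <= b -> @lebesgue_measure R `]a, b] = (b - a)%:E.
Proof.
move=> ab; rewrite lebesgue_measure_itv/= lte_fin.
by case: ltgtP ab => // -> _; rewrite subrr.
Qed.

(** Uniqueness of Lebesgue measure: |a| times the image measure under x |-> a x + b gives ]u, v] its
    length. For a < 0 the preimage of ]u, v] is closed on the left, hence the separate case. *)
Lemma ge0_integral_affine (R : realType) (a b : R) (f : R -> \bar R) :
  a != 0 -> measurable_fun setT f -> (forall x, 0 <= f x)%E ->
  (\int[@lebesgue_measure R]_x f (a * x + b)%R =
   `|a|^-1%:E * \int[@lebesgue_measure R]_x f x)%E.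
Proof.
move=> a0 mf f0.
have a0' : 0 < `|a| by rewrite normr_gt0.
pose phi : measurableTypeR R -> measurableTypeR R := fun x => a * x + b.
have mphi : measurable_fun setT phi.
  by apply: measurable_funD => //; apply: measurable_funM.
have [pf pfE] : exists pf : {measure set (measurableTypeR R) -> \bar R},
    (pf : set _ -> \bar R) = pushforward (@lebesgue_measure R) phi.
  by unshelve eexists (pushforward (@lebesgue_measure R) phi).
pose nu := mscale (NngNum (normr_ge0 a)) pf.
have nuE A : measurable A -> @lebesgue_measure R A = nu A.
  move=> mA; apply: (@lebesgue_measure_unique R nu) => //.
  move=> X [[u v] /= _ <-].
  have [uv|vu] := leP u v; last by rewrite set_itv_ge ?measure0// bnd_simp -leNgt ltW.
  rewrite lebesgue_measure_itv_oc// /nu.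
  have -> : mscale (NngNum (normr_ge0 a)) pf `]u, v] =
      (`|a|%:E * @lebesgue_measure R (phi @^-1` `]u, v]))%E.
    by rewrite /mscale pfE.
  have [ap|an|] := ltgtP 0 a; last by move=> e; rewrite -e eqxx in a0.
    have -> : phi @^-1` `]u, v] = `]((u - b) / a), ((v - b) / a)]%classic.
      apply/seteqP; split => x; rewrite /= !in_itv/= /phi.
        by rewrite ltr_pdivrMr// ler_pdivlMr// ltrBlDr lerBrDr ![x * a]mulrC.
      by rewrite ltr_pdivrMr// ler_pdivlMr// ltrBlDr lerBrDr ![x * a]mulrC.
    rewrite lebesgue_measure_itv_oc; last first.
      by rewrite ler_pM2r ?invr_gt0// lerD2r.
    by rewrite gtr0_norm// -EFinM; congr EFin; field.
  have -> : phi @^-1` `]u, v] = `[((v - b) / a), ((u - b) / a)[%classic.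
    apply/seteqP; split => x; rewrite /= !in_itv/= /phi.
      by rewrite ltr_ndivlMr// ler_ndivrMr// ltrBlDr lerBrDr ![x * a]mulrC andbC.
    by rewrite ltr_ndivlMr// ler_ndivrMr// ltrBlDr lerBrDr ![x * a]mulrC andbC.
  rewrite lebesgue_measure_itv/= lte_fin.
  rewrite ltr0_norm// ltr_nM2r ?invr_lt0// ltrD2r.
  case: ltgtP uv => // [_ _|-> _]; last by rewrite subrr mule0.
  by rewrite -EFinM; congr EFin; field.
have -> : (\int[@lebesgue_measure R]_x f x = \int[nu]_x f x)%E.
  by apply: eq_measure_integral => A mA _; exact: (nuE A).
rewrite ge0_integral_mscale//= muleA -EFinM mulVf ?gt_eqF// mul1e.
transitivity (\int[pushforward (@lebesgue_measure R) phi]_x f x)%E.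
  by rewrite ge0_integral_pushforward.
by apply: eq_measure_integral => A _ _; exact: (congr1 (fun g => g A) (esym pfE)).
Qed.

Lemma ge0_integral_translate (R : realType) (b : R) (f : R -> \bar R) :
  measurable_fun setT f -> (forall x, 0 <= f x)%E ->
  (\int[@lebesgue_measure R]_x f (x + b)%R = \int[@lebesgue_measure R]_x f x)%E.
Proof.
move=> mf f0; have := ge0_integral_affine b (@oner_neq0 R) mf f0.
rewrite normr1 invr1 mul1e => <-.
by apply: eq_integral => x _; rewrite mul1r.
Qed.

(** * Integration on row vectors, one coordinate at a time *)

Definition cons_rV (R : realType) (n : nat) (x : R) (v : 'rV[R]_n) : 'rV[R]_n.+1 :=
  row_mx (x%:M : 'rV[R]_1) v.

Lemma cons_rV0 (R : realType) n (x : R) (v : 'rV[R]_n) : cons_rV x v 0 ord0 = x.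
Proof.
have -> : ord0 = lshift n (@ord0 0) :> 'I_n.+1 by exact: val_inj.
by apply: (etrans (row_mxEl _ _ _ _)); rewrite mxE eqxx mulr1n.
Qed.

Lemma cons_rVS (R : realType) n (x : R) (v : 'rV[R]_n) (i : 'I_n) :
  cons_rV x v 0 (lift ord0 i) = v 0 i.
Proof.
have -> : lift ord0 i = rshift 1 i :> 'I_n.+1 by exact: val_inj.
exact: row_mxEr.
Qed.

(** The recursion of [lebesgue_rV] extended from sets to functions; Tonelli and the changes of
    variables are proved on it by induction on the dimension. *)
Fixpoint iter_integral (R : realType) (n : nat) : ('rV[R]_n -> \bar R) -> \bar R :=
  match n with
  | 0%N => fun F => F 0
  | m.+1 => fun F => (\int[@lebesgue_measure R]_x
      iter_integral (fun v : 'rV[R]_m => F (cons_rV x v)))%E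
  end.

Lemma lebesgue_rVE (R : realType) n (A : set 'rV[R]_n) :
  lebesgue_rV A = iter_integral (fun v => (\1_A v)%:E).
Proof.
elim: n A => [//|n ih] A /=; apply: eq_integral => x _.
by rewrite ih; congr iter_integral; apply/funext => v; rewrite !indicE.
Qed.

(* Joint measurability in a parameter and a row vector, tested on all measurable
   maps into the product: no sigma-algebra on the row vectors is needed. *)
Definition jointly_measurable (R : realType) d (P : measurableType d) (n : nat)
    (F : P -> 'rV[R]_n -> \bar R) : Prop :=
  forall d' (X : measurableType d') (phi : X -> P) (c : X -> 'rV[R]_n),
    measurable_fun setT phi ->
    (forall i, measurable_fun setT (fun x => c x 0 i)) ->
    measurable_fun setT (fun x => F (phi x) (c x)).

Lemma eq_iter_integral (R : realType) n (F G : 'rV[R]_n -> \bar R) :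
  (forall v, F v = G v) -> iter_integral F = iter_integral G.
Proof. by move=> FG; congr iter_integral; apply/funext. Qed.

Lemma iter_integral_ge0 (R : realType) n (F : 'rV[R]_n -> \bar R) :
  (forall v, 0 <= F v)%E -> (0 <= iter_integral F)%E.
Proof.
by elim: n F => [|n ih] F F0 //=; apply: integral_ge0 => x _; exact: ih.
Qed.

(** Inductions on the dimension hand the first coordinate over from the vector to the parameter, so
    the parameter space has to grow along the way. *)
Lemma jointly_measurable_cons (R : realType) d (P : measurableType d) n
    (F : P -> 'rV[R]_n.+1 -> \bar R) :
  jointly_measurable F ->
  jointly_measurable (fun (q : P * measurableTypeR R) v => F q.1 (cons_rV q.2 v)).
Proof.
move=> mF d' X phi c mphi mc; apply: (mF d' X (fst \o phi)).
  exact: measurableT_comp.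
move=> i; case: (unliftP ord0 i) => [j|] ->.
  by under eq_fun do rewrite cons_rVS; exact: mc.
under eq_fun do rewrite cons_rV0.
by apply: (@measurableT_comp _ _ _ _ _ _ snd _ phi).
Qed.

Lemma measurable_iter_integral (R : realType) d (P : measurableType d) n
    (F : P -> 'rV[R]_n -> \bar R) :
  jointly_measurable F -> (forall p v, 0 <= F p v)%E ->
  measurable_fun setT (fun p => iter_integral (F p)).
Proof.
elim: n d P F => [|n ih] d P F mF F0 /=.
  by apply: (mF _ P id (fun=> 0)) => // i; exact: measurable_cst.
pose G (q : P * measurableTypeR R) :=
  iter_integral (fun v : 'rV[R]_n => F q.1 (cons_rV q.2 v)).
have mG : measurable_fun setT G.
  by apply: ih => [|q v]; [exact: jointly_measurable_cons|exact: F0].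
apply: (measurable_fun_fubini_tonelli_F G mG) => q.
by apply: iter_integral_ge0 => v; exact: F0.
Qed.

Lemma iter_integral_fubini (R : realType) n (F : R -> 'rV[R]_n -> \bar R) :
  jointly_measurable (F : measurableTypeR R -> _) -> (forall x v, 0 <= F x v)%E ->
  (\int[@lebesgue_measure R]_x iter_integral (F x) =
   iter_integral (fun v => \int[@lebesgue_measure R]_x F x v))%E.
Proof.
elim: n F => [//|n ih] F mF F0 /=.
pose G (q : measurableTypeR R * measurableTypeR R) :=
  iter_integral (fun v : 'rV[R]_n => F q.1 (cons_rV q.2 v)).
have mG : measurable_fun setT G.
  apply: measurable_iter_integral => [|q v]; last exact: F0.
  exact: jointly_measurable_cons.
have G0 q : (0 <= G q)%E by apply: iter_integral_ge0 => v; exact: F0.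
rewrite (fubini_tonelli G mG G0).
apply: eq_integral => y _; rewrite /= /G/= ih// => d' X phi c mphi mc.
have H := jointly_measurable_cons mF.
apply: (H d' X (fun x => (phi x, y)) c) => //.
by apply/measurable_fun_pairP; split => //=; exact: measurable_cst.
Qed.

(** A dummy real parameter lets the lemmas on [jointly_measurable] serve for functions of the vector
    alone. *)
Definition vmeasurable (R : realType) n (F : 'rV[R]_n -> \bar R) : Prop :=
  jointly_measurable (fun (_ : measurableTypeR R) v => F v).

Lemma vmeasurable_cons (R : realType) n (F : 'rV[R]_n.+1 -> \bar R) :
  vmeasurable F ->
  jointly_measurable (fun (x : measurableTypeR R) v => F (cons_rV x v)).
Proof.
move=> mF d' X phi c mphi mc.
have H := jointly_measurable_cons mF.
by apply: (H d' X (fun x => (phi x, phi x)) c) => //;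
  apply/measurable_fun_pairP; split.
Qed.

Lemma vmeasurable_cons1 (R : realType) n (F : 'rV[R]_n.+1 -> \bar R) (x : R) :
  vmeasurable F -> vmeasurable (fun v => F (cons_rV x v)).
Proof.
move=> mF d' X phi c mphi mc.
have H := vmeasurable_cons mF.
by apply: (H d' X (fun=> x) c) => //; exact: measurable_cst.
Qed.

Lemma measurable_affine_rV (R : realType) m n d (X : measurableType d)
    (c : X -> 'rV[R]_m) (M : 'M[R]_(m, n)) (b : 'rV[R]_n) :
  (forall i, measurable_fun setT (fun x => c x 0 i)) ->
  forall i, measurable_fun setT (fun x => (c x *m M + b) 0 i).
Proof.
move=> mc i; under eq_fun do rewrite !mxE.
apply: measurable_funD => //; apply: measurable_sum => j.
by apply: measurable_funM => //; exact: measurable_cst.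
Qed.

Lemma vmeasurable_affine (R : realType) m n (F : 'rV[R]_n -> \bar R)
    (M : 'M[R]_(m, n)) (b : 'rV[R]_n) :
  vmeasurable F -> vmeasurable (fun v => F (v *m M + b)).
Proof.
move=> mF d' X phi c mphi mc; apply: (mF d' X phi) => //.
exact: measurable_affine_rV.
Qed.

Lemma vmeasurable_mul (R : realType) m n (F : 'rV[R]_n -> \bar R)
    (M : 'M[R]_(m, n)) :
  vmeasurable F -> vmeasurable (fun v => F (v *m M)).
Proof.
move=> /(vmeasurable_affine M 0) mF d' X phi c mphi mc.
by have := mF d' X phi c mphi mc; under eq_fun do rewrite addr0.
Qed.

Lemma measurable_cons_iter (R : realType) n (F : 'rV[R]_n.+1 -> \bar R) :
  vmeasurable F -> (forall v, 0 <= F v)%E ->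
  measurable_fun setT (fun x : measurableTypeR R =>
    iter_integral (fun v => F (cons_rV x v))).
Proof.
move=> mF F0; apply: measurable_iter_integral => [|x v]; last exact: F0.
exact: vmeasurable_cons.
Qed.

Lemma cons_rVD (R : realType) n (x y : R) (u v : 'rV[R]_n) :
  cons_rV x u + cons_rV y v = cons_rV (x + y) (u + v).
Proof. by rewrite /cons_rV [LHS](@add_row_mx _ _ 1 n) raddfD. Qed.

Lemma cons_rV_surj (R : realType) n (v : 'rV[R]_n.+1) :
  exists x u, v = cons_rV x u.
Proof.
exists (v 0 ord0), (\row_j v 0 (lift ord0 j)).
apply/rowP => i; case: (unliftP ord0 i) => [j|] ->.
  by rewrite cons_rVS mxE.
by rewrite cons_rV0.
Qed.

Lemma iter_integral_translate (R : realType) n (F : 'rV[R]_n -> \bar R)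
    (b : 'rV[R]_n) :
  vmeasurable F -> (forall v, 0 <= F v)%E ->
  iter_integral (fun v => F (v + b)) = iter_integral F.
Proof.
elim: n F b => [|n ih] F b mF F0; first by rewrite /= [b]thinmx0 addr0.
have [y [c ->]] := cons_rV_surj b => /=.
rewrite -(@ge0_integral_translate R y (fun x =>
  iter_integral (fun v => F (cons_rV x v)))).
- apply: eq_integral => x _.
  under eq_iter_integral do rewrite cons_rVD.
  by rewrite (ih (fun v => F (cons_rV (x + y) v)))//; exact: vmeasurable_cons1.
- exact: measurable_cons_iter.
- by move=> x; exact: iter_integral_ge0.
Qed.

Lemma mul_cons_rV_block (R : realType) n (x : R) (v : 'rV[R]_n) (a : R)
    (b : 'rV[R]_n) (c : 'cV[R]_n) (D : 'M[R]_n) :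
  cons_rV x v *m (block_mx a%:M b c D : 'M[R]_(1 + n)) =
  cons_rV (x * a + (v *m c) 0 0) (x *: b + v *m D).
Proof.
rewrite /cons_rV [LHS](@mul_row_block _ 1 1 n 1 n).
rewrite -scalar_mxM mul_scalar_mx; congr row_mx.
by rewrite [v *m c]mx11_scalar -raddfD !mxE eqxx mulr1n.
Qed.

(** Once the order of integration is exchanged, v is fixed and the shear is a translation of x. *)
Lemma iter_integral_shear (R : realType) n (F : 'rV[R]_n.+1 -> \bar R)
    (c : 'cV[R]_n) :
  vmeasurable F -> (forall v, 0 <= F v)%E ->
  (\int[@lebesgue_measure R]_x
     iter_integral (fun v => F (cons_rV (x + (v *m c) 0 0)%R v)))%E =
  iter_integral F.
Proof.
move=> mF F0.
have mF2 := vmeasurable_cons mF.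
rewrite iter_integral_fubini//; last first.
  move=> d' X phi w mphi mw; apply: (mF2 d' X _ w) => //.
  apply: measurable_funD => //; under eq_fun do rewrite mxE.
  by apply: measurable_sum => j; apply: measurable_funM.
rewrite /= iter_integral_fubini//; apply: eq_iter_integral => v.
rewrite (@ge0_integral_translate _ _ (fun x => F (cons_rV x v)))//.
by apply: (mF2 _ _ id (fun=> v)) => // i; exact: measurable_cst.
Qed.

(** Clearing the first column below the pivot a leaves a block triangular matrix with diagonal
    blocks a and S, the Schur complement, so det M = a det S. The clearing is a shear, a scales the
    first coordinate, and S is left to the induction hypothesis of [iter_integral_linear], received
    here as an argument. *)
Lemma iter_integral_linear_pivot (R : realType) n (M : 'M[R]_n.+1)
    (F : 'rV[R]_n.+1 -> \bar R) :
  (forall (N : 'M[R]_n) (G : 'rV[R]_n -> \bar R), N \in unitmx ->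
    vmeasurable G -> (forall v, 0 <= G v)%E ->
    iter_integral (fun v => G (v *m N)) =
    ((`|\det N|^-1)%:E * iter_integral G)%E) ->
  M 0 0 != 0 -> M \in unitmx -> vmeasurable F -> (forall v, 0 <= F v)%E ->
  iter_integral (fun v => F (v *m M)) =
  ((`|\det M|^-1)%:E * iter_integral F)%E.
Proof.
move=> ih; set a := M 0 0 => a0 uM mF F0.
pose b : 'rV[R]_n := @ursubmx _ 1 n 1 n M.
pose c : 'cV[R]_n := @dlsubmx _ 1 n 1 n M.
pose D : 'M[R]_n := @drsubmx _ 1 n 1 n M.
have ME : M = (block_mx a%:M b c D : 'M[R]_(1 + n)).
  have <- : @ulsubmx _ 1 n 1 n M = a%:M.
    rewrite [LHS]mx11_scalar !mxE; congr (_%:M); rewrite /a.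
    by congr (M _ _); exact: val_inj.
  exact/esym/(@submxK _ 1 n 1 n).
pose S := D - (a^-1 *: c) *m b.
have detM : \det M = a * \det S.
  pose L := (block_mx (1%:M : 'M[R]_1) 0 (- (a^-1 *: c)) 1%:M : 'M[R]_(1 + n)).
  have detL : \det L = 1 by rewrite (@det_lblock _ 1 n) !det1 mulr1.
  have LM : L *m M = (block_mx a%:M b 0 S : 'M[R]_(1 + n)).
    rewrite ME [LHS](@mulmx_block _ 1 n 1 n 1 n) !mul1mx !mul0mx !addr0.
    have -> : - (a^-1 *: c) *m a%:M + c = 0.
      by rewrite mulNmx mul_mx_scalar scalerA mulfV// scale1r addNr.
    by rewrite mulNmx [_ + D]addrC.
  have := congr1 determinant LM; rewrite det_mulmx detL mul1r => ->.
  by rewrite (@det_ublock _ 1 n) det_mx11 mxE eqxx mulr1n.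
have uS : S \in unitmx.
  move: uM; rewrite !unitmxE detM unitrM => /andP[_].
  by [].
(* Replacing x by x - v c / a cancels the contribution of v to the first coordinate and turns D into
   S in the others. *)
rewrite -[LHS](@iter_integral_shear _ _ _ (- (a^-1 *: c))); last 2 first.
- exact: vmeasurable_mul.
- by [].
transitivity (\int[@lebesgue_measure R]_x
    iter_integral (fun v => F (cons_rV (x * a)%R (x *: b + v *m S)%R)))%E.
  apply: eq_integral => x _; apply: eq_iter_integral => v.
  congr F; rewrite [X in _ *m X]ME mul_cons_rV_block.
  have E : (v *m - (a^-1 *: c)) 0 0 = - (a^-1 * (v *m c) 0 0).
    by rewrite mulmxN -scalemxAr !mxE.
  congr cons_rV; first by rewrite E; field.
  rewrite E scalerDl -addrA; congr (_ + _).
  rewrite addrC /S mulmxBr scaleNr; congr (_ - _).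
  rewrite -scalemxAl -scalemxAr mulmxA [v *m c]mx11_scalar mul_scalar_mx.
  by rewrite scalerA !mxE eqxx mulr1n.
transitivity (\int[@lebesgue_measure R]_x
    ((`|\det S|^-1)%:E * iter_integral (fun v => F (cons_rV (a * x + 0)%R v))))%E.
  apply: eq_integral => x _; rewrite addr0 [(a * x)%R]mulrC.
  pose G v := F (cons_rV (x * a) v).
  have mG : vmeasurable G by exact: vmeasurable_cons1.
  have G0 v : (0 <= G v)%E by exact: F0.
  rewrite -(ih S G)//.
  pose H v := G (v *m S).
  have H0 v : (0 <= H v)%E by exact: G0.
  (* Translating v by x b S^-1 produces the term x b. *)
  rewrite -(@iter_integral_translate _ _ H (x *: b *m invmx S))//; last first.
    exact: vmeasurable_mul.
  apply: eq_iter_integral => v; rewrite /H /G mulmxDl -mulmxA mulVmx//.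
  by rewrite mulmx1 addrC.
rewrite ge0_integralZl//=; last 2 first.
- apply: (@measurable_iter_integral _ _ (measurableTypeR R) _
    (fun x v => F (cons_rV (a * x + 0) v))) => //.
  move=> d' X phi w mphi mw; have H := vmeasurable_cons mF.
  apply: (H d' X _ w) => //.
  by apply: measurable_funD => //; apply: measurable_funM.
- by move=> x _; apply: iter_integral_ge0.
rewrite (@ge0_integral_affine _ a 0 (fun x => iter_integral (fun v => F (cons_rV x v))))//; last 2 first.
- exact: measurable_cons_iter.
- by move=> x; apply: iter_integral_ge0.
by rewrite muleA -EFinM detM normrM invfM mulrC.
Qed.

(* Schur complement induction; a zero pivot is first removed by adding a row to
   the first one, which is a translation in the remaining coordinates. *)
Lemma iter_integral_linear (R : realType) n (M : 'M[R]_n)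
    (F : 'rV[R]_n -> \bar R) :
  M \in unitmx -> vmeasurable F -> (forall v, 0 <= F v)%E ->
  iter_integral (fun v => F (v *m M)) =
  ((`|\det M|^-1)%:E * iter_integral F)%E.
Proof.
elim: n M F => [|n ih] M F uM mF F0.
  by rewrite /= det_mx00 normr1 invr1 mul1e mul0mx.
have [M00|] := eqVneq (M 0 0) 0; last first.
  by move=> M00; exact: iter_integral_linear_pivot.
have [i Mi0] : exists i : 'I_n, M (lift ord0 i) 0 != 0.
  apply/existsP; apply: contraT; rewrite negb_exists => /forallP Mi.
  have : M *m delta_mx 0 0 = 0 :> 'cV[R]_n.+1.
    apply/colP => j; rewrite -colE !mxE.
    case: (unliftP ord0 j) => [k|] ->; last exact: M00.
    by apply/eqP; rewrite -[_ == _]negbK; exact: Mi.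
  move=> /(congr1 (mulmx (invmx M))); rewrite mulKmx// mulmx0.
  move=> /colP/(_ 0); rewrite !mxE !eqxx/= => /eqP.
  by rewrite oner_eq0.
pose T := (block_mx (1%:M : 'M[R]_1) (delta_mx 0 i) 0 1%:M : 'M[R]_(1 + n)).
have detT : \det T = 1 by rewrite (@det_ublock _ 1 n) !det1 mulr1.
have T0 : (T *m M) 0 0 != 0.
  suff -> : (T *m M) 0 0 = M (lift ord0 i) 0 by [].
  have TE j : T 0 (lift ord0 j) = (j == i)%:R.
    have -> : lift ord0 j = rshift 1 j :> 'I_n.+1 by exact: val_inj.
    have -> : 0 = @lshift 1 n ord0 :> 'I_n.+1 by exact: val_inj.
    by apply: (etrans (block_mxEur _ _ _ _ _ _)); rewrite mxE.
  rewrite mxE big_ord_recl M00 mulr0 add0r (bigD1 i)//= big1 ?addr0.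
    by rewrite TE eqxx mul1r.
  by move=> j ji; rewrite TE (negbTE ji) mul0r.
have uT : T *m M \in unitmx.
  by rewrite unitmx_mul uM andbT unitmxE detT unitr1.
have := iter_integral_linear_pivot ih T0 uT mF F0.
rewrite det_mulmx detT mul1r => <-.
pose G v := F (v *m M).
have mG : vmeasurable G by exact: vmeasurable_mul.
have G0 v : (0 <= G v)%E by exact: F0.
rewrite /=; apply: eq_integral => x _.
rewrite -(@iter_integral_translate _ _ (fun v => G (cons_rV x v)) (x *: delta_mx 0 i))//; last first.
  exact: vmeasurable_cons1.
apply: eq_iter_integral => v; rewrite /G mulmxA; congr (F (_ *m _)).
rewrite (mul_cons_rV_block x v 1 (delta_mx 0 i) 0 1%:M).
by rewrite mulr1 mulmx0 mxE addr0 mulmx1 addrC.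
Qed.

(** * Sections of the cube *)

Lemma dotrVE (R : realType) n (u v : 'rV[R]_n) : dotrV u v = (u *m v^T) 0 0.
Proof. by rewrite /dotrV !mxE; apply: eq_bigr => i _; rewrite mxE. Qed.

Lemma dotrVC (R : realType) n (u v : 'rV[R]_n) : dotrV u v = dotrV v u.
Proof. by apply: eq_bigr => i _; rewrite mulrC. Qed.

Lemma dotrVDl (R : realType) n (u v w : 'rV[R]_n) :
  dotrV (u + v) w = dotrV u w + dotrV v w.
Proof. by rewrite !dotrVE mulmxDl mxE. Qed.

Lemma dotrVNl (R : realType) n (u w : 'rV[R]_n) : dotrV (- u) w = - dotrV u w.
Proof. by rewrite !dotrVE mulNmx mxE. Qed.

Lemma dotrVZl (R : realType) n k (u w : 'rV[R]_n) :
  dotrV (k *: u) w = k * dotrV u w.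
Proof. by rewrite !dotrVE -scalemxAl mxE. Qed.

Lemma dotrVDr (R : realType) n (u v w : 'rV[R]_n) :
  dotrV w (u + v) = dotrV w u + dotrV w v.
Proof. by rewrite ![dotrV w _]dotrVC dotrVDl. Qed.

Lemma dotrVNr (R : realType) n (u w : 'rV[R]_n) : dotrV w (- u) = - dotrV w u.
Proof. by rewrite ![dotrV w _]dotrVC dotrVNl. Qed.

Lemma dotrVZr (R : realType) n k (u w : 'rV[R]_n) :
  dotrV w (k *: u) = k * dotrV w u.
Proof. by rewrite ![dotrV w _]dotrVC dotrVZl. Qed.

Lemma dotrVBr (R : realType) n (u v w : 'rV[R]_n) :
  dotrV w (u - v) = dotrV w u - dotrV w v.
Proof. by rewrite dotrVDr dotrVNr. Qed.

Definition dotrV_lin := (dotrVDl, dotrVNl, dotrVZl, dotrVDr, dotrVNr, dotrVZr).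

Lemma dotrV_ge0 (R : realType) n (u : 'rV[R]_n) : 0 <= dotrV u u.
Proof. by apply: sumr_ge0 => i _; rewrite -expr2 sqr_ge0. Qed.

Lemma dotrV_eq0 (R : realType) n (u : 'rV[R]_n) : dotrV u u = 0 -> u = 0.
Proof.
move=> /eqP; rewrite psumr_eq0 => [/allP u0|i _]; last by rewrite -expr2 sqr_ge0.
apply/rowP => i; rewrite mxE; have := u0 i (mem_index_enum _).
by rewrite mulf_eq0 orbb => /eqP.
Qed.

Lemma dotrV_gt0 (R : realType) n (u : 'rV[R]_n) : u != 0 -> 0 < dotrV u u.
Proof.
move=> u0; rewrite lt_def dotrV_ge0 andbT; apply: contra u0 => /eqP.
by move=> /dotrV_eq0 ->.
Qed.

Lemma enorm_sqr (R : realType) n (u : 'rV[R]_n) : enorm u ^+ 2 = dotrV u u.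
Proof. by rewrite /enorm sqr_sqrtr ?dotrV_ge0. Qed.

Lemma dotrV_cauchy (R : realType) n (u v : 'rV[R]_n) :
  dotrV u v ^+ 2 <= dotrV u u * dotrV v v.
Proof.
have [->|v0] := eqVneq v 0.
  by rewrite -(scale0r 0) dotrVZr mul0r expr0n mulr_ge0// dotrV_ge0.
have vp := dotrV_gt0 v0.
have := dotrV_ge0 (u - (dotrV u v / dotrV v v) *: v).
rewrite !dotrV_lin [dotrV v u]dotrVC.
rewrite (_ : _ + _ = (dotrV u u * dotrV v v - dotrV u v ^+ 2) / dotrV v v).
  by rewrite pmulr_lge0 ?invr_gt0// subr_ge0.
by field; rewrite gt_eqF.
Qed.

Lemma inf_min (R : realType) (A : set R) (m : R) :
  A m -> lbound A m -> inf A = m.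
Proof.
move=> Am lb; apply/eqP; rewrite eq_le; apply/andP; split.
  by apply: ge_inf => //; exists m.
by apply: lb_le_inf => //; exists m.
Qed.

(** The infimum is attained at the foot of the perpendicular; Cauchy-Schwarz gives the lower
    bound. *)
Lemma edist_to_hyperplane (R : realType) n (e x : 'rV[R]_n) (c : R) :
  e != 0 ->
  edist_to x [set y | dotrV e y = c] = `|dotrV e x - c| / Num.sqrt (dotrV e e).
Proof.
move=> e0; have ep := dotrV_gt0 e0; apply: inf_min.
  exists (x - ((dotrV e x - c) / dotrV e e) *: e) => /=.
    by rewrite !dotrV_lin; field; rewrite gt_eqF.
  rewrite opprB addrC subrK /enorm !dotrV_lin.
  rewrite (_ : _ * _ = (dotrV e x - c) ^+ 2 / dotrV e e); last first.
    by field; rewrite gt_eqF.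
  by rewrite sqrtrM ?sqr_ge0// sqrtr_sqr sqrtrV// ltW.
move=> _ [y /= <- <-]; rewrite ler_pdivrMr ?sqrtr_gt0//.
rewrite -ler_sqr ?nnegrE ?normr_ge0 ?mulr_ge0 ?sqrtr_ge0//.
rewrite real_normK ?num_real// exprMn enorm_sqr sqr_sqrtr ?dotrV_ge0//.
by rewrite -dotrVBr mulrC dotrV_cauchy.
Qed.

(** Polarization: x |-> f x - f 0 preserves scalar products, so the images of the basis vectors are
    the orthonormal rows of L, and the residual f x - f 0 - x L has square norm 0. *)
Lemma isometry_affine (R : realType) m n (f : 'rV[R]_m -> 'rV[R]_n) :
  (forall x y, enorm (f x - f y) = enorm (x - y)) ->
  exists2 L : 'M[R]_(m, n), L *m L^T = 1%:M & forall x, f x = f 0 + x *m L.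
Proof.
move=> fiso.
have [D DE] : exists D, forall x, D x = f x - f 0 by exists (fun x => f x - f 0).
have DD x y : dotrV (D x) (D y) = dotrV x y.
  have sq a b : dotrV (f a - f b) (f a - f b) = dotrV (a - b) (a - b).
    by rewrite -!enorm_sqr fiso.
  have h1 : dotrV (D x) (D x) = dotrV x x by rewrite !DE sq subr0.
  have h2 : dotrV (D y) (D y) = dotrV y y by rewrite !DE sq subr0.
  have h3 : dotrV (D x - D y) (D x - D y) = dotrV (x - y) (x - y).
    by rewrite !DE opprB addrA subrK sq.
  move: h3; rewrite !dotrV_lin h1 h2 [dotrV (D y) _]dotrVC [dotrV y x]dotrVC.
  lra.
pose L := \matrix_(i < m) D (delta_mx 0 i).
have rowL i : row i L = D (delta_mx 0 i) by rewrite rowK.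
have dotL x i : dotrV x (row i L) = (x *m L^T) 0 i.
  by rewrite !mxE; apply: eq_bigr => j _; rewrite !mxE.
have dotd (x : 'rV[R]_m) i : dotrV x (delta_mx 0 i) = x 0 i.
  rewrite /dotrV (bigD1 i)//= mxE !eqxx mulr1 big1 ?addr0// => j ji.
  by rewrite mxE (negbTE ji) andbF mulr0.
have LL : L *m L^T = 1%:M.
  apply/matrixP => i j; have := dotL (row i L) j.
  rewrite -row_mul [RHS]mxE => <-.
  by rewrite !rowL DD dotd !mxE eqxx eq_sym.
exists L => // x; suff /dotrV_eq0 /eqP : dotrV (D x - x *m L) (D x - x *m L) = 0.
  by rewrite subr_eq0 DE subr_eq addrC => /eqP.
have DxL : D x *m L^T = x.
  by apply/rowP => i; rewrite -dotL rowL DD dotd.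
rewrite dotrVE linearB/= trmx_mul mulmxBr !mulmxBl.
rewrite [D x *m (L^T *m _)]mulmxA DxL.
have -> : x *m L *m (D x)^T = x *m x^T.
  by rewrite -mulmxA -[L *m _]trmxK trmx_mul trmxK DxL.
have -> : x *m L *m (L^T *m x^T) = x *m x^T.
  by rewrite mulmxA -[x *m L *m _]mulmxA LL mulmx1.
rewrite subrr subr0 (_ : D x *m (D x)^T = x *m x^T) ?subrr ?mxE//.
by apply/matrixP => i j; rewrite !ord1 -!dotrVE DD.
Qed.

(** The matrix determinant lemma for u = (1, ..., 1): factoring one bordered matrix in two ways
    gives det (1 + u^T u) = 1 + u u^T. *)
Lemma det_addl_ones (R : realType) n :
  \det (1%:M + const_mx 1 : 'M[R]_n) = n.+1%:R.
Proof.
pose u : 'rV[R]_n := const_mx 1.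
pose A : 'M[R]_(1 + n) := block_mx 1%:M (- u) u^T 1%:M.
have uu : u^T *m u = const_mx 1.
  by apply/matrixP => i j; rewrite !mxE big_ord1 !mxE mulr1.
have AL : A = (block_mx 1%:M 0 u^T 1%:M : 'M[R]_(1 + n)) *m
              block_mx 1%:M (- u) 0 (1%:M + u^T *m u).
  rewrite [RHS](@mulmx_block _ 1 n 1 n 1 n).
  rewrite !mul1mx !mulmx1 !mul0mx !addr0 mulmxN.
  by rewrite [_ + (1%:M + _)]addrC addrK.
have AR : A = (block_mx 1%:M (- u) 0 1%:M : 'M[R]_(1 + n)) *m
              block_mx (1%:M + u *m u^T) 0 u^T 1%:M.
  rewrite [RHS](@mulmx_block _ 1 n 1 n 1 n).
  by rewrite !mul1mx !mulmx1 !mul0mx !add0r mulNmx addrK.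
have := congr1 determinant AR; rewrite {1}AL !det_mulmx.
rewrite !(@det_lblock _ 1 n) !(@det_ublock _ 1 n) !det1 !mul1r mulr1 uu => ->.
rewrite det_mx11 !mxE eqxx mulr1n -natr1 addrC; congr (_ + _).
rewrite (eq_bigr (fun=> 1)) => [|i _]; last by rewrite !mxE mulr1.
by rewrite sumr_const card_ord.
Qed.

(* Volume of the slice of the unit n-cube between the levels s - 1 and s of the
   sum of the coordinates. *)
Definition slice_volume (R : realType) (n : nat) (s : R) : \bar R :=
  lebesgue_rV [set v : 'rV[R]_n |
    (forall i, 0 <= v 0 i <= 1) /\ 0 <= s - \sum_i v 0 i <= 1].

Lemma vmeasurable_indic_affine (R : realType) n k (c : 'I_k -> 'rV[R]_n -> R) :
  (forall j d' (X : measurableType d') (w : X -> 'rV[R]_n),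
    (forall i, measurable_fun setT (fun x => w x 0 i)) ->
    measurable_fun setT (fun x => c j (w x))) ->
  vmeasurable (fun v : 'rV[R]_n =>
    (\1_[set v | forall j, 0 <= c j v <= 1] v)%:E).
Proof.
move=> mc d' X phi w mphi mw.
have mB : measurable [set x : X | forall j, 0 <= c j (w x) <= 1].
  have -> : [set x : X | forall j, 0 <= c j (w x) <= 1] =
      \bigcap_(j in [set: 'I_k]) ((fun x => c j (w x)) @^-1` `[0, 1]).
    apply/seteqP; split => x /= H j; first by move=> _; rewrite /= in_itv/= H.
    by have := H j Logic.I; rewrite /= in_itv.
  apply: fin_bigcap_measurable => [|j _]; first exact: finite_finset.
  by rewrite -[X in measurable X]setTI; apply: mc.
apply/measurable_EFinP.
rewrite (_ : (fun x => _) = \1_[set x : X | forall j, 0 <= c j (w x) <= 1])//.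
Qed.

Lemma vmeasurable_slice (R : realType) n (s : R) :
  vmeasurable (fun v : 'rV[R]_n => (\1_[set v : 'rV[R]_n |
    (forall i, 0 <= v 0 i <= 1) /\ 0 <= s - \sum_i v 0 i <= 1] v)%:E).
Proof.
(* Index 0 carries the condition on the sum, the other indices those on the coordinates. *)
pose c (j : 'I_n.+1) (v : 'rV[R]_n) :=
  if unlift ord0 j is Some i then v 0 i else s - \sum_i v 0 i.
have -> : [set v : 'rV[R]_n |
    (forall i, 0 <= v 0 i <= 1) /\ 0 <= s - \sum_i v 0 i <= 1] =
    [set v | forall j, 0 <= c j v <= 1].
  apply/seteqP; split => v /=.
    by move=> [H1 H2] j; rewrite /c; case: unliftP.
  move=> H; split; last by have := H ord0; rewrite /c unlift_none.
  by move=> i; have := H (lift ord0 i); rewrite /c liftK.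
apply: vmeasurable_indic_affine => j d' X w mw; rewrite /c.
case: unliftP => [i _|_]; first exact: mw.
by apply: measurable_funB => //; apply: measurable_sum.
Qed.

(** The rows of L are orthogonal to (1, ..., 1), so the first column of L is determined by the
    remaining block M, and L L^T = 1 becomes M (1 + J) M^T = 1 with J the all-ones matrix. Hence
    (n+1) (det M)^2 = 1, and the change of variables v = x M + b yields the factor sqrt (n+1). The
    coordinate that was dropped is s minus the sum of the others, which is the slab condition of
    [slice_volume]. *)
Lemma isometry_slice (R : realType) n (f : 'rV[R]_n -> 'rV[R]_n.+1) (s : R) :
  (forall x y, enorm (f x - f y) = enorm (x - y)) ->
  (forall x, \sum_i f x 0 i = s) ->
  lebesgue_rV [set x | forall i, 0 <= f x 0 i <= 1] =
  ((Num.sqrt n.+1%:R)%:E * slice_volume n s)%E.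
Proof.
move=> fiso fs; have [L LL fE] := isometry_affine fiso.
pose c : 'cV[R]_n := @lsubmx _ n 1 n L.
pose M : 'M[R]_n := @rsubmx _ n 1 n L.
pose u : 'rV[R]_n := const_mx 1.
have LE : L = (row_mx c M : 'M[R]_(n, 1 + n)) by rewrite -[LHS](@hsubmxK _ n 1 n).
have sumE (x : 'rV[R]_n.+1) : (x *m (const_mx 1 : 'cV[R]_n.+1)) 0 0 = \sum_i x 0 i.
  by rewrite mxE; apply: eq_bigr => i _; rewrite mxE mulr1.
have L1 : L *m (const_mx 1 : 'cV[R]_n.+1) = 0.
  apply/colP => i; rewrite [RHS]mxE.
  have := fs (delta_mx 0 i); rewrite -(fs 0) -!sumE fE mulmxDl mxE.
  move=> /(canRL (addKr _)); rewrite addNr -mulmxA -rowE [LHS]mxE => <-.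
  by [].
have cM : c = - (M *m u^T).
  apply/eqP; rewrite -addr_eq0; apply/eqP; rewrite -L1 LE.
  have -> : (const_mx 1 : 'cV[R]_n.+1) = (col_mx 1%:M u^T : 'cV[R]_(1 + n)).
    apply/colP => i; rewrite mxE; case: (@split_ordP 1 n i) => j ->.
      by symmetry; apply: (etrans (col_mxEu _ _ _ _)); rewrite mxE ord1.
    by symmetry; apply: (etrans (col_mxEd _ _ _ _)); rewrite !mxE.
  by symmetry; apply: (etrans (@mul_row_col _ n 1 n 1 _ _ _ _)); rewrite mulmx1.
have MM : M *m (1%:M + const_mx 1) *m M^T = 1%:M.
  transitivity (L *m L^T); last exact: LL.
  rewrite LE [(row_mx c M : 'M[R]_(n, 1 + n))^T](@tr_row_mx _ n 1 n).
  rewrite [RHS](@mul_row_col _ n 1 n n) cM mulmxDr mulmx1 mulmxDl addrC.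
  congr (_ + _); rewrite linearN/= mulNmx mulmxN opprK trmx_mul trmxK.
  rewrite !mulmxA; congr (_ *m _); rewrite -mulmxA; congr (_ *m _).
  by apply/matrixP => i j; rewrite !mxE big_ord1 !mxE mulr1.
have detM : n.+1%:R * \det M ^+ 2 = 1.
  have := congr1 determinant MM.
  rewrite !det_mulmx det_tr det_addl_ones det1 => H; rewrite -[RHS]H.
  by rewrite expr2 mulrCA mulrA.
have uM : M \in unitmx.
  rewrite unitmxE unitfE; apply/eqP => M0; move: detM.
  by rewrite M0 expr0n mulr0 => /esym/eqP; rewrite oner_eq0.
have detMV : `|\det M|^-1 = Num.sqrt n.+1%:R.
  rewrite -sqrtr_sqr -sqrtrV ?sqr_ge0//; congr Num.sqrt.
  have M0 : \det M ^+ 2 != 0.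
    by apply/eqP => M0; move: detM; rewrite M0 mulr0 => /esym/eqP; rewrite oner_eq0.
  by apply: (mulIf M0); rewrite mulVf.
pose b : 'rV[R]_n := @rsubmx _ 1 1 n (f 0).
have fS x j : f x 0 (lift ord0 j) = (x *m M + b) 0 j.
  rewrite fE mxE addrC [RHS]mxE; congr (_ + _); last first.
    by rewrite mxE; congr (f 0 _ _); exact: val_inj.
  rewrite !mxE; apply: eq_bigr => k _; rewrite mxE; congr (_ * L _ _).
  exact: val_inj.
have f0 x : f x 0 ord0 = s - \sum_j (x *m M + b) 0 j.
  rewrite -(fs x) big_ord_recl.
  by under [X in _ - X]eq_bigr do rewrite -fS; rewrite addrK.
pose F (v : 'rV[R]_n) : \bar R := (\1_[set v : 'rV[R]_n |
    (forall i, 0 <= v 0 i <= 1) /\ 0 <= s - \sum_i v 0 i <= 1] v)%:E.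
have mF : vmeasurable F by exact: vmeasurable_slice.
have F0 v : (0 <= F v)%E by rewrite lee_fin.
rewrite lebesgue_rVE /slice_volume lebesgue_rVE -/F -detMV.
rewrite -(@iter_integral_translate _ _ F b)//.
rewrite -(@iter_integral_linear _ _ M (fun v => F (v + b)))//; last first.
  have := vmeasurable_affine 1%:M b mF.
  by rewrite (_ : (fun v => F (v *m 1%:M + b)) = (fun v => F (v + b)))//;
    apply/funext => v; rewrite mulmx1.
apply: eq_iter_integral => x; rewrite /F !indicE; congr (_%:R%:E).
congr nat_of_bool; apply/idP/idP; rewrite !inE/=.
  by move=> H; split => [i|]; [rewrite -fS|rewrite -f0].
move=> [H1 H2] i; case: (unliftP ord0 i) => [j|] ->; last by rewrite f0.
by rewrite fS.
Qed.

Lemma dotrV_vertex_sqr (R : realType) d (p : 'rV[R]_d) : cube_vertex p ->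
  dotrV (opposite_vertex p - p) (opposite_vertex p - p) = d%:R.
Proof.
move=> vp; rewrite /dotrV (eq_bigr (fun=> 1)) ?sumr_const ?card_ord// => i _.
by rewrite !mxE; case: (vp i) => ->; ring.
Qed.

(** The component w of e orthogonal to the normal a is a direction of H, hence orthogonal to e by
    hypothesis; so w = 0 and e is a multiple of a. *)
Lemma orthogonal_hyperplane_eq (R : realType) d (H : set 'rV[R]_d)
    (e : 'rV[R]_d) :
  is_hyperplane H -> (forall x y, H x -> H y -> dotrV (x - y) e = 0) -> e != 0 ->
  exists c, H = [set x | dotrV e x = c].
Proof.
move=> [a [c [a0 ->]]] orth e0.
have ap := dotrV_gt0 a0; have a1 : dotrV a a != 0 by rewrite gt_eqF.
pose x0 := (c / dotrV a a) *: a.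
have x0H : dotrV a x0 = c by rewrite dotrVZr; field.
have eE : e = (dotrV a e / dotrV a a) *: a.
  apply/eqP; rewrite -subr_eq0; apply/eqP; apply: dotrV_eq0.
  set w := e - _; have wa : dotrV a w = 0.
    by rewrite /w dotrVBr dotrVZr; field.
  have := orth (x0 + w) x0; rewrite /= dotrVDr x0H wa addr0 => /(_ erefl erefl).
  rewrite [x0 + w]addrC addrK => we.
  by rewrite {2}/w dotrVBr we dotrVZr [dotrV w a]dotrVC wa mulr0 subr0.
have k0 : dotrV a e / dotrV a a != 0.
  by apply: contra e0 => /eqP k0; rewrite eE k0 scale0r.
exists (dotrV a e / dotrV a a * c); apply/seteqP; split => x /=.
  by move=> <-; rewrite {1}eE dotrVZl.
by rewrite {1}eE dotrVZl => /(mulfI k0).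
Qed.

(** The symmetry of the cube replacing x_i by 1 - x_i where p_i = 1. It carries the diagonal issued
    from p to the main diagonal, so that scalar products with the diagonal become coordinate
    sums. *)
Definition cube_flip (R : realType) d (p x : 'rV[R]_d) : 'rV[R]_d :=
  \row_i (p 0 i + (opposite_vertex p - p) 0 i * x 0 i).

Lemma cube_flipE (R : realType) d (p x : 'rV[R]_d) i : cube_vertex p ->
  (0 <= cube_flip p x 0 i <= 1) = (0 <= x 0 i <= 1).
Proof.
move=> vp; rewrite !mxE; case: (vp i) => ->; first by rewrite add0r !subr0 mul1r.
by rewrite (_ : 1 + _ = 1 - x 0 i); [apply/idP/idP => /andP[? ?]; apply/andP; lra|ring].
Qed.

Lemma enorm_cube_flip (R : realType) d (p x y : 'rV[R]_d) : cube_vertex p ->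
  enorm (cube_flip p x - cube_flip p y) = enorm (x - y).
Proof.
move=> vp; rewrite /enorm; congr Num.sqrt; apply: eq_bigr => i _.
by rewrite !mxE; case: (vp i) => ->; ring.
Qed.

Lemma sum_cube_flip (R : realType) d (p x : 'rV[R]_d) : cube_vertex p ->
  \sum_i cube_flip p x 0 i =
  d%:R / 2 + dotrV (opposite_vertex p - p) x
           - dotrV (opposite_vertex p - p) (@cube_center R d).
Proof.
move=> vp; rewrite /dotrV -addrA -sumrB.
have -> : d%:R / 2 = \sum_(i < d) (2^-1 : R).
  by rewrite sumr_const card_ord -[2^-1 *+ _]mulr_natl.
rewrite -big_split; apply: eq_bigr => i _.
by rewrite /cube_flip /opposite_vertex /cube_center /= !mxE; field.
Qed.

Lemma diag_section_volumeE (R : realType) n (t : R) (v : \bar R) :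
  is_diag_section_volume n.+1 t v ->
  v = ((Num.sqrt n.+1%:R)%:E *
       slice_volume n (n.+1%:R / 2 + Num.sqrt n.+1%:R * t))%E.
Proof.
move=> [H [hypH [p [vp orth]] edistH [f [fiso rangef ->]]]].
(* Of the two ends of the diagonal, q is the one for which the level of H is at least that of the
   centre; this removes the absolute value from the distance. *)
have [q [vq [orthq sq]]] : exists q : 'rV[R]_n.+1, cube_vertex q /\
    (forall x y, H x -> H y -> dotrV (x - y) (opposite_vertex q - q) = 0) /\
    (forall x, H x -> dotrV (opposite_vertex q - q) (@cube_center R n.+1) <=
                     dotrV (opposite_vertex q - q) x).
  have oppE : opposite_vertex (opposite_vertex p) - opposite_vertex p =
      - (opposite_vertex p - p).
    by rewrite /opposite_vertex; apply/rowP => i; rewrite !mxE; ring.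
  have vop : cube_vertex (opposite_vertex p).
    by move=> i; rewrite /opposite_vertex !mxE; case: (vp i) => ->;
      rewrite ?subrr ?subr0; [right|left].
  have Hf0 : H (f 0) by rewrite -rangef; exists 0.
  have orth0 x : H x -> dotrV (opposite_vertex p - p) x =
      dotrV (opposite_vertex p - p) (f 0).
    move=> Hx; apply/eqP; rewrite -subr_eq0 -dotrVBr dotrVC.
    by rewrite orth.
  have [le|ge] := leP (dotrV (opposite_vertex p - p) (@cube_center R n.+1))
                 (dotrV (opposite_vertex p - p) (f 0)).
    by exists p; split=> //; split => // x Hx; rewrite [leRHS]orth0.
  exists (opposite_vertex p); split=> //; split.
    by move=> x y Hx Hy; rewrite oppE dotrVNr orth// oppr0.
  move=> x Hx; rewrite oppE !dotrVNl lerN2 [leLHS]orth0//; exact: ltW.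
set e := opposite_vertex q - q in orthq sq *.
have ee : dotrV e e = n.+1%:R by exact: dotrV_vertex_sqr.
have e0 : e != 0.
  by apply/eqP => e0; move: ee; rewrite e0 /dotrV big1 => [/esym/eqP|i _];
     rewrite ?mxE ?mul0r// pnatr_eq0.
have [c HE] := orthogonal_hyperplane_eq hypH orthq e0.
have Hf x : H (f x) by rewrite -rangef; exists x.
have fc x : dotrV e (f x) = c by have := Hf x; rewrite HE.
have cE : c - dotrV e (@cube_center R n.+1) = Num.sqrt n.+1%:R * t.
  move: edistH; rewrite HE edist_to_hyperplane// ee => <-.
  rewrite ler0_norm; last by rewrite subr_le0 -(fc 0); exact: sq.
  by rewrite opprB mulrC divfK// gt_eqF// sqrtr_gt0.
pose g x := cube_flip q (f x).
have -> : f @^-1` (H `&` @cube R n.+1) = [set x | forall i, 0 <= g x 0 i <= 1].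
  apply/seteqP; split => x /=.
    by move=> [_ cx] i; rewrite /g cube_flipE//; exact: cx.
  by move=> cx; split; [exact: Hf|move=> i; rewrite -(@cube_flipE _ _ q)//; exact: cx].
apply: isometry_slice => [x y|x]; first by rewrite /g enorm_cube_flip.
by rewrite /g sum_cube_flip// -/e fc -addrA cE.
Qed.

(* A Householder reflection: the rows of the result after the first one span
   the orthogonal complement of u. *)
Lemma unit_row_orthogonal_mx (R : realType) n (u : 'rV[R]_n.+1) :
  dotrV u u = 1 ->
  exists2 Q : 'M[R]_n.+1, Q *m Q^T = 1%:M & row 0 Q = u.
Proof.
move=> uu; pose e : 'rV[R]_n.+1 := delta_mx 0 0.
have [w wE] : exists w : 'rV[R]_n.+1, w = u - e by exists (u - e).
have dote x : dotrV e x = x 0 0.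
  rewrite /dotrV (bigD1 ord0)//= mxE !eqxx mul1r big1 ?addr0// => j j0.
  by rewrite mxE (negbTE j0) andbF mul0r.
have [w0|w0] := eqVneq w 0.
  exists 1%:M; first by rewrite trmx1 mulmx1.
  by rewrite row1; apply/esym/eqP; rewrite -subr_eq0 -/e -wE w0.
have ww : dotrV w w != 0 by rewrite gt_eqF// dotrV_gt0.
pose k := 2 / dotrV w w; pose Q : 'M[R]_n.+1 := 1%:M - k *: (w^T *m w).
have QT : Q^T = Q.
  by rewrite /Q linearB/= linearZ/= trmx_mul trmxK trmx1.
have wwT : w *m w^T = (dotrV w w)%:M by rewrite [LHS]mx11_scalar -dotrVE.
exists Q.
  rewrite QT /Q mulmxBl !mulmxBr !mul1mx !mulmx1.
  rewrite -scalemxAl -scalemxAr mulmxA -[w^T *m w *m w^T]mulmxA wwT.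
  rewrite mul_mx_scalar -!scalemxAl !scalerA.
  rewrite (_ : k * (k * dotrV w w) = 2 * k); last by rewrite /k; field.
  by rewrite (_ : 2 * k = k + k) ?scalerDl ?opprB ?addrK ?subrK//; ring.
rewrite rowE -/e /Q mulmxBr mulmx1 -scalemxAr mulmxA.
rewrite [e *m w^T]mx11_scalar -dotrVE dote mul_scalar_mx scalerA.
have -> : k * w 0 0 = -1.
  rewrite /k; have -> : dotrV w w = - 2 * w 0 0.
    rewrite wE !dotrV_lin uu [dotrV u e]dotrVC !dote !mxE !eqxx /=.
    by ring.
  have w00 : w 0 0 != 0.
    apply: contra ww => /eqP w00; rewrite wE !dotrV_lin uu [dotrV u e]dotrVC !dote.
    move: w00; rewrite wE !mxE !eqxx /= => w00; apply/eqP; move: w00; lra.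
  by field.
by rewrite scaleN1r opprK wE addrC subrK.
Qed.

(** Guarantees that [xget] does not fall back on its default value. The witness is orthogonal to the
    main diagonal; the rows of an orthogonal matrix after the normalized diagonal give the isometric
    parametrization of the hyperplane through x0. *)
Lemma diag_section_exists (R : realType) n (t : R) : 0 <= t ->
  exists v, is_diag_section_volume n.+1 t v.
Proof.
move=> t0; pose r : R := Num.sqrt n.+1%:R.
have r2 : r ^+ 2 = n.+1%:R by rewrite sqr_sqrtr.
have rp : 0 < r by rewrite sqrtr_gt0.
pose u : 'rV[R]_n.+1 := const_mx r^-1.
have uu : dotrV u u = 1.
  rewrite /dotrV (eq_bigr (fun=> r^-2)) => [|i _]; last by rewrite !mxE expr2 invfM.
  by rewrite sumr_const card_ord -mulr_natl -r2 mulfV// gt_eqF// exprn_gt0.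
have [Q QQ Q0] := unit_row_orthogonal_mx uu.
have QTQ : Q^T *m Q = 1%:M by exact: mulmx1C.
pose L : 'M[R]_(n, n.+1) := \matrix_(i < n) row (lift ord0 i) Q.
have LL : L *m L^T = 1%:M.
  apply/matrixP => i j.
  have := congr1 (fun A : 'M[R]_n.+1 => A (lift ord0 i) (lift ord0 j)) QQ.
  rewrite !mxE (inj_eq lift_inj) => <-; apply: eq_bigr => k _.
  by rewrite !mxE.
pose e : 'rV[R]_n.+1 := const_mx 1.
have eu : e = r *: u by apply/rowP => i; rewrite !mxE mulfV// gt_eqF.
have eL y : dotrV e (y *m L) = 0.
  rewrite eu dotrVZl dotrVC dotrVE -Q0 -mulmxA mxE big1 ?mulr0// => j _.
  rewrite mxE [X in _ * X](_ : _ = (Q *m Q^T) (lift ord0 j) 0).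
    by rewrite QQ mxE mulr0.
  by rewrite !mxE; apply: eq_bigr => k _; rewrite !mxE.
pose c : R := n.+1%:R / 2 + r * t.
pose x0 : 'rV[R]_n.+1 := (c / n.+1%:R) *: e.
have ee : dotrV e e = n.+1%:R.
  rewrite /dotrV (eq_bigr (fun=> 1)) => [|i _]; last by rewrite !mxE mulr1.
  by rewrite sumr_const card_ord.
have e0 : e != 0.
  by apply/eqP => /rowP/(_ 0); rewrite !mxE => /eqP; rewrite oner_eq0.
have ex0 : dotrV e x0 = c by rewrite dotrVZr ee; field.
pose H := [set x : 'rV[R]_n.+1 | dotrV e x = c].
pose f (y : 'rV[R]_n) : 'rV[R]_n.+1 := x0 + y *m L.
exists (lebesgue_rV (f @^-1` (H `&` @cube R n.+1))), H; split.
- by exists e, c.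
- exists 0; split; first by move=> i; left; rewrite mxE.
  move=> x y Hx Hy; rewrite /opposite_vertex !subr0 -/e dotrVC dotrVBr.
  by rewrite (Hx : _ = _) (Hy : _ = _) subrr.
- rewrite edist_to_hyperplane// ee -/r.
  have -> : dotrV e (@cube_center R n.+1) = n.+1%:R / 2.
    rewrite /dotrV (eq_bigr (fun=> 2^-1)) => [|i _]; last by rewrite !mxE mul1r.
    by rewrite sumr_const card_ord -[2^-1 *+ _]mulr_natl.
  rewrite /c opprD addrA subrr add0r normrN ger0_norm ?(mulr_ge0 (ltW rp) t0)//.
  by rewrite mulrC mulKf// gt_eqF.
- exists f; split => //.
    move=> x y; rewrite /f opprD addrACA subrr add0r -mulmxBl.
    by rewrite /enorm !dotrVE trmx_mul mulmxA -[_ *m L *m _]mulmxA LL mulmx1.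
  apply/seteqP; split.
    by move=> _ [y _ <-]; rewrite /H /f /= dotrVDr eL addr0 ex0.
  move=> x Hx; pose z := (x - x0) *m Q^T.
  have z0 : z 0 0 = 0.
    have -> : z 0 0 = dotrV (x - x0) u.
      rewrite -Q0 dotrVE /z !mxE; apply: eq_bigr => k _.
      by rewrite !mxE.
    have : dotrV e (x - x0) = 0 by rewrite dotrVBr ex0 (Hx : _ = _) subrr.
    by rewrite eu dotrVZl dotrVC => /eqP; rewrite mulf_eq0 gt_eqF//= => /eqP.
  exists (\row_j z 0 (lift ord0 j)) => //.
  have zQ : x - x0 = z *m Q by rewrite /z -mulmxA QTQ mulmx1.
  rewrite /f; apply/eqP; rewrite addrC eq_sym -subr_eq zQ; apply/eqP/rowP => i.
  rewrite !mxE big_ord_recl z0 mul0r add0r; apply: eq_bigr => j _.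
  by rewrite !mxE.
Qed.

Lemma diag_volumeE (R : realType) n (t : R) : 0 <= t ->
  diag_volume n.+1 t = ((Num.sqrt n.+1%:R)%:E *
       slice_volume n (n.+1%:R / 2 + Num.sqrt n.+1%:R * t))%E.
Proof.
move=> t0; apply: diag_section_volumeE; rewrite /diag_volume.
have [v Hv] := diag_section_exists n t0.
exact: (@xgetPex _ 0%E _ (ex_intro _ v Hv)).
Qed.

(** * The Irwin-Hall density *)

Lemma integral_itv_derive (R : realType) (F f : R -> R) (a b : R) : a <= b ->
  (forall x : R, is_derive x 1 F (f x)) -> continuous f ->
  (\int[@lebesgue_measure R]_(x in `[a, b]) (f x)%:E = (F b - F a)%:E)%E.
Proof.
rewrite le_eqVlt => /predU1P[<-|ab] dF cf.
  by rewrite set_itv1 integral_set1 subrr.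
have cF : continuous F.
  move=> x; apply: differentiable_continuous.
  by apply/derivable1_diffP; apply: ex_derive.
rewrite EFinB; apply: continuous_FTC2 => //.
- exact: continuous_subspaceT.
- split.
  + by move=> x _; apply: ex_derive.
  + by apply: cvg_at_right_filter; exact: cF.
  + by apply: cvg_at_left_filter; exact: cF.
- by move=> x _; rewrite derive1E; apply: derive_val.
Qed.

(** The truncated power y_+^n, except that n = 0 gives the constant 1 because 0^0 = 1; hence the
    exponents n.+1 below. *)
Definition pospow (R : realType) (n : nat) (y : R) : R := Num.max y 0 ^+ n.

Lemma pospow_ge (R : realType) n (y : R) : 0 <= y -> pospow n y = y ^+ n.
Proof. by move=> y0; rewrite /pospow max_l. Qed.

Lemma pospow_le (R : realType) n (y : R) : y <= 0 -> pospow n.+1 y = 0.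
Proof. by move=> y0; rewrite /pospow max_r// expr0n. Qed.

Lemma continuous_pospow (R : realType) n : continuous (@pospow R n).
Proof.
move=> x; apply: (@continuous_comp _ _ _ (fun y : R => Num.max y 0) (fun y => y ^+ n)).
  by apply: continuous_max => //; exact: cst_continuous.
exact: exprn_continuous.
Qed.

(** This and the next rules are stated on explicit functions, so that a derivative is assembled as a
    term following the shape of the function and its value is adjusted at the end. *)
Lemma is_derive_val (R : realType) (f : R -> R) (x a b : R) :
  is_derive x 1 f a -> a = b -> is_derive x 1 f b.
Proof. by move=> fa <-. Qed.

Lemma is_derive_add (R : realType) (f g : R -> R) (x a b : R) :
  is_derive x 1 f a -> is_derive x 1 g b ->
  is_derive x 1 (fun y => f y + g y) (a + b).
Proof. by move=> fa gb; exact: (is_deriveD fa gb). Qed.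

Lemma is_derive_sub (R : realType) (f g : R -> R) (x a b : R) :
  is_derive x 1 f a -> is_derive x 1 g b ->
  is_derive x 1 (fun y => f y - g y) (a - b).
Proof. by move=> fa gb; exact: (is_deriveB fa gb). Qed.

Lemma is_derive_opp (R : realType) (f : R -> R) (x a : R) :
  is_derive x 1 f a -> is_derive x 1 (fun y => - f y) (- a).
Proof. by move=> fa; exact: (is_deriveN fa). Qed.

Lemma is_derive_mul (R : realType) (f g : R -> R) (x a b : R) :
  is_derive x 1 f a -> is_derive x 1 g b ->
  is_derive x 1 (fun y => f y * g y) (f x * b + g x * a).
Proof. by move=> fa gb; exact: (is_deriveM fa gb). Qed.

Lemma is_derive_const (R : realType) (x a : R) :
  is_derive x 1 (fun=> a) (0 : R).
Proof. exact: is_derive_cst. Qed.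

Lemma is_derive_var (R : realType) (x : R) : is_derive x 1 (fun y : R => y) (1 : R).
Proof. exact: is_derive_id. Qed.

Lemma is_derive_scale (R : realType) (f : R -> R) (x c a : R) :
  is_derive x 1 f a -> is_derive x 1 (fun y => c * f y) (c * a).
Proof.
move=> fa; apply: (is_derive_eq (is_derive_mul (is_derive_const x c) fa)).
by rewrite mulr0 addr0.
Qed.

Lemma is_derive_compose (R : realType) (f g : R -> R) (x a b : R) :
  is_derive x 1 g b -> is_derive (g x) 1 f a ->
  is_derive x 1 (fun y => f (g y)) (a * b).
Proof. by move=> gb fa; exact: (is_derive1_comp fa gb). Qed.

Lemma is_derive_exprn (R : realType) n (x : R) :
  is_derive x 1 (fun y : R => y ^+ n.+1) (n.+1%:R * x ^+ n).
Proof.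
have -> : (fun y : R => y ^+ n.+1) = (id : R -> R) ^+ n.+1.
  by rewrite exprfctE.
by apply: is_derive_eq; rewrite /GRing.scale/= mulr1 mulr_natl.
Qed.

(** Away from 0 the function is locally zero or a monomial. At 0 Caratheodory's criterion applies,
    with slope function [pospow n.+1]. *)
Lemma is_derive_pospow (R : realType) n (x : R) :
  is_derive x 1 (@pospow R n.+2) (n.+2%:R * pospow n.+1 x).
Proof.
have [x0|x0|->] := ltgtP x 0.
- rewrite pospow_le ?ltW// mulr0.
  have H : \near x, cst 0 x = pospow n.+2 x.
    by near=> z; rewrite pospow_le// ltW//; near: z; exact: lt_nbhsl.
  exact: (near_eq_is_derive H).
- rewrite pospow_ge ?ltW//.
  have H : \near x, x ^+ n.+2 = pospow n.+2 x.
    by near=> z; rewrite pospow_ge// ltW//; near: z; exact: lt_nbhsr.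
  apply: (near_eq_is_derive H).
  exact: is_derive_exprn.
- rewrite pospow_le// mulr0; apply/is_derive1_caratheodory.
  exists (pospow n.+1); split; last by rewrite pospow_le.
    move=> z; rewrite [pospow _ 0]pospow_le// !subr0; have [z0|z0] := leP 0 z.
      by rewrite !pospow_ge// exprSr.
    by rewrite !pospow_le ?ltW// mul0r.
  exact: continuous_pospow.
Unshelve. all: by end_near. Qed.

(* Density of the sum of n+1 independent uniform variables on [0, 1]
   (Irwin-Hall), for n > 0. *)
Definition irwin_hall (R : realType) (n : nat) (s : R) : R :=
  (\sum_(k < n.+2) (-1) ^+ k * 'C(n.+1, k)%:R * pospow n (s - k%:R)) / n`!%:R.

(** Pascal's rule: a difference of step 1 turns the alternating binomial sum of order n+1 into the
    one of order n+2. *)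
Lemma pascal_alternating (R : realType) n (f : nat -> R) :
  \sum_(k < n.+2) (-1) ^+ k * 'C(n.+1, k)%:R * (f k - f k.+1) =
  \sum_(k < n.+3) (-1) ^+ k * 'C(n.+2, k)%:R * f k.
Proof.
under eq_bigr do rewrite mulrBr.
rewrite sumrB [RHS]big_ord_recl bin0.
have -> : \sum_(i < n.+2) (-1) ^+ lift ord0 i * 'C(n.+2, lift ord0 i)%:R *
      f (lift ord0 i) =
    \sum_(i < n.+2) ((-1) ^+ i.+1 * 'C(n.+1, i.+1)%:R * f i.+1 -
                     (-1) ^+ i * 'C(n.+1, i)%:R * f i.+1) :> R.
  by apply: eq_bigr => i _; rewrite /= /bump/= add1n binS natrD exprS; ring.
rewrite sumrB addrA; congr (_ - _).
rewrite big_ord_recl/= bin0 expr0 !mulr1; congr (_ + _).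
rewrite [RHS]big_ord_recr/= [in RHS]bin_small// mulr0 mul0r addr0.
by apply: eq_bigr.
Qed.

(** Convolution with the uniform density. Integrating in x raises the degree of the truncated powers
    by one, and the increment between 0 and 1 is a difference of step 1, absorbed by
    [pascal_alternating]. *)
Lemma integral_irwin_hall (R : realType) n (s : R) :
  (\int[@lebesgue_measure R]_(x in `[0%R, 1%R])
     (irwin_hall n.+1 (s - x)%R)%:E = (irwin_hall n.+2 s)%:E)%E.
Proof.
pose F (x : R) : R := - (\sum_(k < n.+3) (-1) ^+ k * 'C(n.+2, k)%:R *
  pospow n.+2 (s - x - k%:R)) / n.+2`!%:R.
have dF (x : R) : is_derive x 1 F (irwin_hall n.+1 (s - x)).
  rewrite /irwin_hall.
  have D (k : 'I_n.+3) : is_derive x 1 (fun x : R => (-1) ^+ k * 'C(n.+2, k)%:R *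
      pospow n.+2 (s - x - k%:R))
      ((-1) ^+ k * 'C(n.+2, k)%:R * - (n.+2%:R * pospow n.+1 (s - x - k%:R))).
    have D1 : is_derive x 1 (fun x : R => s - x - k%:R) (-1).
      apply: (is_derive_val (is_derive_sub (is_derive_sub (is_derive_const x s)
        (is_derive_var x)) (is_derive_const x k%:R))).
      by rewrite subr0 sub0r.
    have D2 := is_derive_pospow n (s - x - k%:R).
    apply: (is_derive_val (is_derive_scale ((-1) ^+ k * 'C(n.+2, k)%:R)
      (is_derive_compose D1 D2))).
    by rewrite mulrN1.
  have -> : F = (fun x => - n.+2`!%:R^-1 *
     (\sum_(k < n.+3) (fun x : R => (-1) ^+ k * 'C(n.+2, k)%:R *
      pospow n.+2 (s - x - k%:R)) : R -> R) x).
    by apply/funext => y; rewrite /F fct_sumE; ring.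
  apply: (is_derive_val (is_derive_scale _ (is_derive_sum D))).
  rewrite mulr_suml mulr_sumr.
  apply: eq_bigr => k _; rewrite [in RHS]mulrAC factS natrM; field.
  by rewrite -natrD !pnatr_eq0 -lt0n fact_gt0.
have cf : continuous (fun x => irwin_hall n.+1 (s - x)).
  move=> x; rewrite /irwin_hall; apply: cvgM; last exact: cvg_cst.
  apply: cvg_big => [|k _]; first exact: add_continuous.
  apply: cvgM; first exact: cvg_cst.
  apply: (@continuous_comp _ _ _ (fun x : R => s - x - k%:R) (pospow n.+1)); last first.
    exact: continuous_pospow.
  by apply: cvgB; [apply: cvgB => //|]; exact: cvg_cst.
rewrite (integral_itv_derive ler01 dF cf).
congr EFin; rewrite /F /irwin_hall -mulrBl opprK addrC; congr (_ / _).
rewrite -(pascal_alternating n.+1 (fun k => pospow n.+2 (s - k%:R))) -sumrB.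
apply: eq_bigr => k _; rewrite -mulrBr; congr (_ * (pospow _ _ - pospow _ _)).
  by rewrite subr0.
by rewrite -natr1; ring.
Qed.

Lemma iter_integral0 (R : realType) n :
  iter_integral (fun _ : 'rV[R]_n => 0%E) = 0%E.
Proof. by elim: n => //= n ih; under eq_integral do rewrite ih; rewrite integral0. Qed.

Lemma slice_volume0 (R : realType) (s : R) :
  slice_volume 0 s = (\1_`[0, 1] s)%:E.
Proof.
rewrite /slice_volume /=; congr (_%:E); rewrite !indicE; congr (_%:R).
congr nat_of_bool; apply/idP/idP; rewrite !inE/= in_itv/= big_ord0 subr0.
  by case.
by move=> H; split => // -[].
Qed.

Lemma sum_cons_rV (R : realType) n (x : R) (v : 'rV[R]_n) :
  \sum_i cons_rV x v 0 i = x + \sum_i v 0 i.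
Proof.
rewrite big_ord_recl cons_rV0; congr (_ + _).
by apply: eq_bigr => i _; rewrite cons_rVS.
Qed.

Lemma slice_volumeS (R : realType) n (s : R) :
  (slice_volume n.+1 s =
   \int[@lebesgue_measure R]_(x in `[0%R, 1%R]) slice_volume n (s - x)%R)%E.
Proof.
rewrite {1}/slice_volume /= [RHS]integral_mkcond; apply: eq_integral => x _.
rewrite patchE; case: ifPn.
  move=> /set_mem; rewrite /= in_itv/= => x01; congr lebesgue_rV.
  apply/seteqP; split => v; rewrite /= -/(cons_rV x v) sum_cons_rV.
    move=> [vi]; rewrite opprD addrA => vs; split => // i.
    by have := vi (lift ord0 i); rewrite cons_rVS.
  move=> [vi vs]; split; last by rewrite opprD addrA.
  by move=> i; case: (unliftP ord0 i) => [j|] ->; rewrite ?cons_rVS ?cons_rV0.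
move=> /negP x01; rewrite lebesgue_rVE -[RHS](iter_integral0 R n).
apply: eq_iter_integral => v; rewrite indicE memNset// => -[vi _].
by apply: x01; apply/mem_set; rewrite /= in_itv/=; have := vi ord0; rewrite cons_rV0.
Qed.

Lemma irwin_hall1 (R : realType) (s : R) :
  irwin_hall 1 s = Num.max s 0 - 2 * Num.max (s - 1) 0 + Num.max (s - 2) 0.
Proof.
rewrite /irwin_hall !big_ord_recl big_ord0 /= /bump /= /pospow.
by rewrite !expr1 subr0 bin0 binn (_ : 'C(2, 1) = 2)// factS fact0; field.
Qed.

(** Both sides obey the same recursion. It starts at dimension 1, where the volume is the length of
    the overlap of [0, 1] and [s - 1, s]. *)
Lemma slice_volumeE (R : realType) n (s : R) :
  slice_volume n.+1 s = (irwin_hall n.+1 s)%:E.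
Proof.
elim: n s => [|n ih] s; rewrite slice_volumeS; last first.
  by under eq_integral do rewrite ih; exact: integral_irwin_hall.
under eq_integral do rewrite slice_volume0.
transitivity (\int[@lebesgue_measure R]_(x in `[0%R, 1%R])
    (\1_(`[(s - 1)%R, s]%classic : set R) x)%:E)%E.
  apply: eq_integral => x _; rewrite !indicE !mem_setE; congr (_%:R%:E).
  by congr nat_of_bool; apply/idP/idP; rewrite !in_itv/= => /andP[? ?]; apply/andP; lra.
rewrite integral_indic//=.
rewrite (_ : _ `&` _ = `[Num.max 0 (s - 1), Num.min 1 s]%classic); last first.
  apply/seteqP; split => x /=; rewrite !in_itv/= ge_max le_min.
    by move=> [/andP[-> ->] /andP[-> ->]].
  by move=> /andP[/andP[-> ->] /andP[-> ->]].
rewrite lebesgue_measure_itv /= lte_fin irwin_hall1 gt_max !lt_min -EFinB.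
rewrite /Num.max /Num.min.
case: ifPn; do ?case: ifPn; rewrite ?negb_and -?leNgt => *; congr EFin;
  do ?[match goal with H : is_true (_ && _) |- _ => move: H => /andP[? ?] end];
  do ?[match goal with H : is_true (_ || _) |- _ => move: H => /orP[?|?] end];
  lra.
Qed.

(** * Gaussian and sinc integrals *)

Lemma integral_lorentz (R : realType) :
  (\int[@lebesgue_measure R]_u ((1 + u ^+ 2)^-1)%:E = pi%:E)%E.
Proof.
rewrite (ge0_symfun_integralT (f := fun u : R => (1 + u ^+ 2)^-1)).
- rewrite (_ : [set x | _] = `[0, +oo[%classic); last first.
    by apply/seteqP; split => x/=; rewrite in_itv/= andbT.
  have := integral0y_oneDsqr R; rewrite /oneDsqr => ->.
  by rewrite -EFinM mulrCA divff// mulr1.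
- by move=> x; rewrite invr_ge0 addr_ge0// sqr_ge0.
- by move=> x; exact: continuous_oneDsqrV.
- by move=> x; rewrite /= sqrrN.
Qed.

Lemma integrable_lorentz (R : realType) :
  (@lebesgue_measure R).-integrable setT (EFin \o (fun u : R => (1 + u ^+ 2)^-1)).
Proof.
have mf : measurable_fun [set: R] (fun u : R => (1 + u ^+ 2)^-1).
  by apply: continuous_measurable_fun => x; exact: continuous_oneDsqrV.
apply/integrableP; split; first exact/measurable_EFinP.
under eq_integral => x _.
  rewrite /= ger0_norm; last by rewrite invr_ge0 addr_ge0// sqr_ge0.
  over.
by rewrite integral_lorentz ltry.
Qed.

(* The functions integrated over the line below are continuous and O(1/u^2). *)
Definition lorentz_dominated (R : realType) (f : R -> R) : Prop :=
  continuous f /\ exists M, forall u, `|f u| <= M / (1 + u ^+ 2).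

Lemma oneDsqr_gt0 (R : realType) (u : R) : 0 < 1 + u ^+ 2.
Proof. by rewrite ltr_wpDr ?sqr_ge0. Qed.

Lemma lorentz_dominatedW (R : realType) (f : R -> R) (M : R) : continuous f ->
  (forall u, (1 + u ^+ 2) * `|f u| <= M) -> lorentz_dominated f.
Proof.
move=> cf fM; split => //; exists M => u.
by rewrite ler_pdivlMr ?oneDsqr_gt0// mulrC.
Qed.

Lemma dominated_integrable (R : realType) (f : R -> R) : lorentz_dominated f ->
  (@lebesgue_measure R).-integrable setT (EFin \o f).
Proof.
move=> [cf [M fM]].
have Hl : (@lebesgue_measure R).-integrable setT
    (EFin \o (fun u : R => M * (1 + u ^+ 2)^-1)).
  rewrite (_ : _ \o _ = (fun u => M%:E * ((1 + u ^+ 2)^-1)%:E)%E)//.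
  by apply: integrableZl => //; exact: integrable_lorentz.
apply: le_integrable Hl => //.
- apply/measurable_EFinP.
  exact: continuous_measurable_fun.
- move=> x _; rewrite /= lee_fin; apply: le_trans (fM x) _.
  exact: ler_norm.
Qed.

Lemma dominatedD (R : realType) (f g : R -> R) : lorentz_dominated f ->
  lorentz_dominated g -> lorentz_dominated (fun u => f u + g u).
Proof.
move=> [cf [M fM]] [cg [N gN]]; split.
  by move=> x; apply: cvgD; [exact: cf|exact: cg].
exists (M + N) => u; rewrite mulrDl (le_trans (ler_normD _ _))//.
exact: lerD.
Qed.

Lemma dominatedM (R : realType) (f g : R -> R) (K : R) : lorentz_dominated f ->
  continuous g -> (forall u, `|g u| <= K) -> lorentz_dominated (fun u => f u * g u).
Proof.
move=> [cf [M fM]] cg gK; split.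
  by move=> x; apply: cvgM; [exact: cf|exact: cg].
exists (M * K) => u; rewrite normrM mulrAC ler_pM//.
Qed.

Lemma dominatedZ (R : realType) (f : R -> R) (k : R) : lorentz_dominated f ->
  lorentz_dominated (fun u => k * f u).
Proof.
move=> [cf [M fM]]; split.
  by move=> x; apply: cvgM; [exact: cvg_cst|exact: cf].
exists (`|k| * M) => u; rewrite normrM -mulrA ler_wpM2l//.
Qed.

Lemma dominatedN (R : realType) (f : R -> R) : lorentz_dominated f ->
  lorentz_dominated (fun u => - f u).
Proof.
move=> [cf [M fM]]; split; first by move=> x; apply: cvgN; exact: cf.
by exists M => u; rewrite normrN.
Qed.

Lemma dominatedB (R : realType) (f g : R -> R) : lorentz_dominated f ->
  lorentz_dominated g -> lorentz_dominated (fun u => f u - g u).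
Proof. by move=> df dg; exact: dominatedD df (dominatedN dg). Qed.

Lemma dominated_lorentz (R : realType) (M : R) :
  lorentz_dominated (fun u : R => M / (1 + u ^+ 2)).
Proof.
split; last by exists `|M| => u; rewrite normrM [X in _ * X]gtr0_norm// invr_gt0 oneDsqr_gt0.
move=> x; apply: cvgM; first exact: cvg_cst.
exact: continuous_oneDsqrV.
Qed.

Lemma Rintegral_lorentz (R : realType) (M : R) :
  \int[@lebesgue_measure R]_u (M / (1 + u ^+ 2)) = M * pi.
Proof.
rewrite RintegralZl//; last exact: integrable_lorentz.
by rewrite /Rintegral integral_lorentz.
Qed.

Lemma dominated_oppr (R : realType) (f : R -> R) : lorentz_dominated f ->
  lorentz_dominated (fun u => f (- u)).
Proof.
move=> [cf [M fM]]; split.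
  move=> x; apply: (@continuous_comp _ _ _ -%R f); last exact: cf.
  exact: opp_continuous.
by exists M => u; rewrite -[u ^+ 2]sqrrN.
Qed.

(** The change of variables is known for nonnegative functions; adding M / (1 + u^2), which
    dominates |f|, reduces to that case. *)
Lemma Rintegral_scale (R : realType) (f : R -> R) (a : R) : a != 0 ->
  lorentz_dominated f -> lorentz_dominated (fun u => f (a * u)) ->
  \int[@lebesgue_measure R]_u f (a * u) =
  `|a|^-1 * \int[@lebesgue_measure R]_u f u.
Proof.
move=> a0 df dfa; have [cf [M fM]] := df.
have M0 : 0 <= M.
  have := fM 0; rewrite expr0n/= addr0 divr1; exact: le_trans.
pose l (u : R) := M / (1 + u ^+ 2).
have dl : lorentz_dominated l by exact: dominated_lorentz.
have l0 u : 0 <= l u by rewrite divr_ge0// ltW// oneDsqr_gt0.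
have fl0 u : 0 <= f u + l u.
  by have := fM u; rewrite -/(l u) ler_norml => /andP[]; rewrite -subr_ge0 opprK.
have scale (h : R -> R) : continuous h -> (forall u, 0 <= h u) ->
    \int[@lebesgue_measure R]_u h (a * u) = `|a|^-1 * \int[@lebesgue_measure R]_u h u.
  move=> ch h0; rewrite /Rintegral.
  under eq_integral => u _ do rewrite -[(a * u)%R]addr0.
  rewrite (@ge0_integral_affine _ a 0 (EFin \o h))//=.
  - case: (\int[lebesgue_measure]_x (h x)%:E)%E => [r||] //=.
      by rewrite mulry gtr0_sg ?invr_gt0 ?normr_gt0// mul1e/= mulr0.
    by rewrite mulrNy gtr0_sg ?invr_gt0 ?normr_gt0// mul1e/= mulr0.
  - by apply/measurable_EFinP; exact: continuous_measurable_fun.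
have dfl : lorentz_dominated (fun u => f u + l u) by exact: dominatedD.
have dla : lorentz_dominated (fun u => l (a * u)).
  have cl : continuous (fun u => l (a * u)).
    move=> u; apply: (@continuous_comp _ _ _ ( *%R a) l); last exact: dl.1.
    exact: mulrl_continuous.
  apply: (@lorentz_dominatedW _ _ (M * (1 + a ^- 2))) => // u.
  rewrite ger0_norm// /l mulrCA ler_wpM2l//.
  rewrite ler_pdivrMr ?oneDsqr_gt0// exprMn.
  rewrite (_ : _ * (1 + a ^+ 2 * _) = 1 + u ^+ 2 + (a ^- 2 + a ^+ 2 * u ^+ 2)).
    rewrite lerDl; apply: addr_ge0; first by rewrite invr_ge0 sqr_ge0.
    by apply: mulr_ge0; exact: sqr_ge0.
  by field.
have E1 : \int[@lebesgue_measure R]_u f (a * u) =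
    \int[@lebesgue_measure R]_u (f (a * u) + l (a * u)) -
    \int[@lebesgue_measure R]_u l (a * u).
  by rewrite RintegralD//; [rewrite addrK|exact: dominated_integrable..].
have E2 : \int[@lebesgue_measure R]_u f u =
    \int[@lebesgue_measure R]_u (f u + l u) - \int[@lebesgue_measure R]_u l u.
  by rewrite RintegralD//; [rewrite addrK|exact: dominated_integrable..].
rewrite E1 E2 (scale (fun u => f u + l u)) ?(scale l)//; first by rewrite mulrBr.
- exact: dl.1.
- exact: dfl.1.
Qed.

Lemma is_derive_continuous (R : realType) (F f : R -> R) :
  (forall x : R, is_derive x 1 F (f x)) -> continuous F.
Proof.
move=> dF x; apply: differentiable_continuous.
by apply/derivable1_diffP; apply: ex_derive.
Qed.

Lemma ge0_derive_ge0 (R : realType) (F f : R -> R) :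
  (forall x : R, is_derive x 1 F (f x)) -> (forall x, 0 <= x -> 0 <= f x) ->
  0 <= F 0 -> forall x, 0 <= x -> 0 <= F x.
Proof.
move=> dF f0 F0 x; rewrite le_eqVlt => /predU1P[<-//|x0].
have cF : {within `[0, x], continuous F}.
  by apply: continuous_subspaceT; exact: is_derive_continuous dF.
have [c] := MVT x0 (fun y _ => dF y) cF.
rewrite in_itv/= => /andP[c0 _] E.
suff : 0 <= F x - F 0 by rewrite subr_ge0; exact: le_trans.
by rewrite E mulr_ge0 ?subr0 ?(ltW x0)// f0// ltW.
Qed.

(** F' agrees with f on the positive half-line only: for an integrand in |x|, F is the smooth
    expression valid for x > 0, and evenness does the rest. *)
Lemma integral_even_half (R : realType) (f F F' : R -> R) :
  continuous f -> (forall x, 0 <= f x) -> (forall x, f (- x) = f x) ->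
  (forall x : R, is_derive x 1 F (F' x)) -> (forall x, 0 < x -> F' x = f x) ->
  F x @[x --> +oo%R] --> 0 ->
  (\int[@lebesgue_measure R]_x (f x)%:E = (- (2 * F 0))%:E)%E.
Proof.
move=> cf f0 fe dF F'E Fl; have cF := is_derive_continuous dF.
rewrite ge0_symfun_integralT//; last by move=> x /=; rewrite fe.
rewrite (_ : [set x | _] = `[0, +oo[%classic); last first.
  by apply/seteqP; split => x/=; rewrite in_itv/= andbT.
rewrite (ge0_continuous_FTC2y _ _ Fl)//.
- by rewrite sub0e -EFinN -EFinM mulrN.
- by apply: continuous_subspaceT.
- by apply: cvg_at_right_filter; exact: cF.
- move=> x; rewrite in_itv/= andbT => x0; rewrite derive1E -F'E//.
  by apply: derive_val.
Qed.

Lemma inv_bound_cvg0 (R : realType) (F : R -> R) (B : R) :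
  (forall x, 1 <= x -> `|F x| <= B / x) -> F x @[x --> +oo%R] --> 0.
Proof.
move=> FB; apply/cvgrPdist_le => e e0.
near=> x; rewrite sub0r normrN.
have x1 : 1 <= x by near: x; exact: nbhs_pinfty_ge.
have xB : B / e <= x by near: x; apply: nbhs_pinfty_ge; exact: num_real.
apply: le_trans (FB x x1) _; rewrite ler_pdivrMr ?(lt_le_trans ltr01)//.
by rewrite mulrC -ler_pdivrMr.
Unshelve. all: by end_near. Qed.

Lemma lorentz_cvg0 (R : realType) (F : R -> R) (C : R) :
  (forall u, `|F u| <= C / (1 + u ^+ 2)) -> F x @[x --> +oo%R] --> 0.
Proof.
move=> FC; apply: (@inv_bound_cvg0 _ _ C) => x x1; apply: le_trans (FC x) _.
have C0 : 0 <= C by have := FC 0; rewrite expr0n /= addr0 divr1; exact: le_trans.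
by rewrite ler_wpM2l// lef_pV2 ?posrE ?oneDsqr_gt0//; nra.
Qed.

(* The integral of an exact derivative vanishes: symmetrize, then add a multiple
   of the derivative of atan to reach the nonnegative case. *)
Lemma Rintegral_derive_eq0 (R : realType) (F f : R -> R) (C : R) :
  lorentz_dominated f -> (forall x : R, is_derive x 1 F (f x)) ->
  (forall u, `|F u| <= C / (1 + u ^+ 2)) ->
  \int[@lebesgue_measure R]_u f u = 0.
Proof.
move=> df dF FC; have [cf [M fM]] := df.
pose l (u : R) := M / (1 + u ^+ 2).
have dl : lorentz_dominated l by exact: dominated_lorentz.
pose h u := (f u + f (- u)) + 2 * l u.
pose H u := (F u - F (- u)) + 2 * (M * atan u).
have dfN := dominated_oppr df.
have dff := dominatedD df dfN.
have d2l := dominatedZ 2 dl.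
have dh : lorentz_dominated h by exact: dominatedD.
have h0 u : 0 <= h u.
  have := fM u; have := fM (- u); rewrite sqrrN -/(l u) !ler_norml.
  by move=> /andP[? _] /andP[? _]; rewrite /h; lra.
have he u : h (- u) = h u by rewrite /h /l sqrrN opprK [f u + _]addrC.
have dH (x : R) : is_derive x 1 H (h x).
  apply: (is_derive_val (is_derive_add (is_derive_sub (dF x)
    (is_derive_compose (is_derive_opp (is_derive_var x)) (dF (- x))))
    (is_derive_scale 2 (is_derive_scale M (is_derive1_atan x))))).
  by rewrite /h /l mulrN1 opprK.
have FN : forall u, `|F (- u)| <= C / (1 + u ^+ 2).
  by move=> u; rewrite -[u ^+ 2]sqrrN.
have Hl : H x @[x --> +oo%R] --> (0 - 0) + 2 * (M * (pi / 2)).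
  apply: cvgD; first by apply: cvgB; exact: lorentz_cvg0.
  by do 2 (apply: cvgM; first exact: cvg_cst); exact: cvgy_atan.
have dG (x : R) : is_derive x 1 (fun x => H x - (0 - 0 + 2 * (M * (pi / 2)))) (h x).
  by apply: (is_derive_val (is_derive_sub (dH x) (is_derive_const x _))); rewrite subr0.
have Gl : H x - (0 - 0 + 2 * (M * (pi / 2))) @[x --> +oo%R] --> 0.
  by rewrite -[X in _ --> X](subrr (0 - 0 + 2 * (M * (pi / 2)))); apply: cvgB Hl (cvg_cst _).
have := integral_even_half dh.1 h0 he dG (fun _ _ => erefl) Gl.
move/(congr1 fine); rewrite /= -/(Rintegral _ _ _) /h RintegralD//; try exact: dominated_integrable.
rewrite RintegralD//; try exact: dominated_integrable.
rewrite RintegralZl//; last exact: dominated_integrable.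
rewrite /l Rintegral_lorentz /H oppr0 atan0 mulr0 !subrr.
have -> : \int[@lebesgue_measure R]_u f (- u) = \int[@lebesgue_measure R]_u f u.
  have := @Rintegral_scale R f (-1); rewrite oppr_eq0 oner_eq0 normrN1 invr1 mul1r.
  under eq_Rintegral do rewrite mulN1r.
  apply => //; rewrite (_ : (fun u => _) = (fun u => f (- u)))//.
  by apply/funext => u; rewrite mulN1r.
by move=> E; lra.
Qed.

Lemma expR_ge_pow (R : realType) (n : nat) (x : R) : 0 <= x ->
  x ^+ n / n`!%:R <= expR x.
Proof.
elim: n x => [|n ih] x x0.
  by rewrite expr0 fact0 divr1; apply: le_trans (expR_ge1Dx x); rewrite lerDl.
rewrite -subr_ge0 mulrC; move: x x0; apply: (@ge0_derive_ge0 _ _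
  (fun y => expR y - n.+1`!%:R^-1 * (n.+1%:R * y ^+ n))) => [y|y /ih h|].
- exact: is_derive_sub (is_derive_expR y) (is_derive_scale _ (is_derive_exprn n y)).
- rewrite subr_ge0; apply: le_trans h; rewrite le_eqVlt; apply/orP; left; apply/eqP.
  by rewrite factS natrM; field; rewrite nat1r !pnatr_eq0 -lt0n fact_gt0.
- by rewrite expR0 expr0n /= mulr0 subr0.
Qed.

(** With w = 1 + u^2, |u^k| <= w^k and e^(-a u^2) = e^a e^(-a w), while e^(a w) >= (a w)^(k+1) /
    (k+1)!; one power of w is left for the denominator. *)
Lemma gauss_pow_bound (R : realType) (a : R) (k : nat) (u : R) : 0 < a ->
  `|u ^+ k * expR (- (a * u ^+ 2))| <=
  (k.+1`!%:R * a ^- k.+1 * expR a) / (1 + u ^+ 2).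
Proof.
move=> a0; set w := 1 + u ^+ 2; have w1 : 0 < w by exact: oneDsqr_gt0.
rewrite ler_pdivlMr// normrM (@ger0_norm _ (expR _)) ?expR_ge0//.
have uw : `|u ^+ k| <= w ^+ k.
  rewrite normrX lerXn2r ?nnegrE ?(ltW w1)//.
  by rewrite ler_norml /w; apply/andP; split; rewrite expr2; nra.
have ew : expR (- (a * u ^+ 2)) = expR a * (expR (a * w))^-1.
  by rewrite -expRN -expRD; congr expR; rewrite /w; ring.
have aw0 : 0 <= a * w by rewrite mulr_ge0// ltW.
have aw : (a * w) ^+ k.+1 / k.+1`!%:R <= expR (a * w) by exact: expR_ge_pow.
have e0 := expR_gt0 (a * w).
have f0 : 0 < k.+1`!%:R :> R by rewrite ltr0n fact_gt0.
apply: (@le_trans _ _ (w ^+ k.+1 * expR (- (a * u ^+ 2)))).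
  rewrite [w ^+ k.+1]exprSr [leRHS]mulrAC; apply: ler_wpM2r; first exact: ltW.
  by apply: ler_wpM2r => //; exact: expR_ge0.
rewrite ew mulrCA [leRHS]mulrC; apply: ler_wpM2l; first exact: expR_ge0.
rewrite ler_pdivrMr//.
move: aw; rewrite ler_pdivrMr// exprMn => aw.
rewrite -mulrA [a ^- _ * _]mulrC mulrA ler_pdivlMr ?exprn_gt0//.
by rewrite mulrC [_ * expR _]mulrC.
Qed.

(** * Gaussian moments against cosines and sines *)

Definition gauss_kernel (R : realType) (a : R) (k : nat) (u : R) : R :=
  u ^+ k * expR (- (a * u ^+ 2)).

Lemma is_derive_gauss (R : realType) (a x : R) :
  is_derive x 1 (fun u : R => expR (- (a * u ^+ 2)))
    (- (2 * a * x) * expR (- (a * x ^+ 2))).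
Proof.
apply: (is_derive_val (is_derive_compose (is_derive_opp (is_derive_scale a
  (is_derive_exprn 1 x))) (is_derive_expR (- (a * x ^+ 2))))).
by rewrite expr1; ring.
Qed.

Lemma continuous_gauss_kernel (R : realType) (a : R) k : continuous (gauss_kernel a k).
Proof.
move=> x; apply: cvgM; first exact: exprn_continuous.
exact: is_derive_continuous (is_derive_gauss a) _.
Qed.

Lemma dominated_gauss (R : realType) (a : R) k : 0 < a ->
  lorentz_dominated (gauss_kernel a k).
Proof.
move=> a0; split; first exact: continuous_gauss_kernel.
by eexists => u; exact: gauss_pow_bound.
Qed.

Lemma is_derive_cosM (R : realType) (b x : R) :
  is_derive x 1 (fun u : R => cos (b * u)) (- (b * sin (b * x))).
Proof.
apply: (is_derive_val (is_derive_compose (is_derive_scale b (is_derive_var x))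
  (is_derive_cos (b * x)))).
by ring.
Qed.

Lemma is_derive_sinM (R : realType) (b x : R) :
  is_derive x 1 (fun u : R => sin (b * u)) (b * cos (b * x)).
Proof.
apply: (is_derive_val (is_derive_compose (is_derive_scale b (is_derive_var x))
  (is_derive_sin (b * x)))).
by ring.
Qed.

Lemma continuous_cosM (R : realType) (b : R) : continuous (fun u : R => cos (b * u)).
Proof. exact: is_derive_continuous (is_derive_cosM b). Qed.

Lemma continuous_sinM (R : realType) (b : R) : continuous (fun u : R => sin (b * u)).
Proof. exact: is_derive_continuous (is_derive_sinM b). Qed.

Lemma normr_cos_le1 (R : realType) (x : R) : `|cos x| <= 1.
Proof. by rewrite ler_norml cos_geN1 cos_le1. Qed.

Lemma normr_sin_le1 (R : realType) (x : R) : `|sin x| <= 1.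
Proof. by rewrite ler_norml sin_geN1 sin_le1. Qed.

Lemma dominated_gauss_cos (R : realType) (a b : R) k : 0 < a ->
  lorentz_dominated (fun u => gauss_kernel a k u * cos (b * u)).
Proof.
move=> a0; apply: (@dominatedM _ _ _ 1); first exact: dominated_gauss.
  exact: continuous_cosM.
by move=> u; exact: normr_cos_le1.
Qed.

Lemma dominated_gauss_sin (R : realType) (a b : R) k : 0 < a ->
  lorentz_dominated (fun u => gauss_kernel a k u * sin (b * u)).
Proof.
move=> a0; apply: (@dominatedM _ _ _ 1); first exact: dominated_gauss.
  exact: continuous_sinM.
by move=> u; exact: normr_sin_le1.
Qed.

Definition gauss_cos (R : realType) (a : R) (k : nat) (b : R) : R :=
  \int[@lebesgue_measure R]_u (gauss_kernel a k u * cos (b * u)).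

Definition gauss_sin (R : realType) (a : R) (k : nat) (b : R) : R :=
  \int[@lebesgue_measure R]_u (gauss_kernel a k u * sin (b * u)).

Lemma is_derive_gauss_kernel0 (R : realType) (a x : R) :
  is_derive x 1 (gauss_kernel a 0) (- (2 * a) * gauss_kernel a 1 x).
Proof.
rewrite /gauss_kernel; apply: (is_derive_val (is_derive_mul
  (is_derive_const x 1) (is_derive_gauss a x))).
by rewrite expr1; ring.
Qed.

Lemma is_derive_gauss_kernelS (R : realType) (a x : R) k :
  is_derive x 1 (gauss_kernel a k.+1)
    (k.+1%:R * gauss_kernel a k x - 2 * a * gauss_kernel a k.+2 x).
Proof.
rewrite /gauss_kernel; apply: (is_derive_val (is_derive_mul
  (is_derive_exprn k x) (is_derive_gauss a x))).
by rewrite !exprS; ring.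
Qed.

(** Integration by parts: the derivative of e^(-a u^2) sin (b u) has integral 0. The next two lemmas
    do the same with an additional factor u^(k+1), against cosine and sine. *)
Lemma gauss_sin1 (R : realType) (a b : R) : 0 < a ->
  2 * a * gauss_sin a 1 b = b * gauss_cos a 0 b.
Proof.
move=> a0.
pose f u := - (2 * a) * (gauss_kernel a 1 u * sin (b * u)) +
            b * (gauss_kernel a 0 u * cos (b * u)).
have d1 := dominatedZ (- (2 * a)) (dominated_gauss_sin b 1 a0).
have d2 := dominatedZ b (dominated_gauss_cos b 0 a0).
have df : lorentz_dominated f by exact: dominatedD.
have [_ [C HC]] := dominated_gauss_sin b 0 a0.
have : \int[@lebesgue_measure R]_u f u = 0.
  apply: (Rintegral_derive_eq0 df _ HC) => x.
  apply: (is_derive_val (is_derive_mul (is_derive_gauss_kernel0 a x)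
    (is_derive_sinM b x))).
  by rewrite /f; ring.
rewrite /f RintegralD//; try exact: dominated_integrable.
rewrite !RintegralZl//; try (apply: dominated_integrable; first
  [exact: dominated_gauss_sin | exact: dominated_gauss_cos]).
by rewrite -/(gauss_sin a 1 b) -/(gauss_cos a 0 b); lra.
Qed.

Lemma gauss_cosSS (R : realType) (a b : R) k : 0 < a ->
  2 * a * gauss_cos a k.+2 b =
  k.+1%:R * gauss_cos a k b - b * gauss_sin a k.+1 b.
Proof.
move=> a0.
pose f u := (k.+1%:R * (gauss_kernel a k u * cos (b * u)) -
             2 * a * (gauss_kernel a k.+2 u * cos (b * u))) -
            b * (gauss_kernel a k.+1 u * sin (b * u)).
have d1 := dominatedZ k.+1%:R (dominated_gauss_cos b k a0).
have d2 := dominatedZ (2 * a) (dominated_gauss_cos b k.+2 a0).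
have d3 := dominatedZ b (dominated_gauss_sin b k.+1 a0).
have d12 := dominatedB d1 d2.
have df : lorentz_dominated f by exact: dominatedB.
have [_ [C HC]] := dominated_gauss_cos b k.+1 a0.
have : \int[@lebesgue_measure R]_u f u = 0.
  apply: (Rintegral_derive_eq0 df _ HC) => x.
  apply: (is_derive_val (is_derive_mul (is_derive_gauss_kernelS a x k)
    (is_derive_cosM b x))).
  by rewrite /f; ring.
rewrite /f !RintegralB//; try exact: dominated_integrable.
rewrite !RintegralZl//; try (apply: dominated_integrable; first
  [exact: dominated_gauss_sin | exact: dominated_gauss_cos]).
by rewrite -/(gauss_sin a k.+1 b) -/(gauss_cos a k b) -/(gauss_cos a k.+2 b); lra.
Qed.

Lemma gauss_sinSS (R : realType) (a b : R) k : 0 < a ->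
  2 * a * gauss_sin a k.+2 b =
  k.+1%:R * gauss_sin a k b + b * gauss_cos a k.+1 b.
Proof.
move=> a0.
pose f u := (k.+1%:R * (gauss_kernel a k u * sin (b * u)) -
             2 * a * (gauss_kernel a k.+2 u * sin (b * u))) +
            b * (gauss_kernel a k.+1 u * cos (b * u)).
have d1 := dominatedZ k.+1%:R (dominated_gauss_sin b k a0).
have d2 := dominatedZ (2 * a) (dominated_gauss_sin b k.+2 a0).
have d3 := dominatedZ b (dominated_gauss_cos b k.+1 a0).
have d12 := dominatedB d1 d2.
have df : lorentz_dominated f by exact: dominatedD.
have [_ [C HC]] := dominated_gauss_sin b k.+1 a0.
have : \int[@lebesgue_measure R]_u f u = 0.
  apply: (Rintegral_derive_eq0 df _ HC) => x.
  apply: (is_derive_val (is_derive_mul (is_derive_gauss_kernelS a x k)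
    (is_derive_sinM b x))).
  by rewrite /f; ring.
rewrite /f RintegralD//; try exact: dominated_integrable.
rewrite RintegralB//; try exact: dominated_integrable.
rewrite !RintegralZl//; try (apply: dominated_integrable; first
  [exact: dominated_gauss_sin | exact: dominated_gauss_cos]).
by rewrite -/(gauss_sin a k.+2 b) -/(gauss_sin a k b) -/(gauss_cos a k.+1 b); lra.
Qed.

Lemma gauss_cos0_at0 (R : realType) (a : R) : 0 < a ->
  gauss_cos a 0 0 = Num.sqrt (pi / a).
Proof.
move=> a0; have sa : 0 < Num.sqrt a by rewrite sqrtr_gt0.
have g1 : lorentz_dominated (@gauss_fun R).
  have := @dominated_gauss R 1 0 ltr01; congr lorentz_dominated.
  by apply/funext => u; rewrite /gauss_kernel expr0 !mul1r.
have E u : gauss_kernel a 0 u * cos (0 * u) = gauss_fun (Num.sqrt a * u).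
  rewrite mul0r cos0 /gauss_kernel expr0 mulr1 mul1r /gauss_fun exprMn.
  by rewrite sqr_sqrtr// ltW.
have ga : lorentz_dominated (fun u => gauss_fun (Num.sqrt a * u)).
  have := dominated_gauss_cos 0 0 a0; congr lorentz_dominated.
  exact/funext.
rewrite /gauss_cos; under eq_Rintegral do rewrite E.
rewrite Rintegral_scale// ?gt_eqF//.
rewrite [X in _ * X](_ : _ = Num.sqrt pi).
  by rewrite gtr0_norm// sqrtrM ?pi_ge0// sqrtrV ?ltW// mulrC.
by rewrite /Rintegral integralT_gauss.
Qed.

(** Differentiation under the integral sign: |u| e^(-a u^2) dominates the derivative at every
    frequency. *)
Lemma is_derive_gauss_cos0 (R : realType) (a b : R) : 0 < a ->
  is_derive b 1 (gauss_cos a 0) (- gauss_sin a 1 b).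
Proof.
move=> a0.
pose f (x u : R) := gauss_kernel a 0 u * cos (x * u).
pose G (u : R) := `|gauss_kernel a 1 u|.
have Df (x u : R) : is_derive x 1 (f ^~ u) (- (gauss_kernel a 1 u * sin (x * u))).
  apply: (is_derive_val (is_derive_scale (gauss_kernel a 0 u) (is_derive_compose
    (is_derive_mul (is_derive_var x) (is_derive_const x u)) (is_derive_cos (x * u))))).
  by rewrite /gauss_kernel expr0 expr1; ring.
have d1f x u : partial1of2 f x u = - (gauss_kernel a 1 u * sin (x * u)).
  by rewrite partial1of2E; apply: derive_val.
have Ib : `]b - 1, b + 1[%classic b by rewrite /= in_itv/=; apply/andP; lra.
have intf x : `]b - 1, b + 1[%classic x ->
    (@lebesgue_measure R).-integrable setT (EFin \o f x).
  by move=> _; apply: dominated_integrable; exact: dominated_gauss_cos.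
have derf x u : `]b - 1, b + 1[%classic x -> [set: R] u -> derivable (f ^~ u) x 1.
  by move=> _ _; apply: ex_derive.
have intG : (@lebesgue_measure R).-integrable setT (EFin \o G).
  apply: dominated_integrable; have [cg [M gM]] := dominated_gauss 1 a0; split.
    move=> x; apply: (@continuous_comp _ _ _ (gauss_kernel a 1) Num.norm).
      exact: cg.
    exact: norm_continuous.
  by exists M => u; rewrite normr_id.
have G0 u : 0 <= G u by exact: normr_ge0.
have Gub x u : `]b - 1, b + 1[%classic x -> [set: R] u -> `|partial1of2 f x u| <= G u.
  move=> _ _; rewrite d1f normrN normrM ler_piMr ?normr_ge0//.
  exact: normr_sin_le1.
have D := derivable_under_integral measurableT Ib intf derf G0 intG Gub.
have V := differentiation_under_integral measurableT Ib intf derf G0 intG Gub.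
apply: DeriveDef; first exact: D.
rewrite -derive1E V -mulN1r -[gauss_sin _ _ _]/(\int[@lebesgue_measure R]_u _).
rewrite -RintegralZl//; last by apply: dominated_integrable; exact: dominated_gauss_sin.
by apply: eq_Rintegral => u _; rewrite d1f mulN1r.
Qed.

(** By [gauss_sin1] the integral solves y' = - b y / (2 a), so its product with e^(b^2 / (4 a)) is
    constant in b. *)
Lemma gauss_cos0E (R : realType) (a b : R) : 0 < a ->
  gauss_cos a 0 b = Num.sqrt (pi / a) * expR (- (b ^+ 2 / (4 * a))).
Proof.
move=> a0.
pose h (x : R) := gauss_cos a 0 x * expR ((4 * a)^-1 * x ^+ 2).
have dh (x : R) : is_derive x 1 h 0.
  apply: (is_derive_val (is_derive_mul (is_derive_gauss_cos0 x a0)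
    (is_derive_compose (is_derive_scale _ (is_derive_exprn 1 x))
      (is_derive_expR ((4 * a)^-1 * x ^+ 2))))).
  have -> : gauss_sin a 1 x = (x / (2 * a)) * gauss_cos a 0 x.
    have := gauss_sin1 x a0; move=> E.
    apply: (mulfI (x := 2 * a)); first by rewrite mulf_neq0 ?gt_eqF.
    by rewrite E; field; rewrite gt_eqF.
  by rewrite expr1; field; rewrite gt_eqF.
have hE : h b = h 0 by exact: is_derive_0_is_cst.
move: hE; rewrite /h expr0n /= mulr0 expR0 mulr1 gauss_cos0_at0// => <-.
rewrite -mulrA -expRD [X in expR X](_ : _ = 0) ?expR0 ?mulr1//.
by field; rewrite gt_eqF.
Qed.

Lemma gauss_cos4E (R : realType) (a b : R) : 0 < a ->
  gauss_cos a 4 b =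
  (3 / (4 * a ^+ 2) - 3 * b ^+ 2 / (4 * a ^+ 3) + b ^+ 4 / (16 * a ^+ 4)) *
  gauss_cos a 0 b.
Proof.
move=> a0; have a1 : a != 0 by rewrite gt_eqF.
have aa : 2 * a != 0 by rewrite mulf_neq0.
have s1 : gauss_sin a 1 b = b * gauss_cos a 0 b / (2 * a).
  by apply: (mulfI aa); rewrite gauss_sin1//; field.
have c2 : gauss_cos a 2 b = (gauss_cos a 0 b - b * gauss_sin a 1 b) / (2 * a).
  by apply: (mulfI aa); rewrite gauss_cosSS//; field.
have s3 : gauss_sin a 3 b = (2 * gauss_sin a 1 b + b * gauss_cos a 2 b) / (2 * a).
  by apply: (mulfI aa); rewrite gauss_sinSS//; field.
have c4 : gauss_cos a 4 b = (3 * gauss_cos a 2 b - b * gauss_sin a 3 b) / (2 * a).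
  by apply: (mulfI aa); rewrite gauss_cosSS//; field.
by rewrite c4 s3 c2 s1; field.
Qed.

Lemma gauss_cos68_at0 (R : realType) (a : R) : 0 < a ->
  gauss_cos a 6 0 = 15 / (8 * a ^+ 3) * Num.sqrt (pi / a) /\
  gauss_cos a 8 0 = 105 / (16 * a ^+ 4) * Num.sqrt (pi / a).
Proof.
move=> a0; have a1 : a != 0 by rewrite gt_eqF.
have aa : 2 * a != 0 by rewrite mulf_neq0.
have cS k : gauss_cos a k.+2 0 = k.+1%:R * gauss_cos a k 0 / (2 * a).
  by apply: (mulfI aa); rewrite gauss_cosSS//; field.
by rewrite !cS gauss_cos0_at0//; split; field.
Qed.

(* Alternating Taylor sums in nested form; the first argument is the number of
   terms and j is the index of the first one. *)
Fixpoint exp_nested (R : realType) (n j : nat) (y : R) : R :=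
  if n is m.+1 then 1 - y / j.+1%:R * exp_nested m j.+1 y else 0.

Fixpoint trig_nested (R : realType) (n j : nat) (w : R) : R :=
  if n is m.+1 then 1 - w / (j.+1%:R * j.+2%:R) * trig_nested m j.+2 w else 0.

Lemma exp_nestedE (R : realType) n j (y : R) :
  exp_nested n j y = \sum_(k < n) (-1) ^+ k * y ^+ k * (j`!%:R / (j + k)`!%:R).
Proof.
elim: n j => [|n ih] j /=; first by rewrite big_ord0.
rewrite big_ord_recl /= addn0 !expr0 divff; last by rewrite pnatr_eq0 -lt0n fact_gt0.
rewrite !mulr1; congr (_ + _); rewrite ih mulr_sumr -sumrN.
apply: eq_bigr => k _; rewrite /bump/= add1n addSnnS !exprS factS natrM.
have : j.+1%:R != 0 :> R by rewrite pnatr_eq0.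
have : (j + k.+1)`!%:R != 0 :> R by rewrite pnatr_eq0 -lt0n fact_gt0.
by move=> h1 h2; field; rewrite h1 nat1r h2.
Qed.

Lemma trig_nestedE (R : realType) n j (w : R) :
  trig_nested n j w =
  \sum_(k < n) (-1) ^+ k * w ^+ k * (j`!%:R / (j + k.*2)`!%:R).
Proof.
elim: n j => [|n ih] j /=; first by rewrite big_ord0.
rewrite big_ord_recl /= addn0 !expr0 divff; last by rewrite pnatr_eq0 -lt0n fact_gt0.
rewrite !mulr1; congr (_ + _); rewrite ih mulr_sumr -sumrN.
apply: eq_bigr => k _; rewrite /bump/= add1n doubleS.
rewrite (_ : (j.+2 + k.*2)%N = (j + k.*2.+2)%N); last by rewrite !addSn !addnS.
rewrite !exprS (factS j.+1) (factS j) !natrM.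
have : j.+1%:R != 0 :> R by rewrite pnatr_eq0.
have : j.+2%:R != 0 :> R by rewrite pnatr_eq0.
have : (j + k.*2.+2)`!%:R != 0 :> R by rewrite pnatr_eq0 -lt0n fact_gt0.
by move=> h _ _; field; rewrite h nat1r -natrD !pnatr_eq0.
Qed.

(** Taylor sums of e^(-y) lie alternately below and above it: up to sign, the derivative of each
    remainder is the previous one, and every remainder after the first vanishes at 0. *)
Lemma expRN_nested (R : realType) n (y : R) : 0 <= y ->
  0 <= (-1) ^+ n * (expR (- y) - exp_nested n 0 y).
Proof.
elim: n y => [|n ih] y y0; first by rewrite /= subr0 expr0 mul1r expR_ge0.
pose T m (x : R) := \sum_(k < m) (-1) ^+ k * x ^+ k / k`!%:R.
have TE m x : exp_nested m 0 x = T m x.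
  by rewrite exp_nestedE; apply: eq_bigr => k _; rewrite fact0 add0n mul1r.
have dT (x : R) : is_derive x 1 (T n.+1) (- T n x).
  have -> : T n.+1 = (fun x => 1 + \sum_(k < n) (fun x : R =>
      ((-1) ^+ k.+1 / k.+1`!%:R) * x ^+ k.+1) x).
    apply/funext => z; rewrite /T big_ord_recl /= !expr0 fact0 divr1 mulr1.
    by congr (_ + _); apply: eq_bigr => k _; rewrite /bump/= add1n mulrAC.
  have D (k : 'I_n) : is_derive x 1 (fun x : R => ((-1) ^+ k.+1 / k.+1`!%:R) * x ^+ k.+1)
      (((-1) ^+ k.+1 / k.+1`!%:R) * (k.+1%:R * x ^+ k)).
    exact: is_derive_scale (is_derive_exprn k x).
  have S := is_derive_add (is_derive_const x 1) (is_derive_sum D).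
  have -> : (fun x => 1 + \sum_(k < n) (fun x : R =>
      ((-1) ^+ k.+1 / k.+1`!%:R) * x ^+ k.+1) x) = (fun y => 1 + (\sum_(k < n)
      (fun x : R => ((-1) ^+ k.+1 / k.+1`!%:R) * x ^+ k.+1) : R -> R) y).
    by apply/funext => z; rewrite fct_sumE.
  apply: (is_derive_val S); rewrite add0r -sumrN; apply: eq_bigr => k _.
  rewrite factS natrM exprS.
  have h : k`!%:R != 0 :> R by rewrite pnatr_eq0 -lt0n fact_gt0.
  have h' : k.+1%:R != 0 :> R by rewrite pnatr_eq0.
  by field; rewrite h nat1r h'.
rewrite TE.
apply: (@ge0_derive_ge0 _ (fun x => (-1) ^+ n.+1 * (expR (- x) - T n.+1 x))
  (fun x => (-1) ^+ n * (expR (- x) - T n x))) => //.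
- move=> x; apply: (is_derive_val (is_derive_scale _ (is_derive_sub
    (is_derive_compose (is_derive_opp (is_derive_var x)) (is_derive_expR (- x))) (dT x)))).
  by rewrite exprS; ring.
- by move=> x x0; rewrite -TE; exact: ih.
- rewrite oppr0 expR0 /T big_ord_recl big1 => [|k _]; last by rewrite expr0n mulr0 mul0r.
  by rewrite !expr0 fact0 divr1 mulr1 addr0 subrr mulr0.
Qed.

(** Both signs go together: the sine remainder integrates the cosine remainder with as many terms,
    and the next cosine remainder integrates that sine remainder up to sign. The start is cos <=
    1. *)
Lemma sin_cos_nested (R : realType) n (u : R) : 0 <= u ->
  0 <= (-1) ^+ n.+1 * (cos u - trig_nested n.+1 0 (u ^+ 2)) /\
  0 <= (-1) ^+ n.+1 * (sin u - u * trig_nested n.+1 1 (u ^+ 2)).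
Proof.
pose C m (x : R) := \sum_(k < m) ((-1) ^+ k / k.*2`!%:R) * x ^+ k.*2.
pose S m (x : R) := \sum_(k < m) ((-1) ^+ k / k.*2.+1`!%:R) * x ^+ k.*2.+1.
have CE m x : trig_nested m 0 (x ^+ 2) = C m x.
  rewrite trig_nestedE; apply: eq_bigr => k _.
  by rewrite fact0 add0n mul1r -exprM mul2n mulrAC.
have SE m x : x * trig_nested m 1 (x ^+ 2) = S m x.
  rewrite trig_nestedE mulr_sumr; apply: eq_bigr => k _.
  by rewrite (_ : 1`! = 1%N)// mul1r -exprM mul2n add1n exprS; ring.
have dS m (x : R) : is_derive x 1 (S m) (C m x).
  have -> : S m = (\sum_(k < m) (fun x : R => ((-1) ^+ k / k.*2.+1`!%:R) * x ^+ k.*2.+1) : R -> R).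
    by apply/funext => z; rewrite fct_sumE.
  have D (k : 'I_m) : is_derive x 1 (fun x : R => ((-1) ^+ k / k.*2.+1`!%:R) * x ^+ k.*2.+1)
      (((-1) ^+ k / k.*2.+1`!%:R) * (k.*2.+1%:R * x ^+ k.*2)).
    exact: is_derive_scale (is_derive_exprn _ x).
  apply: (is_derive_val (is_derive_sum D)); apply: eq_bigr => k _.
  rewrite factS natrM.
  have h : k.*2`!%:R != 0 :> R by rewrite pnatr_eq0 -lt0n fact_gt0.
  have h' : k.*2.+1%:R != 0 :> R by rewrite pnatr_eq0.
  by field; rewrite h nat1r h'.
have dC m (x : R) : is_derive x 1 (C m.+1) (- S m x).
  have -> : C m.+1 = (fun x => 1 + (\sum_(k < m) (fun x : R =>
      ((-1) ^+ k.+1 / k.+1.*2`!%:R) * x ^+ k.+1.*2) : R -> R) x).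
    apply/funext => z; rewrite fct_sumE /C big_ord_recl /= double0 !expr0 fact0.
    by rewrite divr1 mulr1.
  have D (k : 'I_m) : is_derive x 1 (fun x : R => ((-1) ^+ k.+1 / k.+1.*2`!%:R) * x ^+ k.+1.*2)
      (((-1) ^+ k.+1 / k.+1.*2`!%:R) * (k.+1.*2%:R * x ^+ k.*2.+1)).
    by rewrite doubleS; exact: is_derive_scale (is_derive_exprn _ x).
  apply: (is_derive_val (is_derive_add (is_derive_const x 1) (is_derive_sum D))).
  rewrite add0r -sumrN; apply: eq_bigr => k _; rewrite doubleS (factS k.*2.+1) natrM exprS.
  have h : k.*2.+1`!%:R != 0 :> R by rewrite pnatr_eq0 -lt0n fact_gt0.
  have h' : k.*2.+2%:R != 0 :> R by rewrite pnatr_eq0.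
  by field; rewrite h -natrD pnatr_eq0.
have C0 m : C m.+1 0 = 1.
  rewrite /C big_ord_recl big1 => [|k _]; last by rewrite expr0n mulr0.
  by rewrite /= double0 !expr0 fact0 divr1 mulr1 addr0.
have S0 m : S m 0 = 0.
  by rewrite /S big1 // => k _; rewrite expr0n mulr0.
elim: n u => [|n ih] u u0; rewrite CE SE.
  have cos1 (x : R) : 0 <= x -> 0 <= (-1) ^+ 1 * (cos x - C 1%N x).
    move=> x0; rewrite /C big_ord1 /= double0 !expr0 fact0 divr1 mulr1 expr1.
    by have := cos_le1 x; lra.
  split; first exact: cos1.
  apply: (@ge0_derive_ge0 _ (fun x => (-1) ^+ 1 * (sin x - S 1%N x)) _ _ cos1) => //.
  by rewrite sin0 S0 subrr mulr0.
have cosS (x : R) : 0 <= x -> 0 <= (-1) ^+ n.+2 * (cos x - C n.+2 x).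
  apply: (@ge0_derive_ge0 _ (fun x => (-1) ^+ n.+2 * (cos x - C n.+2 x))
    (fun x => (-1) ^+ n.+1 * (sin x - S n.+1 x))).
  - move=> y; apply: (is_derive_val (is_derive_scale _ (is_derive_sub
      (is_derive_cos y) (dC n.+1 y)))).
    by rewrite exprS; ring.
  - by move=> y y0; have [_] := ih y y0; rewrite SE.
  - by rewrite cos0 C0 subrr mulr0.
split; first exact: cosS.
apply: (@ge0_derive_ge0 _ (fun x => (-1) ^+ n.+2 * (sin x - S n.+2 x)) _ _ cosS) => //.
by rewrite sin0 S0 subrr mulr0.
Qed.

(** * The cardinal sine and the integral of its square *)

Definition sinc (R : realType) (u : R) : R := if u == 0 then 1 else sin u / u.

Lemma mul_sinc (R : realType) (u : R) : u * sinc u = sin u.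
Proof.
rewrite /sinc; case: eqVneq => [->|u0]; first by rewrite sin0 mul0r.
by rewrite mulrC divfK.
Qed.

Lemma sincN (R : realType) (u : R) : sinc (- u) = sinc u.
Proof.
by rewrite /sinc oppr_eq0; case: eqVneq => // u0; rewrite sinN invrN mulrNN.
Qed.

Lemma sinc_bounds (R : realType) (u : R) : 1 - u ^+ 2 / 6 <= sinc u <= 1.
Proof.
wlog u0 : u / 0 <= u.
  move=> H; have [/H//|/ltW] := leP 0 u.
  by rewrite -oppr_ge0 => /H; rewrite sincN sqrrN.
have [->|un0] := eqVneq u 0.
  by rewrite /sinc eqxx expr0n /= mul0r subr0 lexx.
have up : 0 < u by rewrite lt_def un0.
have [_] := sin_cos_nested 0 u0; have [_] := sin_cos_nested 1 u0.
rewrite -mul_sinc /= !mulr0 !subr0 !mulr1 -mulrBr mulrCA pmulr_rge0//.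
rewrite sqrrN expr1n mul1r -mulNr -mulrA mulN1r => H1 H2.
have : 0 <= u * (1 - sinc u) by lra.
rewrite pmulr_rge0// subr_ge0 => ->; rewrite andbT.
have E : 2%:R * 3%:R = 6 :> R by rewrite -natrM.
by move: H1; rewrite E; lra.
Qed.

Lemma normr_sinc_le1 (R : realType) (u : R) : `|sinc u| <= 1.
Proof.
have /andP[lo hi] := sinc_bounds u; rewrite ler_norml hi andbT.
(* Up to u^2 = 12 the bound 1 - u^2 / 6 is at least -1; beyond, |u| >= 1 and |sin u| <= 1
   suffice. *)
have [u2|u2] := leP (u ^+ 2) 12; first by lra.
have u0 : u != 0 by apply: contraTneq u2 => ->; rewrite expr0n /=; lra.
have : `|u * sinc u| <= 1 by rewrite mul_sinc; exact: normr_sin_le1.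
rewrite normrM => H; have := normr_ge0 (sinc u).
have : 1 <= `|u|.
  rewrite -(@ler_pXn2r _ 2)// ?nnegrE// expr1n real_normK ?num_real//; lra.
move=> u1 s0; have : `|sinc u| <= 1 by nra.
by rewrite ler_norml => /andP[].
Qed.

Lemma sinc_sqr_bound (R : realType) (u : R) : (1 + u ^+ 2) * sinc u ^+ 2 <= 2.
Proof.
rewrite mulrDl mul1r -exprMn mul_sinc.
have -> : 2 = 1 + 1 :> R by lra.
apply: lerD; rewrite -[X in X <= _]real_normK ?num_real// -(expr1n _ 2%N).
  by rewrite lerXn2r ?nnegrE// normr_sinc_le1.
by rewrite lerXn2r ?nnegrE// normr_sin_le1.
Qed.

Lemma continuous_sinc (R : realType) : continuous (@sinc R).
Proof.
move=> x; have [->|x0] := eqVneq x 0.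
  rewrite /continuous_at {2}/sinc eqxx.
  apply: (@squeeze_cvgr _ _ _ _ (fun u : R => 1 - u ^+ 2 / 6) (cst 1)).
  - by apply: nearW => u; exact: sinc_bounds.
  - have c : continuous (fun u : R => 1 - u ^+ 2 / 6).
      move=> z; apply: cvgB; first exact: cvg_cst.
      by apply: cvgM; [exact: exprn_continuous|exact: cvg_cst].
    by have := c 0; rewrite /continuous_at expr0n /= mul0r subr0.
  - exact: cvg_cst.
have H : \near x, sin x * x^-1 = sinc x.
  near=> z; rewrite /sinc ifN//; near: z.
  by apply: open_nbhs_nbhs; split => //; exact: open_neq.
rewrite /continuous_at -(nbhs_singleton H).
apply: cvg_trans; first exact: near_eq_cvg H.
by apply: cvgM; [exact: continuous_sin|apply: cvgV => //; exact: cvg_id].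
Unshelve. all: by end_near. Qed.

Lemma dominated_sinc (R : realType) n :
  lorentz_dominated (fun u : R => sinc u ^+ n.+2).
Proof.
apply: (@lorentz_dominatedW _ _ 2) => [x|u].
  apply: (@continuous_comp _ _ _ (@sinc R) (fun y => y ^+ n.+2)).
    exact: continuous_sinc.
  exact: exprn_continuous.
apply: le_trans (sinc_sqr_bound u); apply: ler_wpM2l.
  exact/ltW/oneDsqr_gt0.
rewrite normrX -[X in _ <= X]real_normK ?num_real// -(addn2 n) exprD.
apply: ler_piMl; first exact: sqr_ge0.
by rewrite exprn_ile1// normr_sinc_le1.
Qed.

Lemma dominated_sinc_cos (R : realType) n (b : R) :
  lorentz_dominated (fun u : R => sinc u ^+ n.+2 * cos (b * u)).
Proof.
apply: (@dominatedM _ _ _ 1); first exact: dominated_sinc.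
  exact: continuous_cosM.
by move=> u; exact: normr_cos_le1.
Qed.

Lemma expRN_bound (R : realType) (c x : R) : 0 < c -> 1 <= x ->
  x * expR (- (c * x)) <= 2 / c ^+ 2 / x.
Proof.
move=> c0 x1; have x0 : 0 < x by apply: lt_le_trans x1.
have := @expR_ge_pow _ 2 (c * x) (ltW (mulr_gt0 c0 x0)).
rewrite (_ : 2`! = 2)// ler_pdivrMr// exprMn => H.
rewrite expRN -mulrA -invfM ler_pdivlMr ?mulr_gt0 ?exprn_gt0//.
rewrite mulrAC ler_pdivrMr ?expR_gt0// [2 * _]mulrC; apply: le_trans H.
by rewrite expr2 [x ^+ 2]expr2; nra.
Qed.

Lemma integral_abs_expRN (R : realType) (c : R) : 0 < c ->
  (\int[@lebesgue_measure R]_v (`|v| * expR (- (c * `|v|)))%:E =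
   (2 / c ^+ 2)%:E)%E.
Proof.
move=> c0; have c1 : c != 0 by rewrite gt_eqF.
pose F (v : R) := - ((v / c + c ^- 2) * expR (- (c * v))).
have dF (v : R) : is_derive v 1 F (v * expR (- (c * v))).
  apply: (is_derive_val (is_derive_opp (is_derive_mul
    (is_derive_add (is_derive_mul (is_derive_var v) (is_derive_const v c^-1))
       (is_derive_const v (c ^- 2)))
    (is_derive_compose (is_derive_opp (is_derive_scale c (is_derive_var v)))
       (is_derive_expR (- (c * v))))))).
  by field.
rewrite (@integral_even_half _ _ F _ _ _ _ dF).
- by rewrite /F mul0r add0r mulr0 oppr0 expR0 mulr1 mulrN opprK.
- move=> v; apply: cvgM; first exact: norm_continuous.
  apply: (@continuous_comp _ _ _ (fun v : R => - (c * `|v|)) expR); last exact: continuous_expR.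
  by apply: cvgN; apply: cvgM; [exact: cvg_cst|exact: norm_continuous].
- by move=> v; rewrite mulr_ge0// expR_ge0.
- by move=> v; rewrite normrN.
- by move=> v v0; rewrite gtr0_norm.
- apply: (@inv_bound_cvg0 _ _ ((c^-1 + c ^- 2) * (2 / c ^+ 2))) => v v1.
  have v0 : 0 < v by apply: lt_le_trans v1.
  have ci : 0 < c^-1 by rewrite invr_gt0.
  have ci2 : 0 < c ^- 2 by rewrite invr_gt0 exprn_gt0.
  rewrite /F normrN ger0_norm; last first.
    by rewrite mulr_ge0 ?expR_ge0// addr_ge0 ?ltW// divr_gt0.
  apply: (@le_trans _ _ ((c^-1 + c ^- 2) * (v * expR (- (c * v))))).
    rewrite mulrA ler_wpM2r ?expR_ge0// mulrDl [v / c]mulrC lerD2l.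
    by rewrite ler_peMr// ltW.
  rewrite -[leRHS]mulrA ler_wpM2l ?addr_ge0 ?(ltW ci) ?(ltW ci2)//.
  exact: expRN_bound.
Qed.

Lemma integral_expRN_sin2 (R : realType) (c : R) : 0 < c ->
  (\int[@lebesgue_measure R]_u (expR (- (c * `|u|)) * sin u ^+ 2)%:E =
   (4 / (c * (c ^+ 2 + 4)))%:E)%E.
Proof.
move=> c0; have c1 : c != 0 by rewrite gt_eqF.
have c4 : c ^+ 2 + 4 != 0 by rewrite gt_eqF// ltr_wpDl ?sqr_ge0.
pose P (u : R) := - (2 * c)^-1 + (2 * (c ^+ 2 + 4))^-1 * (c * cos (2 * u) - 2 * sin (2 * u)).
pose F (u : R) := expR (- (c * u)) * P u.
have cos2 (u : R) : cos (2 * u) = 1 - 2 * sin u ^+ 2.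
  by rewrite mulr_natl cos_mulr2n cos2sin2; ring.
have dF (u : R) : is_derive u 1 F (expR (- (c * u)) * sin u ^+ 2).
  apply: (is_derive_val (is_derive_mul
    (is_derive_compose (is_derive_opp (is_derive_scale c (is_derive_var u)))
       (is_derive_expR (- (c * u))))
    (is_derive_add (is_derive_const u _) (is_derive_scale _ (is_derive_sub
      (is_derive_scale c (is_derive_cosM 2 u)) (is_derive_scale 2 (is_derive_sinM 2 u))))))).
  have -> : sin u ^+ 2 = (1 - cos (2 * u)) / 2 by rewrite cos2; field.
  by rewrite /P; field; rewrite c4.
rewrite (@integral_even_half _ _ F _ _ _ _ dF).
- rewrite /F /P !mulr0 oppr0 expR0 cos0 sin0; congr EFin; field.
  by rewrite c4.
- move=> u; apply: cvgM; last first.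
    apply: (@continuous_comp _ _ _ sin (fun y : R => y ^+ 2)); first exact: continuous_sin.
    exact: exprn_continuous.
  apply: (@continuous_comp _ _ _ (fun v : R => - (c * `|v|)) expR); last exact: continuous_expR.
  by apply: cvgN; apply: cvgM; [exact: cvg_cst|exact: norm_continuous].
- by move=> u; rewrite mulr_ge0 ?expR_ge0 ?sqr_ge0.
- by move=> u; rewrite normrN sinN sqrrN.
- by move=> u u0; rewrite gtr0_norm.
- pose B := (2 * c)^-1 + (2 * (c ^+ 2 + 4))^-1 * (c + 2).
  apply: (@inv_bound_cvg0 _ _ (B * (2 / c ^+ 2))) => u u1.
  have u0 : 0 < u by apply: lt_le_trans u1.
  have i1 : 0 < (2 * c)^-1 by rewrite invr_gt0 mulr_gt0.
  have i2 : 0 < (2 * (c ^+ 2 + 4))^-1.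
    by rewrite invr_gt0 mulr_gt0// ltr_wpDl ?sqr_ge0.
  have PB : `|P u| <= B.
    apply: le_trans (ler_normD _ _) _; rewrite normrN gtr0_norm// lerD2l.
    rewrite normrM (gtr0_norm i2); apply: ler_wpM2l; first exact: ltW.
    apply: le_trans (ler_normB _ _) _; rewrite !normrM (gtr0_norm c0) (@gtr0_norm _ 2)//.
    apply: lerD; first by rewrite ler_piMr ?(ltW c0)// normr_cos_le1.
    by rewrite ler_piMr// normr_sin_le1.
  rewrite /F normrM ger0_norm ?expR_ge0// mulrC.
  apply: (@le_trans _ _ (B * (u * expR (- (c * u))))).
    have B0 : 0 <= B by apply: le_trans PB; exact: normr_ge0.
    apply: (@le_trans _ _ (B * expR (- (c * u)))); first by rewrite ler_wpM2r ?expR_ge0.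
    by rewrite ler_wpM2l// ler_peMl ?expR_ge0.
  rewrite -[leRHS]mulrA ler_wpM2l//; last exact: expRN_bound.
  by apply: le_trans PB; exact: normr_ge0.
Qed.

(** For the closed forms of inner integrals, which may fail at the single point 0. *)
Lemma ge0_integral_eq_off0 (R : realType) (f g : R -> \bar R) :
  measurable_fun setT f -> measurable_fun setT g ->
  (forall x, 0 <= f x)%E -> (forall x, 0 <= g x)%E ->
  (forall x, x != 0 -> f x = g x) ->
  (\int[@lebesgue_measure R]_x f x = \int[@lebesgue_measure R]_x g x)%E.
Proof.
move=> mf mg f0 g0 fg; apply: ge0_ae_eq_integral => //.
exists [set 0]; split; first exact: measurable_set1.
  exact: lebesgue_measure_set1.
move=> x /= H; apply: contrapT => x0; apply: H => _.
by apply: fg; apply/eqP.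
Qed.

(** Tonelli on |v| e^(-|u v|) sin^2 u: integrating in v first gives 2 sinc^2 u, integrating in u
    first gives 4 / (v^2 + 4), whose integral is 2 pi. *)
Lemma integral_sinc2 (R : realType) :
  \int[@lebesgue_measure R]_u (sinc u ^+ 2) = pi.
Proof.
pose G (z : measurableTypeR R * measurableTypeR R) : \bar R :=
  (`|z.2| * expR (- (`|z.1| * `|z.2|)) * sin z.1 ^+ 2)%:E.
have mG : measurable_fun setT G.
  apply/measurable_EFinP; apply: measurable_funM.
    apply: measurable_funM; first exact: measurableT_comp.
    apply: measurableT_comp; first exact: measurable_expR.
    apply: measurableT_comp => //; apply: measurable_funM; exact: measurableT_comp.
  apply: measurable_funX; apply: measurableT_comp => //.
  by apply: continuous_measurable_fun; exact: continuous_sin.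
have G0 z : (0 <= G z)%E.
  by rewrite lee_fin; apply: mulr_ge0; [rewrite mulr_ge0 ?expR_ge0|exact: sqr_ge0].
have [cs [M sM]] := dominated_sinc R 0.
have s0 (u : R) : 0 <= sinc u ^+ 2 by exact: sqr_ge0.
have := @fubini_tonelli _ _ _ _ _ (@lebesgue_measure R) (@lebesgue_measure R) G mG G0.
rewrite (@ge0_integral_eq_off0 _ _ (fun u => 2%:E * (sinc u ^+ 2)%:E)%E); last 5 first.
- exact: (measurable_fun_fubini_tonelli_F G mG G0).
- apply: measurable_funeM; apply/measurable_EFinP; exact: continuous_measurable_fun.
- by move=> x; apply: integral_ge0 => y _.
- by move=> u; rewrite mule_ge0// lee_fin.
- move=> u u0; rewrite /G/=.
  under eq_integral => v _ do rewrite mulrC EFinM.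
  rewrite ge0_integralZl//=; last 2 first.
  + apply/measurable_EFinP; apply: measurable_funM => //.
    apply: measurableT_comp; first exact: measurable_expR.
    by apply: measurableT_comp => //; apply: measurable_funM.
  + by rewrite lee_fin sqr_ge0.
  rewrite integral_abs_expRN ?normr_gt0// -!EFinM; congr EFin.
  rewrite -mul_sinc exprMn real_normK ?num_real//; field.
  exact: u0.
rewrite [X in _ = X -> _](@ge0_integral_eq_off0 _ _ (fun v => 4%:E * ((v ^+ 2 + 4)^-1)%:E)%E); last 5 first.
- exact: (measurable_fun_fubini_tonelli_G G mG G0).
- apply: measurable_funeM; apply/measurable_EFinP; apply: continuous_measurable_fun.
  move=> v; apply: cvgV; first by rewrite gt_eqF// ltr_wpDl ?sqr_ge0.
  by apply: cvgD; [exact: exprn_continuous|exact: cvg_cst].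
- by move=> x; apply: integral_ge0 => y _.
- by move=> v; rewrite mule_ge0// lee_fin invr_ge0 addr_ge0 ?sqr_ge0.
- move=> v v0; rewrite /G/=.
  under eq_integral => u _ do rewrite -mulrA EFinM [(`|u| * _)%R]mulrC.
  rewrite ge0_integralZl//=; last 2 first.
  + apply/measurable_EFinP; apply: measurable_funM => //.
      apply: measurableT_comp; first exact: measurable_expR.
      by apply: measurableT_comp => //; apply: measurable_funM.
    by apply: measurable_funX; apply: continuous_measurable_fun; exact: continuous_sin.
  + by move=> u _; rewrite lee_fin mulr_ge0 ?expR_ge0 ?sqr_ge0.
  rewrite integral_expRN_sin2 ?normr_gt0// -!EFinM; congr EFin.
  rewrite real_normK ?num_real//; field.
  by rewrite normr_eq0 v0 gt_eqF// ltr_wpDl ?sqr_ge0.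
rewrite ge0_integralZl//; last 2 first.
- by apply/measurable_EFinP; exact: continuous_measurable_fun.
- by move=> u _; rewrite lee_fin.
rewrite ge0_integralZl//; last 2 first.
- apply/measurable_EFinP; apply: continuous_measurable_fun.
  move=> v; apply: cvgV; first by rewrite gt_eqF// ltr_wpDl ?sqr_ge0.
  by apply: cvgD; [exact: exprn_continuous|exact: cvg_cst].
- by move=> v _; rewrite lee_fin invr_ge0 addr_ge0 ?sqr_ge0.
have -> : (\int[@lebesgue_measure R]_v ((v ^+ 2 + 4)^-1)%:E = (pi / 2)%:E)%E.
  transitivity (\int[@lebesgue_measure R]_v (4^-1 * (1 + (2^-1 * v + 0) ^+ 2)^-1)%:E)%E.
    apply: eq_integral => v _; congr EFin; rewrite addr0.
    have h : 0 < (v : R) ^+ 2 + 4 by rewrite ltr_wpDl ?sqr_ge0.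
    by field; rewrite [4 + _]addrC gt_eqF.
  rewrite (@ge0_integral_affine _ 2^-1 0 (fun v => (4^-1 * (1 + v ^+ 2)^-1)%:E))//.
  - under eq_integral do rewrite EFinM.
    rewrite ge0_integralZl//; last 2 first.
    + apply/measurable_EFinP; apply: continuous_measurable_fun.
      by move=> v; exact: continuous_oneDsqrV.
    + by move=> v _; rewrite lee_fin invr_ge0 ltW// oneDsqr_gt0.
    rewrite integral_lorentz -!EFinM; congr EFin.
    by rewrite gtr0_norm ?invr_gt0//; field.
  - apply/measurable_EFinP; apply: measurable_funM => //.
    by apply: continuous_measurable_fun => v; exact: continuous_oneDsqrV.
  - by move=> v; rewrite lee_fin mulr_ge0// invr_ge0 ltW// oneDsqr_gt0.
have fin := integrable_fin_num measurableT (dominated_integrable (dominated_sinc R 0)).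
rewrite /Rintegral -(fineK fin) -!EFinM => -[] /= H.
by apply: (mulfI (x := 2)) => //; rewrite H; field.
Qed.

(** * Fourier inversion *)

(** The integrand is sin^2 (c u) / u^2 continued at u = 0; writing it with sinc keeps it continuous
    and covers c = 0. *)
Lemma Rintegral_sinc2_scale (R : realType) (c : R) :
  lorentz_dominated (fun u => c ^+ 2 * sinc (c * u) ^+ 2) /\
  \int[@lebesgue_measure R]_u (c ^+ 2 * sinc (c * u) ^+ 2) = pi * `|c|.
Proof.
have [->|c0] := eqVneq c 0.
  have -> : (fun u : R => 0 ^+ 2 * sinc (0 * u) ^+ 2) = (fun u => 0 / (1 + u ^+ 2)).
    by apply/funext => u; rewrite expr0n /= !mul0r.
  by split; [exact: dominated_lorentz|rewrite Rintegral_lorentz mul0r normr0 mulr0].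
have ds := dominated_sinc R 0.
have dc : lorentz_dominated (fun u : R => sinc (c * u) ^+ 2).
  apply: (@lorentz_dominatedW _ _ (2 * (1 + c ^- 2))) => [u|u].
    apply: (@continuous_comp _ _ _ ( *%R c) (fun y => sinc y ^+ 2)); last exact: ds.1.
    exact: mulrl_continuous.
  rewrite ger0_norm ?sqr_ge0//.
  apply: (@le_trans _ _ ((1 + c ^- 2) * ((1 + (c * u) ^+ 2) * sinc (c * u) ^+ 2))).
    rewrite [leRHS]mulrA; apply: ler_wpM2r; first exact: sqr_ge0.
    rewrite exprMn (_ : _ * (1 + c ^+ 2 * _) = 1 + u ^+ 2 + (c ^- 2 + c ^+ 2 * u ^+ 2)).
      rewrite lerDl; apply: addr_ge0; first by rewrite invr_ge0 sqr_ge0.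
      by apply: mulr_ge0; exact: sqr_ge0.
    by field.
  rewrite [leRHS]mulrC; apply: ler_wpM2l; last exact: sinc_sqr_bound.
  by rewrite addr_ge0// invr_ge0 sqr_ge0.
split; first exact: dominatedZ.
rewrite RintegralZl//; last exact: dominated_integrable.
rewrite (@Rintegral_scale _ (fun u => sinc u ^+ 2))// integral_sinc2 mulrA mulrC.
rewrite -[c ^+ 2]real_normK ?num_real// expr2 mulfK// normr_eq0//.
Qed.

(** The centred sum of n+1 uniform variables has characteristic function sinc (xi / 2)^(n+1). With
    xi = 2 u, this is pi times the density given by Fourier inversion at x. *)
Definition fourier_irwin_hall (R : realType) (n : nat) (x : R) : R :=
  \int[@lebesgue_measure R]_u (sinc u ^+ n.+1 * cos ((2 * x) * u)).

(** The integrand is half the second difference, of step 1 in x, of x^2 sinc^2 (x u), whose integral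
    is pi |x|; half the second difference of |x| is the triangular density. *)
Lemma fourier_irwin_hall1 (R : realType) (x : R) :
  fourier_irwin_hall 1 x = pi * irwin_hall 1 (1 + x).
Proof.
have E (u : R) : sinc u ^+ 2 * cos ((2 * x) * u) =
    2^-1 * (((x + 1) ^+ 2 * sinc ((x + 1) * u) ^+ 2 +
             (x - 1) ^+ 2 * sinc ((x - 1) * u) ^+ 2) -
            2 * (x ^+ 2 * sinc (x * u) ^+ 2)).
  have [->|u0] := eqVneq u 0.
    by rewrite !mulr0 cos0 /sinc eqxx; field.
  apply: (mulfI (expf_neq0 2 u0)).
  rewrite [LHS]mulrA -[u ^+ 2 * _]exprMn mul_sinc.
  have S c : u ^+ 2 * (c ^+ 2 * sinc (c * u) ^+ 2) = sin (c * u) ^+ 2.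
    by rewrite -!exprMn mulrA [u * c]mulrC mul_sinc.
  have D a b c : u ^+ 2 * (2^-1 * (a + b - 2 * c)) =
      2^-1 * (u ^+ 2 * a + u ^+ 2 * b - 2 * (u ^+ 2 * c)) by ring.
  rewrite D !S.
  have cos2 (y : R) : cos (2 * y) = 1 - 2 * sin y ^+ 2.
    by rewrite mulr_natl cos_mulr2n cos2sin2; ring.
  rewrite -[2 * x * u]mulrA cos2.
  rewrite (_ : (x + 1) * u = x * u + u); last by ring.
  rewrite (_ : (x - 1) * u = x * u - u); last by ring.
  rewrite sinD sinB.
  have := cos2sin2 u; have := cos2sin2 (x * u).
  move: (sin u) (cos u) (sin (x * u)) (cos (x * u)) => a b c d Hd Hb.
  transitivity (c ^+ 2 * b ^+ 2 + d ^+ 2 * a ^+ 2 - c ^+ 2); last by field.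
  by rewrite Hb Hd; ring.
have [d1 I1] := Rintegral_sinc2_scale (x + 1).
have [d2 I2] := Rintegral_sinc2_scale (x - 1).
have [d3 I3] := Rintegral_sinc2_scale x.
have d12 := dominatedD d1 d2; have d3' := dominatedZ 2 d3.
have d123 := dominatedB d12 d3'.
rewrite /fourier_irwin_hall; under eq_Rintegral do rewrite E.
rewrite RintegralZl//; last exact: (dominated_integrable d123).
rewrite RintegralB//; [|exact: (dominated_integrable d12)|exact: (dominated_integrable d3')].
rewrite RintegralD//; [|exact: (dominated_integrable d1)|exact: (dominated_integrable d2)].
rewrite I1 I2 RintegralZl//; last exact: (dominated_integrable d3).
rewrite I3 irwin_hall1 /Num.max; clear.
have [h1|h1] := ger0P (x + 1); have [h2|h2] := ger0P (x - 1); have [h3|h3] := ger0P x;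
  do 3 case: ifPn; rewrite -?leNgt; move=> *; try lra.
Qed.

Lemma integral_cos_shift (R : realType) (x u : R) :
  (\int[@lebesgue_measure R]_(y in `[0%R, 1%R]) (cos (2 * (x + 2^-1 - y) * u)%R)%:E =
   (sinc u * cos (2 * x * u)%R)%:E)%E.
Proof.
have dlin (y : R) : is_derive y 1 (fun y => 2 * (x + 2^-1 - y) * u) (- (2 * u)).
  apply: (is_derive_val (is_derive_mul (is_derive_scale 2 (is_derive_sub
    (is_derive_const y (x + 2^-1)) (is_derive_var y))) (is_derive_const y u))).
  by ring.
have ccos : continuous (fun y => cos (2 * (x + 2^-1 - y) * u)).
  move=> y; apply: (@continuous_comp _ _ _ (fun y => 2 * (x + 2^-1 - y) * u) cos).
    exact: is_derive_continuous dlin _.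
  exact: continuous_cos.
have [->|u0] := eqVneq u 0.
  under eq_integral do rewrite mulr0 cos0.
  rewrite integral_cst//= mul1e lebesgue_measure_itv/= lte_fin ltr01 sube0.
  by rewrite mulr0 cos0 /sinc eqxx mulr1.
pose F (y : R) := - (2 * u)^-1 * sin (2 * (x + 2^-1 - y) * u).
have dF (y : R) : is_derive y 1 F (cos (2 * (x + 2^-1 - y) * u)).
  apply: (is_derive_val (is_derive_scale (- (2 * u)^-1) (is_derive_compose (dlin y)
    (is_derive_sin (2 * (x + 2^-1 - y) * u))))).
  by field.
rewrite (integral_itv_derive ler01 dF ccos); congr EFin.
apply: (mulfI u0); rewrite mulrA mul_sinc /F.
rewrite (_ : 2 * (x + 2^-1 - 0) * u = 2 * x * u + u); last by field.
rewrite (_ : 2 * (x + 2^-1 - 1) * u = 2 * x * u - u); last by field.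
by rewrite sinB sinD; field.
Qed.

(** By Fubini the average over the unit interval falls on the cosine, where it costs one more factor
    sinc. The exponent is at least 2 because sinc is not absolutely integrable. *)
Lemma fourier_irwin_hallS (R : realType) n (x : R) :
  (\int[@lebesgue_measure R]_(y in `[0%R, 1%R])
     (fourier_irwin_hall n.+1 (x + 2^-1 - y)%R)%:E =
   (fourier_irwin_hall n.+2 x)%:E)%E.
Proof.
pose G (z : measurableTypeR R * measurableTypeR R) : R :=
  \1_(`[0%R, 1%R]%classic : set R) z.1 * (sinc z.2 ^+ n.+2 * cos (2 * (x + 2^-1 - z.1) * z.2)).
have msinc : measurable_fun [set: R] (@sinc R).
  by apply: continuous_measurable_fun; exact: continuous_sinc.
have mcos : measurable_fun [set: R] (@cos R).
  by apply: continuous_measurable_fun; exact: continuous_cos.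
have mind : measurable_fun [set: R] (\1_(`[0%R, 1%R]%classic : set R) : R -> R).
  exact: measurable_indic.
have m1 : measurable_fun setT (fun z : measurableTypeR R * measurableTypeR R => z.1 : R).
  exact: measurable_fst.
have m2 : measurable_fun setT (fun z : measurableTypeR R * measurableTypeR R => z.2 : R).
  exact: measurable_snd.
have mG : measurable_fun setT G.
  apply: measurable_funM.
    exact: (measurableT_comp mind m1).
  apply: measurable_funM.
    apply: measurable_funX; exact: (measurableT_comp msinc m2).
  apply: (measurableT_comp mcos); apply: measurable_funM => //.
  apply: measurable_funM => //; exact: measurable_funB.
have dsc (y : R) := dominated_sinc_cos n (2 * (x + 2^-1 - y)).
have inner (y : R) : (\int[@lebesgue_measure R]_u (G (y, u))%:E =
    (\1_(`[0%R, 1%R]%classic : set R) y * fourier_irwin_hall n.+1 (x + 2^-1 - y))%:E)%E.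
  rewrite /G/=; under eq_integral => u _ do rewrite EFinM.
  rewrite integralZl//; last exact: dominated_integrable.
  rewrite EFinM; congr (_ * _)%E.
  rewrite /fourier_irwin_hall /Rintegral fineK//.
  exact: (integrable_fin_num measurableT (dominated_integrable (dsc y))).
(* On [0, 1] x R the integrand is dominated by M / (1 + u^2), of total mass M pi. *)
have iG : ((@lebesgue_measure R) \x (@lebesgue_measure R))%E.-integrable setT (EFin \o G).
  apply/integrable12ltyP; first exact/measurable_EFinP.
  have [cs [M sM]] := dominated_sinc R n.
  have M0 : 0 <= M.
    by have := sM 0; rewrite expr0n/= addr0 divr1; exact: le_trans.
  apply: (@le_lt_trans _ _ (\int[@lebesgue_measure R]_y
      ((M * pi)%:E * (\1_(`[0%R, 1%R]%classic : set R) y)%:E))%E).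
    apply: ge0_le_integral => //.
    - by move=> y _; exact: integral_ge0.
    - apply: (measurable_fun_fubini_tonelli_F (fun z => `|(G z)%:E|)%E) => //.
      by apply/measurableT_comp => //; exact/measurable_EFinP.
    - apply: measurable_funeM; apply/measurable_EFinP; exact: measurable_indic.
    - move=> y _; apply: (@le_trans _ _ (\int[@lebesgue_measure R]_u
        ((\1_(`[0%R, 1%R]%classic : set R) y)%:E * (M * (1 + u ^+ 2)^-1)%:E))%E).
        apply: ge0_le_integral => //.
        + apply/measurable_EFinP; apply: measurableT_comp => //.
          exact: (measurableT_comp mG (pair1_measurable y)).
        + apply: measurable_funeM; apply/measurable_EFinP; apply: measurable_funM => //.
          by apply: continuous_measurable_fun => u; exact: continuous_oneDsqrV.
        + move=> u _; rewrite /G/= -EFinM lee_fin normrM ger0_norm// ler_wpM2l//.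
          rewrite normrM; apply: le_trans (sM u); rewrite ler_piMr//.
          exact: normr_cos_le1.
      rewrite ge0_integralZl//; last 2 first.
      + apply/measurable_EFinP; apply: measurable_funM => //.
        by apply: continuous_measurable_fun => u; exact: continuous_oneDsqrV.
      + by move=> u _; rewrite lee_fin mulr_ge0// invr_ge0 ltW// oneDsqr_gt0.
      have -> : (\int[@lebesgue_measure R]_u (M * (1 + u ^+ 2)^-1)%:E = (M * pi)%:E)%E.
        under eq_integral do rewrite EFinM.
        rewrite ge0_integralZl ?lee_fin//; last 2 first.
        - apply/measurable_EFinP.
          by apply: continuous_measurable_fun => u; exact: continuous_oneDsqrV.
        - by move=> u _; rewrite lee_fin invr_ge0 ltW// oneDsqr_gt0.
        by rewrite integral_lorentz -EFinM.
      by rewrite muleC.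
  rewrite ge0_integralZl//; last 2 first.
  - by apply/measurable_EFinP; exact: measurable_indic.
  - by rewrite lee_fin mulr_ge0// pi_ge0.
  have -> : (\int[@lebesgue_measure R]_y (\1_(`[0%R, 1%R]%classic : set R) y)%:E = 1)%E.
    rewrite integral_indic// setIT.
    by apply: (etrans (lebesgue_measure_itv _)); rewrite /= lte_fin ltr01 sube0.
  by rewrite mule1 ltry.
have F := Fubini iG.
rewrite integral_mkcond/=.
transitivity (\int[@lebesgue_measure R]_y \int[@lebesgue_measure R]_u (G (y, u))%:E)%E.
  apply: eq_integral => y _; rewrite inner patchE indicE.
  by case: ifPn => _; rewrite ?mul1r ?mul0r.
rewrite F /fourier_irwin_hall /Rintegral fineK; last first.
  exact: (integrable_fin_num measurableT (dominated_integrable (dominated_sinc_cos n.+1 (2 * x)))).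
apply: eq_integral => u _.
transitivity (\int[@lebesgue_measure R]_(y in `[0%R, 1%R])
    ((sinc u ^+ n.+2)%:E * (cos (2 * (x + 2^-1 - y) * u)%R)%:E))%E.
  rewrite [RHS]integral_mkcond/=; apply: eq_integral => y _.
  by rewrite patchE /G/= indicE; case: ifPn => _; rewrite ?mul1r ?mul0r.
rewrite integralZl//; last first.
  apply: continuous_compact_integrable; first exact: segment_compact.
  apply: continuous_subspaceT => y.
  apply: (@continuous_comp _ _ _ (fun y => 2 * (x + 2^-1 - y) * u) cos).
    apply: cvgM; last exact: cvg_cst.
    apply: cvgM; first exact: cvg_cst.
    by apply: cvgB; [exact: cvg_cst|exact: cvg_id].
  exact: continuous_cos.
by rewrite integral_cos_shift -EFinM mulrA -exprSr.
Qed.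

(** Induction from the triangular density: [integral_irwin_hall] and [fourier_irwin_hallS] are the
    same recursion. *)
Lemma irwin_hall_fourier (R : realType) n (x : R) :
  irwin_hall n.+1 (n.+2%:R / 2 + x) = pi^-1 * fourier_irwin_hall n.+1 x.
Proof.
have pi0 : pi != 0 :> R by rewrite gt_eqF// pi_gt0.
elim: n x => [|n ih] x.
  by rewrite fourier_irwin_hall1 mulKf// divff.
apply: EFin_inj; rewrite -integral_irwin_hall.
transitivity (\int[@lebesgue_measure R]_(y in `[0%R, 1%R])
    ((pi^-1)%:E * (fourier_irwin_hall n.+1 (x + 2^-1 - y)%R)%:E))%E.
  apply: eq_integral => y _; rewrite -EFinM -ih; congr (irwin_hall _ _)%:E.
  by rewrite -[n.+3%:R]natr1; field.
rewrite EFinM -fourier_irwin_hallS.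
have -> : fourier_irwin_hall n.+1 = (fun x : R => pi * irwin_hall n.+1 (n.+2%:R / 2 + x)).
  by apply/funext => y; rewrite ih mulrA mulfV// mul1r.
rewrite integralZl//.
apply: continuous_compact_integrable; first exact: segment_compact.
apply: continuous_subspaceT => y.
apply: cvgM; first exact: cvg_cst.
rewrite /irwin_hall; apply: cvgM; last exact: cvg_cst.
apply: cvg_big => [|k _]; first exact: add_continuous.
apply: cvgM; first exact: cvg_cst.
apply: (@continuous_comp _ _ _ (fun y : R => n.+2%:R / 2 + (x + 2^-1 - y) - k%:R) (pospow n.+1)); last first.
  exact: continuous_pospow.
apply: cvgB; last exact: cvg_cst.
apply: cvgD; first exact: cvg_cst.
by apply: cvgB; [exact: cvg_cst|exact: cvg_id].
Qed.

(** * Sections in dimensions 4 to 20 *)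

(* Imported only here: [ZArith] shadows names used above and rebinds %N, and
   [ring] has to be imported again after it. *)
From Stdlib Require Import ZArith.
From mathcomp Require Import zify ssrZ ring lra.
Delimit Scope nat_scope with N.

(** * Integer polynomials and positivity by Bernstein coefficients *)

(** Real numerals are unary; [Z] is binary, so the certificates are computed there and transported
    to R by this morphism. *)
Definition zr (R : realType) (z : Z) : R := (int_of_Z z)%:~R.

Lemma zrD (R : realType) a b : zr R (a + b) = zr R a + zr R b.
Proof. by rewrite /zr (rmorphD int_of_Z) rmorphD. Qed.

Lemma zrM (R : realType) a b : zr R (a * b) = zr R a * zr R b.
Proof. by rewrite /zr (rmorphM int_of_Z) rmorphM. Qed.

Lemma zrN (R : realType) a : zr R (- a) = - zr R a.
Proof. by rewrite /zr (rmorphN int_of_Z) rmorphN. Qed.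

Lemma zrB (R : realType) a b : zr R (a - b) = zr R a - zr R b.
Proof. by rewrite zrD zrN. Qed.

Lemma zr_nat (R : realType) n : zr R (Z.of_nat n) = n%:R.
Proof. by rewrite /zr -[Z.of_nat n]/(Z_of_int n) Z_of_intK. Qed.

Lemma zr0 (R : realType) : zr R 0 = 0. Proof. exact: zr_nat R 0. Qed.
Lemma zr1 (R : realType) : zr R 1 = 1. Proof. exact: zr_nat R 1. Qed.

Lemma le_zr (R : realType) a b : (a <=? b)%Z -> zr R a <= zr R b.
Proof.
move=> ab; rewrite -subr_ge0 -zrB /zr ler0z.
have : (0 <= b - a)%Z by lia.
by case: (b - a)%Z => //= p [].
Qed.

Lemma lt_zr (R : realType) a b : (a <? b)%Z -> zr R a < zr R b.
Proof.
move=> ab; apply: (@lt_le_trans _ _ (zr R (a + 1))).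
  by rewrite zrD zr1 ltrDl.
by apply: le_zr; lia.
Qed.

Definition polyZ_eval (R : realType) (p : seq Z) (y : R) : R :=
  foldr (fun a v => zr R a + y * v) 0 p.

Fixpoint addZs (p q : seq Z) : seq Z :=
  match p, q with
  | [::], _ => q
  | _, [::] => p
  | a :: p', b :: q' => (a + b)%Z :: addZs p' q'
  end.

Definition scaleZs (c : Z) (p : seq Z) : seq Z := [seq (c * a)%Z | a <- p].

Lemma polyZ_eval_cons (R : realType) a p (y : R) :
  polyZ_eval (a :: p) y = zr R a + y * polyZ_eval p y.
Proof. by []. Qed.

Lemma polyZ_evalD (R : realType) p q (y : R) :
  polyZ_eval (addZs p q) y = polyZ_eval p y + polyZ_eval q y.
Proof.
elim: p q => [|a p ih] [|b q] /=; rewrite ?add0r ?addr0//.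
by rewrite ih zrD; ring.
Qed.

Lemma polyZ_evalZ (R : realType) c p (y : R) :
  polyZ_eval (scaleZs c p) y = zr R c * polyZ_eval p y.
Proof. by elim: p => [|a p ih] /=; rewrite ?mulr0// ih zrM; ring. Qed.

(* The list [h] stands for the form in l, m whose coefficient of
   m^i l^(size h - 1 - i) is the i-th entry. *)
Fixpoint form_eval (R : realType) (h : seq Z) (l m : R) : R :=
  if h is c :: h' then zr R c * l ^+ size h' + m * form_eval h' l m else 0.

Definition mul_linear (a b : Z) (h : seq Z) : seq Z :=
  addZs (rcons (scaleZs a h) 0%Z) (0%Z :: scaleZs b h).

Lemma size_addZs p q : size p = size q -> size (addZs p q) = size p.
Proof. by elim: p q => [|a p ih] [|b q] //= [] /ih ->. Qed.

Lemma size_mul_linear a b h : size (mul_linear a b h) = (size h).+1.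
Proof. by rewrite /mul_linear size_addZs size_rcons ?size_map//= size_map. Qed.

Lemma form_evalD (R : realType) p q (l m : R) : size p = size q ->
  form_eval (addZs p q) l m = form_eval p l m + form_eval q l m.
Proof.
elim: p q => [|a p ih] [|b q] //= pq; first by rewrite addr0.
by case: pq => pq; rewrite ih// size_addZs// pq zrD; ring.
Qed.

Lemma form_evalZ (R : realType) c p (l m : R) :
  form_eval (scaleZs c p) l m = zr R c * form_eval p l m.
Proof. by elim: p => [|a p ih] /=; rewrite ?mulr0// ih zrM size_map; ring. Qed.

Lemma form_eval_rcons0 (R : realType) h (l m : R) :
  form_eval (rcons h 0%Z) l m = l * form_eval h l m.
Proof.
elim: h => [|c h ih] /=; first by rewrite zr0 mul0r mulr0 addr0 mulr0.
by rewrite ih size_rcons exprS; ring.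
Qed.

Lemma form_eval_mul_linear (R : realType) a b h (l m : R) :
  form_eval (mul_linear a b h) l m = (zr R a * l + zr R b * m) * form_eval h l m.
Proof.
rewrite /mul_linear form_evalD; last by rewrite size_rcons /= !size_map.
rewrite form_eval_rcons0 /= !form_evalZ.
by rewrite zr0; ring.
Qed.

Lemma form_eval_ge0 (R : realType) h (l m : R) : 0 <= l -> 0 <= m ->
  all (Z.leb 0) h -> 0 <= form_eval h l m.
Proof.
move=> l0 m0; elim: h => [|c h ih] //= /andP[c0 /ih h0].
have {}c0 : 0 <= zr R c by rewrite -(zr0 R); exact: le_zr.
by rewrite addr_ge0 ?mulr_ge0 ?exprn_ge0.
Qed.

(* The forms (l + m)^(size p - 1) p((A l + B m) / (l + m)) and (l + m)^(size p). *)
Fixpoint bernstein (A B : Z) (p : seq Z) : seq Z * seq Z :=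
  if p is a :: q then
    let: (h, L) := bernstein A B q in
    (addZs (scaleZs a L) (mul_linear A B h), mul_linear 1 1 L)
  else ([::], [:: 1%Z]).

Lemma bernsteinE (R : realType) A B p (l m y : R) :
  y * (l + m) = zr R A * l + zr R B * m ->
  [/\ size (bernstein A B p).1 = size p, size (bernstein A B p).2 = (size p).+1,
      form_eval (bernstein A B p).2 l m = (l + m) ^+ size p &
      form_eval (bernstein A B p).1 l m * (l + m) = (l + m) ^+ size p * polyZ_eval p y].
Proof.
move=> yE; elim: p => [|a p] /=.
  by split=> //; rewrite ?zr1 ?mul0r ?mulr0// mulr1 addr0.
case: (bernstein A B p) => h L /= [sh sL hL hE].
have S : size (scaleZs a L) = size (mul_linear A B h).
  by rewrite size_map size_mul_linear sL sh.
split; rewrite ?size_mul_linear ?sL//; first by rewrite size_addZs// size_map.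
  by rewrite form_eval_mul_linear hL zr1 !mul1r exprS.
rewrite form_evalD// form_evalZ hL form_eval_mul_linear -yE mulrDl.
by rewrite -[_ * form_eval _ _ _ * _]mulrA hE exprS; ring.
Qed.

(** For p of degree less than N = size p, the first component q satisfies q(D y) = D^(N-1) p(y), so
    the endpoints A / D and B / D become integers. The second component is D^N. *)
Fixpoint rescaleZs (D : Z) (p : seq Z) : seq Z * Z :=
  if p is a :: q then
    let: (q', c) := rescaleZs D q in ((c * a)%Z :: q', (D * c)%Z)
  else ([::], 1%Z).

Lemma rescaleZsE (R : realType) D p (y : R) :
  zr R (rescaleZs D p).2 = zr R D ^+ size p /\
  zr R D * polyZ_eval (rescaleZs D p).1 (zr R D * y) = zr R D ^+ size p * polyZ_eval p y.
Proof.
elim: p => [|a p] /=; first by rewrite zr1 !mulr0.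
case: (rescaleZs D p) => q c /= [ih1 ih2]; rewrite !zrM ih1 exprS; split=> //.
rewrite [RHS]mulrDr [X in _ = _ + X](_ : _ = zr R D * y * (zr R D ^+ size p * polyZ_eval p y)).
  by rewrite -ih2; ring.
by ring.
Qed.

Definition nonneg_on (A B D : Z) (p : seq Z) : bool :=
  [&& (0 <? D)%Z, (A <? B)%Z & all (Z.leb 0) (bernstein A B (rescaleZs D p).1).1].

Lemma nonneg_onP (R : realType) A B D p (y : R) : nonneg_on A B D p ->
  zr R A <= zr R D * y <= zr R B -> 0 <= polyZ_eval p y.
Proof.
move=> /and3P[D0 AB h0] /andP[Ay yB].
have D0' : 0 < zr R D by rewrite -(zr0 R); exact: lt_zr.
have AB' := lt_zr R AB.
(* Unnormalized barycentric coordinates of D y between A and B; both are nonnegative on the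
   interval. *)
pose l := zr R B - zr R D * y; pose m := zr R D * y - zr R A.
have yE : zr R D * y * (l + m) = zr R A * l + zr R B * m by rewrite /l /m; ring.
have [_ _ _ E] := @bernsteinE R A B (rescaleZs D p).1 l m _ yE.
have [_ E'] := @rescaleZsE R D p y.
have M0 : 0 < l + m by rewrite /l /m; lra.
rewrite -(pmulr_rge0 _ (exprn_gt0 (size p) D0')) -E' pmulr_rge0//.
rewrite -(pmulr_rge0 _ (exprn_gt0 (size (rescaleZs D p).1) M0)) -E.
rewrite mulr_ge0 ?(ltW M0)//.
by apply: form_eval_ge0 h0; rewrite /l /m; lra.
Qed.

Definition linear_powZ (c : Z) (n : nat) : seq Z :=
  ssrnat.iter n (fun p => addZs (0%Z :: p) (scaleZs c p)) [:: 1%Z].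

Lemma linear_powZE (R : realType) c n (y : R) :
  polyZ_eval (linear_powZ c n) y = (y + zr R c) ^+ n.
Proof.
elim: n => [|n ih]; first by rewrite /= zr1 mulr0 addr0.
rewrite /linear_powZ iterS -/(linear_powZ c n) polyZ_evalD polyZ_eval_cons.
by rewrite polyZ_evalZ ih zr0 exprS; ring.
Qed.

(** A whole row at once, by additions in binary, so that [vm_compute] meets no unary binomial
    coefficient. *)
Definition pascalZ (n : nat) : seq Z :=
  ssrnat.iter n (fun r => addZs (rcons r 0%Z) (0%Z :: r)) [:: 1%Z].

Lemma nth_addZs p q j : nth 0%Z (addZs p q) j = (nth 0 p j + nth 0 q j)%Z.
Proof.
elim: p q j => [|a p ih] [|b q] [|j] //=; rewrite ?Z.add_0_r//.
Qed.

Lemma nth_pascalZ n j : nth 0%Z (pascalZ n) j = Z.of_nat 'C(n, j).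
Proof.
elim: n j => [|n ih] j; first by case: j => [|j]; rewrite ?bin0 ?bin0n //= nth_nil.
rewrite /pascalZ iterS -/(pascalZ n) nth_addZs nth_rcons_default.
case: j => [|j]; first by rewrite [nth _ (_ :: _) _]/= Z.add_0_r ih !bin0.
by rewrite [nth _ (_ :: _) _]/= !ih binS Nat2Z.inj_add.
Qed.

Fixpoint factZ (n : nat) : Z :=
  if n is m.+1 then (Z.of_nat n * factZ m)%Z else 1%Z.

Lemma zr_factZ (R : realType) n : zr R (factZ n) = n`!%:R.
Proof.
elim: n => [|n ih]; first exact: zr1.
by rewrite -[factZ n.+1]/(Z.of_nat n.+1 * factZ n)%Z zrM zr_nat ih factS natrM.
Qed.

Lemma polyZ_eval_sum (R : realType) (F : nat -> seq Z) s (y : R) :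
  polyZ_eval (foldr (fun j => addZs (F j)) [::] s) y = \sum_(j <- s) polyZ_eval (F j) y.
Proof.
elim: s => [|j s ih]; first by rewrite big_nil.
by rewrite big_cons -ih /= polyZ_evalD.
Qed.

(* In the variable y = 2 s - (n + 1), on the interval k <= s <= k + 1. *)
Definition irwin_hall_poly (n k : nat) : seq Z :=
  let row := pascalZ n.+1 in
  foldr (fun j => addZs (scaleZs ((if odd j then -1 else 1) * nth 0 row j)%Z
      (linear_powZ (Z.of_nat n.+1 - 2 * Z.of_nat j) n))) [::] (iota 0 k.+1).

(** Between the knots k and k + 1 the truncated powers of index at most k are plain powers and the
    others vanish; both ends are allowed since the powers vanish at their own knots. The factor
    2^(n+1) (n+1)! clears the denominators. *)
Lemma irwin_hall_polyE (R : realType) n k (y : R) : (k <= n.+2)%N ->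
  2 * k%:R <= n.+2%:R + y <= 2 * k.+1%:R ->
  polyZ_eval (irwin_hall_poly n.+1 k) y =
  2 ^+ n.+1 * n.+1`!%:R * irwin_hall n.+1 ((n.+2%:R + y) / 2).
Proof.
move=> kn /andP[ky yk].
have -> : polyZ_eval (irwin_hall_poly n.+1 k) y =
    \sum_(0 <= j < k.+1) ((-1) ^+ j * 'C(n.+2, j)%:R * (y + n.+2%:R - 2 * j%:R) ^+ n.+1).
  rewrite /irwin_hall_poly polyZ_eval_sum /index_iota subn0; apply: eq_bigr => j _.
  rewrite polyZ_evalZ linear_powZE zrM nth_pascalZ zr_nat.
  rewrite zrB zrM !zr_nat (zr_nat R 2) addrA; congr (_ * _ * _).
  by rewrite -signr_odd; case: (odd j); rewrite ?zr1// -(zr1 R) -zrN.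
rewrite /irwin_hall -(big_mkord xpredT (fun k0 => (-1) ^+ k0 * 'C(n.+2, k0)%:R *
   pospow n.+1 ((n.+2%:R + y) / 2 - k0%:R))).
rewrite [in RHS](big_cat_nat _ (n := k.+1))//=.
rewrite [X in _ * ((_ + X) / _)]big_nat_cond [X in _ * ((_ + X) / _)]big1 => [|j].
  have f0 : n.+1`!%:R != 0 :> R by rewrite pnatr_eq0 -lt0n fact_gt0.
  rewrite addr0 -mulrA [X in _ = _ * X]mulrC divfK// mulr_sumr !big_nat; apply: eq_bigr => j /andP[_ jk].
  rewrite pospow_ge; last first.
    have : (j%:R : R) <= k%:R by rewrite ler_nat.
    by move: ky; lra.
  rewrite mulrCA -exprMn; congr (_ * _ ^+ _); by field.
rewrite andbT => /andP[kj _]; rewrite pospow_le ?mulr0//.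
have : k.+1%:R <= j%:R :> R by rewrite ler_nat.
by move: yk; lra.
Qed.

Lemma zrX (R : realType) a n : zr R (a ^ Z.of_nat n) = zr R a ^+ n.
Proof.
elim: n => [|n ih]; first exact: zr1.
by rewrite Nat2Z.inj_succ Z.pow_succ_r ?zrM ?ih ?exprS//; lia.
Qed.

Lemma zr_lt (R : realType) a b : zr R a < zr R b -> (a < b)%Z.
Proof.
move=> ab; have [//|ba] : (a < b \/ b <= a)%Z by lia.
have : zr R b <= zr R a by apply: le_zr; lia.
by rewrite leNgt ab.
Qed.

Lemma zr_le (R : realType) a b : zr R a <= zr R b -> (a <= b)%Z.
Proof.
move=> ab; have [//|ba] : (a <= b \/ b < a)%Z by lia.
have : zr R b < zr R a by apply: lt_zr; lia.
by rewrite ltNge ab.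
Qed.

Lemma irwin_hall_ge0 (R : realType) n (s : R) : 0 <= irwin_hall n.+1 s.
Proof.
elim: n s => [|n ih] s.
  rewrite irwin_hall1 /Num.max; do 3 case: ifPn; rewrite -?leNgt => *; lra.
rewrite -lee_fin -integral_irwin_hall; apply: integral_ge0 => x _.
by rewrite lee_fin.
Qed.

(* I_(n+2)(t). *)
Definition diag_density (R : realType) (n : nat) (t : R) : R :=
  Num.sqrt n.+2%:R *
  irwin_hall n.+1 (n.+2%:R / 2 + Num.sqrt n.+2%:R * t).

(* A test for e 10^6 2^(n+1) (n+1)! I_(n+2)(t) <= rhs(2 sqrt d t) on the range
   a <= 10^5 t <= b, one interval between consecutive knots at a time; r / 10^6
   is an upper approximation of sqrt d. *)
Definition section_le (n : nat) (a b e : Z) (rhs : seq Z) : bool :=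
  let d := Z.of_nat n.+2 in
  let r := (Z.sqrt (d * 10 ^ 12) + 1)%Z in
  let lo := (2 * a * (r - 1) / 10 ^ 8)%Z in
  let hi := (2 * b * r / 10 ^ 8 + 1)%Z in
  let k0 := ((lo / 10 ^ 3 + d) / 2)%Z in
  let k1 := ((hi / 10 ^ 3 + d) / 2)%Z in
  [&& (0 <=? a)%Z, (0 <=? b)%Z, (0 <=? e)%Z, (k1 <? d)%Z &
    all (fun k => let c := (2 * Z.of_nat k - d)%Z in
      nonneg_on (Z.max lo (10 ^ 3 * c)) (Z.min hi (10 ^ 3 * (c + 2))) (10 ^ 3)
        (addZs rhs (scaleZs (- (e * r)) (irwin_hall_poly n.+1 k))))
      (iota (Z.to_nat k0) (Z.to_nat (k1 - k0 + 1)))].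

Lemma sqrt_boundZ (R : realType) (d : nat) :
  zr R (Z.sqrt (Z.of_nat d * 10 ^ 12) + 1 - 1) <= 10 ^+ 6 * Num.sqrt d%:R
    <= zr R (Z.sqrt (Z.of_nat d * 10 ^ 12) + 1).
Proof.
set r := (_ + 1)%Z.
have [s1 s2] : (Z.sqrt (Z.of_nat d * 10 ^ 12) * Z.sqrt (Z.of_nat d * 10 ^ 12) <=
    Z.of_nat d * 10 ^ 12 < r * r)%Z by apply: Z.sqrt_spec; lia.
have r1 : (r - 1 = Z.sqrt (Z.of_nat d * 10 ^ 12))%Z by rewrite /r; lia.
have r0 : (0 <= r - 1)%Z by rewrite r1; exact: Z.sqrt_nonneg.
have E : (10 ^+ 6 * Num.sqrt d%:R) ^+ 2 = zr R (Z.of_nat d * 10 ^ 12).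
  rewrite exprMn sqr_sqrtr// zrM zr_nat (zrX R 10 12) (zr_nat R 10) -exprM.
  by rewrite mulrC.
have r0' : 0 <= zr R (r - 1) by rewrite -(zr0 R); apply: le_zr; lia.
have r0'' : 0 <= zr R r by rewrite -(zr0 R); apply: le_zr; lia.
have S0 : 0 <= 10 ^+ 6 * Num.sqrt d%:R :> R by rewrite mulr_ge0 ?sqrtr_ge0.
apply/andP; split; rewrite -(@ler_pXn2r _ 2) ?nnegrE// E expr2 -zrM; apply: le_zr; lia.
Qed.

(** Ensures that the intervals tested by [section_le] include every one that meets the range of y,
    despite the integer divisions. *)
Lemma piece_indexZ (lo hi d : Z) (k : nat) :
  (lo < 10 ^ 3 * (2 * Z.of_nat k - d + 2))%Z ->
  (10 ^ 3 * (2 * Z.of_nat k - d) <= hi)%Z ->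
  let k0 := ((lo / 10 ^ 3 + d) / 2)%Z in let k1 := ((hi / 10 ^ 3 + d) / 2)%Z in
  (Z.of_nat k <= k1)%Z /\ k \in iota (Z.to_nat k0) (Z.to_nat (k1 - k0 + 1)).
Proof.
move=> b1 b2 k0 k1.
have kk0 : (k0 <= Z.of_nat k)%Z.
  have : (lo / 10 ^ 3 < 2 * Z.of_nat k - d + 2)%Z by apply: Z.div_lt_upper_bound; lia.
  by have := Z.mul_div_le (lo / 10 ^ 3 + d) 2; rewrite -/k0; move: (lo / _)%Z k0; lia.
have kk1 : (Z.of_nat k <= k1)%Z.
  have : (2 * Z.of_nat k - d <= hi / 10 ^ 3)%Z by apply: Z.div_le_lower_bound; lia.
  by move=> h; apply: Z.div_le_lower_bound; move: (hi / _)%Z h; lia.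
by split=> //; rewrite mem_iota; move: k0 k1 kk0 kk1; lia.
Qed.

(** In y = 2 sqrt d t everything but the prefactor sqrt d is rational. That prefactor is replaced by
    r / 10^6, which only strengthens the inequality tested, and the range of y is enlarged to the
    integers lo and hi at scale 10^3. *)
Lemma section_leP (R : realType) n a b e rhs (t : R) : section_le n a b e rhs ->
  zr R a <= 10 ^+ 5 * t <= zr R b ->
  zr R e * 10 ^+ 6 * (2 ^+ n.+1 * n.+1`!%:R) * diag_density n t <=
  polyZ_eval rhs (2 * Num.sqrt n.+2%:R * t).
Proof.
rewrite /section_le; set d := Z.of_nat n.+2; set r := (Z.sqrt _ + 1)%Z.
set lo := (2 * a * (r - 1) / 10 ^ 8)%Z; set hi := (2 * b * r / 10 ^ 8 + 1)%Z.
set k0 := ((lo / 10 ^ 3 + d) / 2)%Z; set k1 := ((hi / 10 ^ 3 + d) / 2)%Z.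
move=> /and5P[a0 b0 e0 k1d /allP H] /andP[at_ tb].
set y := 2 * Num.sqrt n.+2%:R * t.
have dE : zr R d = n.+2%:R by rewrite zr_nat.
have /andP[r1 r2] : zr R (r - 1) <= 10 ^+ 6 * Num.sqrt n.+2%:R <= zr R r.
  exact: sqrt_boundZ.
have rge : (0 <= r - 1)%Z by rewrite /r Z.add_simpl_r; exact: Z.sqrt_nonneg.
have rge' : 0 <= zr R (r - 1) by rewrite -(zr0 R); apply/le_zr/Z.leb_le.
have a0' : 0 <= zr R a by rewrite -(zr0 R); apply: le_zr.
have e0' : 0 <= zr R e by rewrite -(zr0 R); apply: le_zr.
have s0 : 0 <= Num.sqrt n.+2%:R :> R by exact: sqrtr_ge0.
have t0 : 0 <= 10 ^+ 5 * t by exact: le_trans at_.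
have y0 : 0 <= y by rewrite /y; apply: mulr_ge0; [rewrite mulr_ge0|lra].
have yE : 10 ^+ 8 * (10 ^+ 3 * y) = 2 * ((10 ^+ 5 * t) * (10 ^+ 6 * Num.sqrt n.+2%:R)).
  by rewrite /y; ring.
have lo5 : (10 ^ 8 * lo <= 2 * a * (r - 1))%Z by exact: Z.mul_div_le.
have hi5 : (2 * b * r <= 10 ^ 8 * hi)%Z.
  by rewrite /hi Z.add_1_r; apply/Z.lt_le_incl; exact: Z.mul_succ_div_gt.
have T5 : zr R (10 ^ 8) = 10 ^+ 8 by rewrite (zrX R 10 8) (zr_nat R 10).
have T5' : 0 < 10 ^+ 8 :> R by rewrite exprn_gt0.
have ylo : zr R lo <= 10 ^+ 3 * y.
  rewrite -(ler_pM2l T5') yE; move/Z.leb_le/(le_zr R): lo5.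
  rewrite zrM T5 -Z.mul_assoc zrM (zr_nat R 2) zrM => /le_trans; apply.
  by rewrite ler_wpM2l//; exact: ler_pM.
have yhi : 10 ^+ 3 * y <= zr R hi.
  rewrite -(ler_pM2l T5') yE; move/Z.leb_le/(le_zr R): hi5.
  rewrite [zr R (_ * hi)]zrM T5 -Z.mul_assoc zrM (zr_nat R 2) zrM; apply: le_trans.
  by rewrite ler_wpM2l//; apply: ler_pM => //; rewrite mulr_ge0.
have yd0 : 0 <= (n.+2%:R + y) / 2 by rewrite divr_ge0// addr_ge0.
(* k is the index of the knot interval containing (d + y) / 2. *)
have /andP[ky yk] := truncn_itv yd0; set k := Num.truncn _ in ky yk.
have zk : zr R (2 * Z.of_nat k - d) = 2 * k%:R - n.+2%:R.
  by rewrite zrB zrM !zr_nat (zr_nat R 2).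
have zk2 : zr R (2 * Z.of_nat k - d + 2) = 2 * k.+1%:R - n.+2%:R.
  by rewrite zrD zk (zr_nat R 2) -natr1; ring.
have T6 : zr R (10 ^ 3) = 10 ^+ 3 by rewrite (zrX R 10 3) (zr_nat R 10).
have T6' : 0 < 10 ^+ 3 :> R by rewrite exprn_gt0.
have ky' : 2 * k%:R - n.+2%:R <= y by lra.
have yk' : y < 2 * k.+1%:R - n.+2%:R by lra.
have c1 : zr R (10 ^ 3 * (2 * Z.of_nat k - d)) <= 10 ^+ 3 * y.
  by rewrite zrM zk T6 ler_pM2l.
have c2 : 10 ^+ 3 * y < zr R (10 ^ 3 * (2 * Z.of_nat k - d + 2)).
  by rewrite zrM zk2 T6 ltr_pM2l.
have b1 : (lo < 10 ^ 3 * (2 * Z.of_nat k - d + 2))%Z.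
  by apply: (@zr_lt R); exact: le_lt_trans c2.
have b2 : (10 ^ 3 * (2 * Z.of_nat k - d) <= hi)%Z.
  by apply: (@zr_le R); exact: le_trans yhi.
have [kk1 kin] := piece_indexZ b1 b2.
have kn : (k <= n.+2)%N by move: kk1 k1d; rewrite -/k1 /d; clear; move: k1 k; lia.
have := nonneg_onP (y := y) (H k kin); rewrite T6.
have -> : zr R (Z.max lo (10 ^ 3 * (2 * Z.of_nat k - d))) <= 10 ^+ 3 * y <=
    zr R (Z.min hi (10 ^ 3 * (2 * Z.of_nat k - d + 2))).
  apply/andP; split.
    by case: (Z.max_spec lo (10 ^ 3 * (2 * Z.of_nat k - d))) => [[_ ->]|[_ ->]].
  case: (Z.min_spec hi (10 ^ 3 * (2 * Z.of_nat k - d + 2))) => [[_ ->]|[_ ->]] //.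
  exact: ltW.
move=> /(_ isT); rewrite polyZ_evalD polyZ_evalZ irwin_hall_polyE//; last by lra.
rewrite zrN zrM /diag_density.
rewrite (_ : (n.+2%:R + y) / 2 = n.+2%:R / 2 + Num.sqrt n.+2%:R * t); last by rewrite /y; field.
rewrite mulNr subr_ge0; apply: le_trans.
set g := irwin_hall _ _; have g0 : 0 <= g by exact: irwin_hall_ge0.
rewrite (_ : _ * (Num.sqrt n.+2%:R * g) = zr R e * (10 ^+ 6 * Num.sqrt n.+2%:R) *
  (2 ^+ n.+1 * (n.+1)`!%:R * g)); last by ring.
apply: ler_wpM2r; last exact: ler_wpM2l.
by apply: mulr_ge0 => //; rewrite mulr_ge0 ?exprn_ge0.
Qed.

(** The common denominator carried by [irwin_hall_poly], by which the right-hand sides are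
    multiplied. *)
Definition denZ (n : nat) : Z := (2 ^ Z.of_nat n.+1 * factZ n.+1)%Z.

(* Numerator and denominator of [exp_nested m j (3 y^2 / (2 d))]. *)
Fixpoint exp_nestedZ (d : Z) (m j : nat) : seq Z * Z :=
  if m is m'.+1 then
    let: (p, c) := exp_nestedZ d m' j.+1 in
    ((2 * d * Z.of_nat j.+1 * c)%Z :: 0%Z :: scaleZs (- 3) p,
     (2 * d * Z.of_nat j.+1 * c)%Z)
  else ([::], 1%Z).

(* The index n stands for the dimension n + 2, between 4 and 20. *)
Definition small_dims : seq nat := iota 2 17.

(** Comparison with I_1 = 1 on a range starting just below [alpha13]. *)
Lemma section_le1 : all (fun n =>
  section_le n 23980 50000 1 [:: 10 ^ 6 * denZ n]%Z) small_dims.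
Proof. by vm_compute. Qed.

(** Comparison with sqrt 2 - 2 t, multiplied by 10^6 d: 1414213 is a lower approximation of 10^6
    sqrt 2, and 2 d t = y sqrt d is rounded up through r. The range ends just above [alpha23]. *)
Lemma section_le2 : all (fun n => let d := Z.of_nat n.+2 in
  let r := (Z.sqrt (d * 10 ^ 12) + 1)%Z in
  section_le n 50000 64179 d
    (scaleZs (denZ n) [:: 1414213 * d; - r]%Z)) small_dims.
Proof. by vm_compute. Qed.

(** Comparison with [section3_inner], multiplied by 4 * 10^6 d, where t^2 = y^2 / (4 d) and 1732050
    is a lower approximation of 10^6 sqrt 3. *)
Lemma section_le3in : all (fun n => let d := Z.of_nat n.+2 in
  section_le n 19400 23990 (4 * d)
    (scaleZs (denZ n) [:: 3 * 1732050 * d; 0; - (3 * 1732050)]%Z)) small_dims.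
Proof. by vm_compute. Qed.

(** Comparison with [section3_outer], multiplied by 8 * 10^6 d; the linear term is rounded through r
    as in [section_le2]. *)
Lemma section_le3out : all (fun n => let d := Z.of_nat n.+2 in
  let r := (Z.sqrt (d * 10 ^ 12) + 1)%Z in
  section_le n 64178 64608 (8 * d)
    (scaleZs (denZ n) [:: 9 * d * 1732050; - (18 * r); 3 * 1732050]%Z)) small_dims.
Proof. by vm_compute. Qed.

(** Comparison with phi: 1381976 is a lower approximation of 10^6 sqrt (6 / pi), and the Taylor sum
    of e^(-6 t^2) has eight terms, an even number, so it is a lower bound. *)
Lemma section_le_gauss : all (fun n =>
  let E := exp_nestedZ (Z.of_nat n.+2) 8 0 in
  section_le n 0 19400 E.2 (scaleZs (1381976 * denZ n) E.1)) small_dims.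
Proof. by vm_compute. Qed.
Lemma sqrt_ge (R : realType) (a x : R) : 0 <= x -> a ^+ 2 <= x -> a <= Num.sqrt x.
Proof.
move=> x0 ax; have [a0|/ltW a0] := leP 0 a; last exact: le_trans (sqrtr_ge0 _).
by rewrite -(sqr_sqrtr x0) ler_pXn2r ?nnegrE ?sqrtr_ge0 in ax.
Qed.

(** Reads an integer by groups of three digits, as [dec] does, to avoid a large unary numeral in
    R. *)
Lemma zr_digits (R : realType) (a b : nat) :
  zr R (Z.of_nat a * 1000 + Z.of_nat b) = a%:R * 10 ^+ 3 + b%:R.
Proof. by rewrite zrD zrM !zr_nat (zrX R 10 3) (zr_nat R 10). Qed.

Lemma zr_digits3 (R : realType) (a b c : nat) :
  zr R ((Z.of_nat a * 1000 + Z.of_nat b) * 1000 + Z.of_nat c) =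
  a%:R * 10 ^+ 6 + b%:R * 10 ^+ 3 + c%:R.
Proof.
by rewrite zrD zrM zr_digits zr_nat (zrX R 10 3) (zr_nat R 10); ring.
Qed.

Section SmallDimensions.
Variables (R : realType) (n : nat) (t : R).
Hypothesis nsmall : n \in small_dims.
Let d : R := n.+2%:R.
Let r := zr R (Z.sqrt (Z.of_nat n.+2 * 10 ^ 12) + 1).
Let K : R := 2 ^+ n.+1 * n.+1`!%:R.

Let d0 : 0 < d. Proof. by rewrite ltr0n. Qed.
Let K0 : 0 < K. Proof. by rewrite mulr_gt0// ltr0n fact_gt0. Qed.
Let KE : zr R (denZ n) = K.
Proof. by rewrite zrM zrX (zr_nat R 2) zr_factZ. Qed.

Let sd : 10 ^+ 6 * Num.sqrt d <= r.
Proof. by have /andP[] := sqrt_boundZ R n.+2. Qed.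

Let sd2 : Num.sqrt d ^+ 2 = d. Proof. by rewrite sqr_sqrtr// ltW. Qed.

(** A term linear in t keeps a factor sqrt d once written in y. It is replaced by the upper
    approximation r / 10^6, on the safe side because these terms have negative coefficients. *)
Let ry : 0 <= t -> 2 * 10 ^+ 6 * d * t <= r * (2 * Num.sqrt d * t).
Proof.
move=> t0; rewrite (_ : 2 * _ * d * t = (10 ^+ 6 * Num.sqrt d) * (2 * Num.sqrt d * t)).
  by rewrite ler_wpM2r// !mulr_ge0// sqrtr_ge0.
by rewrite -{1}sd2; ring.
Qed.

Lemma diag_density_le1 : dec 239 800 000 <= t <= dec 500 000 000 ->
  diag_density n t <= 1.
Proof.
rewrite /dec => tr.
have := section_leP (t := t) (allP section_le1 n nsmall).
rewrite (zr_digits R 23 980 : zr R 23980 = _) (zr_digits R 50 0 : zr R 50000 = _).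
move=> H; have {H} := H ltac:(lra).
rewrite polyZ_eval_cons mulr0 addr0 zr1 mul1r zrM (zrX R 10 6) (zr_nat R 10) KE -/K.
by rewrite ger_pMr// mulr_gt0// exprn_gt0.
Qed.

Lemma diag_density_le2 : dec 500 000 000 <= t <= dec 641 790 000 ->
  diag_density n t <= Num.sqrt 2 - 2 * t.
Proof.
rewrite /dec => tr.
have t0 : 0 <= t by lra.
have := section_leP (t := t) (allP section_le2 n nsmall).
rewrite (zr_digits R 64 179 : zr R 64179 = _) (zr_digits R 50 0 : zr R 50000 = _).
move=> H; have {H} := H ltac:(lra).
rewrite polyZ_evalZ !polyZ_eval_cons mulr0 addr0 KE zrM zrN zr_nat -/d -/r -/K.
rewrite (zr_digits3 R 1 414 213 : zr R 1414213 = _) => H.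
have W : 1 + dec 414 213 000 <= Num.sqrt 2 :> R by apply: sqrt_ge => //; rewrite /dec; lra.
have W2 : 10 ^+ 6 * d * (1 + dec 414 213 000) <= 10 ^+ 6 * d * Num.sqrt 2 :> R.
  by rewrite ler_wpM2l// mulr_ge0// ltW.
have ryt := ry t0.
rewrite -(ler_pM2l K0) -(ler_pM2l d0) -(@ler_pM2l _ (10 ^+ 6)) ?exprn_gt0//.
rewrite (_ : 10 ^+ 6 * (d * (K * diag_density n t)) = d * 10 ^+ 6 * K * diag_density n t); last by ring.
apply: le_trans H _.
rewrite (_ : 10 ^+ 6 * (d * (K * _)) = K * (10 ^+ 6 * d * Num.sqrt 2 - 2 * 10 ^+ 6 * d * t)); last by ring.
rewrite ler_pM2l//; move: W2; rewrite /dec; lra.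
Qed.

Lemma diag_density_le3in : dec 194 000 000 <= t <= dec 239 900 000 ->
  diag_density n t <= 3 * Num.sqrt 3 / 4 - 3 * Num.sqrt 3 * t ^+ 2.
Proof.
rewrite /dec => tr.
have := section_leP (t := t) (allP section_le3in n nsmall).
rewrite (zr_digits R 19 400 : zr R 19400 = _) (zr_digits R 23 990 : zr R 23990 = _).
move=> H; have {H} := H ltac:(lra).
rewrite polyZ_evalZ !polyZ_eval_cons mulr0 addr0 KE !zrN !zrM zr_nat zr0 -/d -/K.
rewrite (zr_digits3 R 1 732 50 : zr R 1732050 = _) (zr_nat R 3) (zr_nat R 4) => H.
have W : 1 + dec 732 050 000 <= Num.sqrt 3 :> R by apply: sqrt_ge => //; rewrite /dec; lra.
have t2 : 0 <= 3 * d * (1 - 4 * t ^+ 2).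
  by rewrite mulr_ge0 ?mulr_ge0 ?(ltW d0)//; nra.
have := ler_wpM2l t2 W => {}W.
rewrite -(ler_pM2l K0) -(ler_pM2l d0) -(@ler_pM2l _ (4 * 10 ^+ 6)) ?mulr_gt0 ?exprn_gt0//.
rewrite (_ : 4 * 10 ^+ 6 * (d * (K * diag_density n t)) =
  4 * d * 10 ^+ 6 * K * diag_density n t); last by ring.
apply: le_trans H _.
rewrite (_ : 4 * 10 ^+ 6 * (d * (K * _)) =
  K * (10 ^+ 6 * (3 * d * (1 - 4 * t ^+ 2) * Num.sqrt 3))); last by field.
rewrite ler_pM2l//; apply: le_trans (ler_wpM2l _ W); last by rewrite exprn_ge0.
by rewrite le_eqVlt; apply/orP; left; apply/eqP; rewrite /dec; field: sd2.
Qed.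

Lemma diag_density_le3out : dec 641 780 000 <= t <= dec 646 080 000 ->
  diag_density n t <= 9 * Num.sqrt 3 / 8 - 9 / 2 * t + 3 * Num.sqrt 3 / 2 * t ^+ 2.
Proof.
rewrite /dec => tr.
have t0 : 0 <= t by lra.
have := section_leP (t := t) (allP section_le3out n nsmall).
rewrite (zr_digits R 64 178 : zr R 64178 = _) (zr_digits R 64 608 : zr R 64608 = _).
move=> H; have {H} := H ltac:(lra).
rewrite polyZ_evalZ !polyZ_eval_cons mulr0 addr0 KE !zrN !zrM zr_nat -/d -/K -/r.
rewrite (zr_digits3 R 1 732 50 : zr R 1732050 = _) (zr_nat R 3) (zr_nat R 8).
rewrite (zr_nat R 9) (zr_nat R 18) => H.
have W : 1 + dec 732 050 000 <= Num.sqrt 3 :> R by apply: sqrt_ge => //; rewrite /dec; lra.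
have t2 : 0 <= 3 * d * (3 + 4 * t ^+ 2).
  by rewrite mulr_ge0 ?mulr_ge0 ?(ltW d0)// addr_ge0// mulr_ge0// sqr_ge0.
have := ler_wpM2l t2 W => {}W.
have ryt := ry t0.
rewrite -(ler_pM2l K0) -(ler_pM2l d0) -(@ler_pM2l _ (8 * 10 ^+ 6)) ?mulr_gt0 ?exprn_gt0//.
rewrite (_ : 8 * 10 ^+ 6 * (d * (K * diag_density n t)) =
  8 * d * 10 ^+ 6 * K * diag_density n t); last by ring.
apply: le_trans H _.
rewrite (_ : 8 * 10 ^+ 6 * (d * (K * _)) =
  K * (10 ^+ 6 * (3 * d * (3 + 4 * t ^+ 2) * Num.sqrt 3) - 18 * (2 * 10 ^+ 6 * d * t))); last by field.
rewrite ler_pM2l//.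
apply: (@le_trans _ _ (10 ^+ 6 * (3 * d * (3 + 4 * t ^+ 2) * (1 + dec 732 050 000)) -
  18 * (r * (2 * Num.sqrt d * t)))).
  by rewrite le_eqVlt; apply/orP; left; apply/eqP; rewrite /dec; field: sd2.
by apply: lerB; [rewrite ler_wpM2l ?exprn_ge0|rewrite ler_wpM2l].
Qed.

Lemma exp_nestedZE m j : 0 < zr R (exp_nestedZ (Z.of_nat n.+2) m j).2 /\
  polyZ_eval (exp_nestedZ (Z.of_nat n.+2) m j).1 (2 * Num.sqrt d * t) =
  zr R (exp_nestedZ (Z.of_nat n.+2) m j).2 * exp_nested m j (6 * t ^+ 2).
Proof.
elim: m j => [|m ih] j; first by rewrite /= zr1 mulr0.
have S D : exp_nestedZ D m.+1 j = let: (p, c) := exp_nestedZ D m j.+1 in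
  ((2 * D * Z.of_nat j.+1 * c)%Z :: 0%Z :: scaleZs (- 3) p,
   (2 * D * Z.of_nat j.+1 * c)%Z) by [].
rewrite S; have := ih j.+1; case: (exp_nestedZ _ m j.+1) => p c; rewrite /fst /snd => -[c0 pE].
have -> : zr R (2 * Z.of_nat n.+2 * Z.of_nat j.+1 * c) = 2 * d * j.+1%:R * zr R c.
  by rewrite !zrM !zr_nat (zr_nat R 2).
split; first by rewrite !mulr_gt0.
rewrite !polyZ_eval_cons polyZ_evalZ pE zr0 (zrN R 3 : zr R (-3) = _) (zr_nat R 3) [exp_nested m.+1 _ _]/=.
field: sd2.
by rewrite nat1r pnatr_eq0.
Qed.

Lemma diag_density_le_gauss : 1 + dec 381 976 000 <= Num.sqrt (6 / pi) :> R ->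
  0 <= t <= dec 194 000 000 -> diag_density n t <= gauss_limit t.
Proof.
rewrite {2}/dec => W tr.
have [] := exp_nestedZE 8 0; set c := zr R _ => c0 pE.
have := section_leP (t := t) (allP section_le_gauss n nsmall); rewrite -/c.
rewrite (zr_digits R 19 400 : zr R 19400 = _) zr0 => H; have {H} := H ltac:(lra).
rewrite polyZ_evalZ pE zrM KE -/K (zr_digits3 R 1 381 976 : zr R 1381976 = _) => H.
have y0 : 0 <= 6 * t ^+ 2 by rewrite mulr_ge0 ?sqr_ge0.
have E : exp_nested 8 0 (6 * t ^+ 2) <= expR (- (6 * t ^+ 2)).
  by have := expRN_nested 8 y0; rewrite -signr_odd expr0 mul1r subr_ge0.
have S0 : 0 < 1 * 10 ^+ 6 + 381 * 10 ^+ 3 + 976 :> R by lra.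
rewrite -(ler_pM2l K0) -(ler_pM2l c0) -(@ler_pM2l _ (10 ^+ 6)) ?exprn_gt0//.
rewrite (_ : 10 ^+ 6 * (c * (K * diag_density n t)) =
  c * 10 ^+ 6 * K * diag_density n t); last by ring.
apply: le_trans H _.
apply: (@le_trans _ _ ((1 * 10 ^+ 6 + 381 * 10 ^+ 3 + 976) * K * (c * expR (- (6 * t ^+ 2))))).
  by rewrite ler_wpM2l ?(ltW (mulr_gt0 _ _))// ler_wpM2l// ltW.
rewrite /gauss_limit.
rewrite [leRHS](_ : _ = 10 ^+ 6 * Num.sqrt (6 / pi) * K * (c * expR (- (6 * t ^+ 2)))); last by ring.
rewrite ler_wpM2r ?(ltW (mulr_gt0 _ (expR_gt0 _)))// ler_wpM2r ?(ltW K0)//.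
by move: W; rewrite /dec; lra.
Qed.
End SmallDimensions.

(** * Gaussian approximation of the sections *)

Lemma even_powers (R : realType) (u : R) : (u ^+ 4 = (u ^+ 2) ^+ 2) *
  ((u ^+ 6 = (u ^+ 2) ^+ 3) * (u ^+ 8 = (u ^+ 2) ^+ 4)).
Proof. by rewrite -!exprM. Qed.

Lemma ler_sqr2 (R : realType) (x y : R) : 0 <= x -> x <= y -> x ^+ 2 <= y ^+ 2.
Proof. by move=> x0 xy; apply: lerXn2r; rewrite // nnegrE; exact: le_trans xy. Qed.

(** - log sinc u = u^2 / 6 + u^4 / 180 + u^6 / 2835 + ...; replacing 2835 by 2450 leaves enough room
    for the lower bound to hold up to u^2 = 4. Taylor sums of sin and exp reduce both bounds to
    polynomials in w = u^2. *)
Lemma sinc_gauss (R : realType) (u : R) : u ^+ 2 <= 4 ->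
  expR (- (u ^+ 2 / 6)) * (1 - (u ^+ 4 / 180 + u ^+ 6 / 2450)) <= sinc u <=
  expR (- (u ^+ 2 / 6)) * (1 - u ^+ 4 / 180).
Proof.
rewrite !(even_powers u).
wlog u0 : u / 0 <= u.
  move=> H; have [/H//|/ltW] := leP 0 u.
  by rewrite -oppr_ge0 => /H; rewrite sincN sqrrN.
have [->|un0] := eqVneq u 0.
  by rewrite !expr0n /= !mul0r addr0 !subr0 oppr0 expR0 mulr1 /sinc eqxx lexx.
have up : 0 < u by rewrite lt_neqAle eq_sym un0.
have [_ s5] := sin_cos_nested 4 u0; have [_ s6] := sin_cos_nested 5 u0.
have w0 : 0 <= u ^+ 2 := sqr_ge0 u; move: (u ^+ 2) w0 s5 s6 => w w0 s5 s6 w4.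
have w60 : 0 <= w / 6 by lra.
have e4 := expRN_nested 4 w60; have e7 := expRN_nested 7 w60.
move: s5 s6 e4 e7; rewrite -(signr_odd _ 5) -(signr_odd _ 6) -(signr_odd _ 4) -(signr_odd _ 7).
rewrite !expr1 !expr0 !mulN1r !mul1r !oppr_ge0.
rewrite !subr_ge0 !subr_le0 -mul_sinc !ler_pM2l// => s5 s6 e4 e7; rewrite /= in s5 s6 e4 e7.
have q1 : 0 <= 1 - w ^+ 2 / 180 by nra.
have q2 : 0 <= 1 - (w ^+ 2 / 180 + w ^+ 3 / 2450) by nra.
apply/andP; split.
  apply: le_trans (ler_wpM2r q2 e7) _; apply: le_trans _ s6.
  have v0 : 0 <= 4 - w by lra.
  (* Up to constants, w^3 times the Bernstein basis of degree 6 on [0, 4]; the difference of the two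
     sides is a nonnegative combination of these, found by [lra]. *)
  have h (i j k : nat) : 0 <= w ^+ k * (w ^+ i * (4 - w) ^+ j) by rewrite !mulr_ge0 ?exprn_ge0.
  have h0 := h 0%N 6%N 3%N; have h1 := h 1%N 5%N 3%N; have h2 := h 2%N 4%N 3%N.
  have h3 := h 3%N 3%N 3%N; have h4 := h 4%N 2%N 3%N; have h5 := h 5%N 1%N 3%N.
  have h6 := h 6%N 0%N 3%N; clear - h0 h1 h2 h3 h4 h5 h6; lra.
apply: le_trans _ (ler_wpM2r q1 e4); apply: (le_trans s5).
have h1 : 0 <= w ^+ 3 * (4 - w) by rewrite mulr_ge0 ?exprn_ge0//; lra.
have h2 : 0 <= w ^+ 4 by rewrite exprn_ge0.
have h3 : 0 <= w ^+ 5 by rewrite exprn_ge0.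
have h4 : 0 <= w ^+ 3 by rewrite exprn_ge0.
clear - h1 h2 h3 h4; lra.
Qed.

Lemma bernoulli2 (R : realType) (x : R) n : 0 <= x <= 1 ->
  1 - n%:R * x <= (1 - x) ^+ n <= 1 - n%:R * x + (n%:R * x) ^+ 2 / 2.
Proof.
move=> /andP[x0 x1]; elim: n => [|n /andP[l h]].
  by rewrite expr0 !mul0r subr0 expr0n /= !mul0r addr0 lexx.
have y0 : 0 <= 1 - x by lra.
have n0 : 0 <= n%:R :> R by [].
have nx : 0 <= n%:R * x by rewrite mulr_ge0.
have nxx : 0 <= n%:R * x * x by rewrite mulr_ge0.
have nnx : 0 <= (n%:R * x) ^+ 2 * x by rewrite mulr_ge0 ?sqr_ge0.
have xx : 0 <= x ^+ 2 by rewrite sqr_ge0.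
rewrite [(1 - x) ^+ n.+1]exprS -natr1.
have := ler_wpM2l y0 l; have := ler_wpM2l y0 h; move: ((1 - x) ^+ n) => p h1 h2; apply/andP; split; lra.
Qed.

(** For u^2 <= 4, write sinc u = e^(-u^2 / 6) (1 - x) with x between u^4 / 180 and u^4 / 180 + u^6 /
    2450, and raise to the power d by [bernoulli2]; the 4 in 4 / 2450 bounds u^2. For |u| >= 2,
    |sinc u| <= 1/2, and two factors sinc are kept for integrability. *)
Lemma sinc_pow_approx (R : realType) n (u : R) : (10 <= n)%N ->
  `|sinc u ^+ n.+2 - (1 - n.+2%:R * u ^+ 4 / 180) * expR (- (n.+2%:R / 6 * u ^+ 2))| <=
  (n.+2%:R / 2450 * u ^+ 6 + (n.+2%:R * (1 / 180 + 4 / 2450)) ^+ 2 / 2 * u ^+ 8) *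
    expR (- (n.+2%:R / 6 * u ^+ 2)) + 2^-1 ^+ n * sinc u ^+ 2.
Proof.
move=> n10; set d : R := n.+2%:R; have d12 : 12 <= d by rewrite ler_nat.
have e0 := expR_gt0 (- (d / 6 * u ^+ 2)).
have t0 : 0 <= 2^-1 ^+ n * sinc u ^+ 2 by rewrite mulr_ge0 ?sqr_ge0 ?exprn_ge0.
have w0 : 0 <= u ^+ 2 := sqr_ge0 u.
have [w4|w4] := leP (u ^+ 2) 4.
  have /andP[l h] := sinc_gauss w4.
  set E := expR (- (u ^+ 2 / 6)) in l h; have E0 : 0 < E by exact: expR_gt0.
  have Ed : expR (- (d / 6 * u ^+ 2)) = E ^+ n.+2.
    by rewrite /E -expRM_natl -/d; congr expR; field.
  pose x := 1 - sinc u / E.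
  have sE : sinc u = E * (1 - x) by rewrite /x; field; rewrite gt_eqF.
  rewrite sE !ler_pM2l// in l h; rewrite Ed in e0 *; rewrite sE in t0 *.
  move: l h; rewrite !(even_powers u).
  move: (u ^+ 2) w0 w4 => w w0 w4 l h.
  have x01 : 0 <= x <= 1 by apply/andP; split; nra.
  have /andP[B1 B2] := bernoulli2 n.+2 x01; rewrite -/d in B1 B2.
  have xk : x <= (1 / 180 + 4 / 2450) * w ^+ 2 by nra.
  have dx : (d * x) ^+ 2 <= (d * ((1 / 180 + 4 / 2450) * w ^+ 2)) ^+ 2.
    apply: ler_sqr2; first by case/andP: x01 => x0 _; exact: mulr_ge0.
    by apply: ler_wpM2l.
  have dh : d * (w ^+ 2 / 180) <= d * x by rewrite ler_wpM2l//; lra.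
  have dl : d * x <= d * (w ^+ 2 / 180 + w ^+ 3 / 2450) by rewrite ler_wpM2l//; lra.
  rewrite exprMn [E ^+ _ * _]mulrC -mulrBl normrM [`|E ^+ _|]gtr0_norm//.
  apply: ler_wpDr => //; rewrite ler_wpM2r ?(ltW e0)//.
  have w30 : 0 <= d * w ^+ 3 by rewrite mulr_ge0 ?exprn_ge0.
  have w40 : 0 <= (d * ((1 / 180 + 4 / 2450) * w ^+ 2)) ^+ 2 by exact: sqr_ge0.
  by rewrite ler_norml; apply/andP; clear - B1 B2 dx dh dl w30 w40; split; lra.
have s2 : `|sinc u| <= 2^-1.
  have u1 : `|u * sinc u| <= 1 by rewrite mul_sinc; exact: normr_sin_le1.
  have u2 : 2 <= `|u|.
    rewrite -(@ler_pXn2r _ 2) ?nnegrE// real_normK ?num_real//; lra.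
  have := ler_wpM2r (normr_ge0 (sinc u)) u2; rewrite -normrM; lra.
apply: le_trans (ler_normB _ _) _; rewrite addrC; apply: lerD.
  rewrite normrM [`|expR _|]gtr0_norm// ler_wpM2r ?(ltW e0)//.
  rewrite !(even_powers u).
  move: (u ^+ 2) w0 w4 => w w0 w4.
  have w30 : 0 <= d * w ^+ 3 by rewrite mulr_ge0 ?exprn_ge0.
  have w16 : 16 <= w ^+ 2 by nra.
  (* From d >= 12 and w >= 4: 12 * 16 / 180 > 1. The quadratic error term then outweighs the
     approximant itself. *)
  have y1 : 1 <= d * (w ^+ 2 / 180) by nra.
  have yy : (d * (w ^+ 2 / 180)) ^+ 2 <= (d * ((1 / 180 + 4 / 2450) * w ^+ 2)) ^+ 2.
    apply: ler_sqr2; first by lra.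
    apply: ler_wpM2l; first by lra.
    by clear - w16; lra.
  have ys := sqr_ge0 (d * (w ^+ 2 / 180) - 1).
  by rewrite ler_norml; apply/andP; clear - w30 y1 yy ys; split; lra.
rewrite normrX -(addn2 n) exprD real_normK ?num_real//.
by rewrite ler_wpM2r ?sqr_ge0// lerXn2r ?nnegrE.
Qed.

Lemma dominated_norm (R : realType) (f : R -> R) : lorentz_dominated f ->
  lorentz_dominated (fun u => `|f u|).
Proof.
move=> [cf [M fM]]; split; last by exists M => u; rewrite normr_id.
by move=> x; apply: (@continuous_comp _ _ _ f); [exact: cf|exact: norm_continuous].
Qed.

Lemma fourier_irwin_hall_approx (R : realType) n (x : R) : (10 <= n)%N ->
  let d : R := n.+2%:R in let a := d / 6 in
  `|fourier_irwin_hall n.+1 x -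
    (gauss_cos a 0 (2 * x) - d / 180 * gauss_cos a 4 (2 * x))| <=
  d / 2450 * gauss_cos a 6 0 +
  (d * (1 / 180 + 4 / 2450)) ^+ 2 / 2 * gauss_cos a 8 0 + 2^-1 ^+ n * pi.
Proof.
cbv zeta; move=> n10; set d : R := n.+2%:R; set a := d / 6; set b := 2 * x.
have a0 : 0 < a by rewrite divr_gt0.
have ds := dominated_sinc_cos n b.
have d0 := dominated_gauss_cos b 0 a0; have d4 := dominatedZ (d / 180) (dominated_gauss_cos b 4 a0).
have d6 := dominatedZ (d / 2450) (dominated_gauss_cos 0 6 a0).
have d8 := dominatedZ ((d * (1 / 180 + 4 / 2450)) ^+ 2 / 2) (dominated_gauss_cos 0 8 a0).
have d2 := dominatedZ (2^-1 ^+ n) (dominated_sinc R 0).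
have dg := dominatedB d0 d4; have df := dominatedB ds dg.
have d68 := dominatedD d6 d8; have dB := dominatedD d68 d2.
rewrite -integral_sinc2 /gauss_cos /fourier_irwin_hall.
do 4 (rewrite -RintegralZl//; last exact: dominated_integrable (dominated_gauss_cos _ _ a0) ||
        exact: dominated_integrable (dominated_sinc R 0)).
rewrite -RintegralB//; [|exact: dominated_integrable d0|exact: dominated_integrable d4].
rewrite -RintegralB//; [|exact: dominated_integrable ds|exact: dominated_integrable dg].
rewrite -RintegralD//; [|exact: dominated_integrable d6|exact: dominated_integrable d8].
rewrite -RintegralD//; [|exact: dominated_integrable d68|exact: dominated_integrable d2].
apply: le_trans (le_normr_Rintegral _ (dominated_integrable df)) _ => //.
apply: le_Rintegral => //.
- exact: dominated_integrable (dominated_norm df).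
- exact: dominated_integrable dB.
move=> u _; rewrite mul0r cos0 !mulr1 /gauss_kernel expr0 mul1r.
rewrite (_ : _ - _ = (sinc u ^+ n.+2 - (1 - d * u ^+ 4 / 180) * expR (- (a * u ^+ 2))) * cos (b * u)).
  rewrite normrM; apply: (@le_trans _ _ (`|sinc u ^+ n.+2 - (1 - d * u ^+ 4 / 180) * expR (- (a * u ^+ 2))|)).
    by rewrite ler_piMr// normr_cos_le1.
  apply: le_trans (sinc_pow_approx u n10) _.
  by rewrite le_eqVlt; apply/orP; left; apply/eqP; rewrite -/d -/a; ring.
by rewrite /a; field.
Qed.

(** With a = d / 6, the fourth moment against the cosine gives the polynomial in t; 405 = 15 * 6^3 /
    8 and 8505 = 105 * 6^4 / 16 come from the sixth and eighth moments. *)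
Lemma diag_density_approx (R : realType) n (t : R) : (10 <= n)%N ->
  let d : R := n.+2%:R in
  `|diag_density n t -
    gauss_limit t * (1 - (3 - 72 * t ^+ 2 + 144 * t ^+ 4) / (20 * d))| <=
  gauss_limit 0 * (405 / 2450 + 8505 * (1 / 180 + 4 / 2450) ^+ 2 / 2) / d ^+ 2 +
  Num.sqrt d * 2^-1 ^+ n.
Proof.
cbv zeta; move=> n10; have [d dE] : exists d : R, d = n.+2%:R by exists n.+2%:R.
have d0 : 0 < d by rewrite dE.
have d1 : d != 0 by rewrite gt_eqF.
have p0 : 0 < pi :> R := pi_gt0 R.
have p1 : pi != 0 :> R by rewrite gt_eqF.
have a0 : 0 < d / 6 by rewrite divr_gt0.
have s0 : 0 <= Num.sqrt d := sqrtr_ge0 d.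
have s2 : Num.sqrt d ^+ 2 = d by rewrite sqr_sqrtr// ltW.
have H := fourier_irwin_hall_approx (Num.sqrt d * t) n10; cbv zeta in H; rewrite -dE in H.
rewrite /diag_density irwin_hall_fourier -dE.
move: H; rewrite gauss_cos4E// gauss_cos0E//.
have [-> ->] := gauss_cos68_at0 a0.
have S : Num.sqrt (pi / (d / 6)) = Num.sqrt (6 / pi) * pi / Num.sqrt d.
  have r0 : 0 <= Num.sqrt (6 / pi) * pi / Num.sqrt d.
    by rewrite mulr_ge0 ?invr_ge0// mulr_ge0 ?sqrtr_ge0// ltW.
  rewrite -[RHS](ger0_norm r0) -sqrtr_sqr; congr Num.sqrt.
  rewrite exprMn exprVn s2 exprMn sqr_sqrtr ?divr_ge0 ?(ltW p0)//.
  have F (p q : R) : p != 0 -> q != 0 -> p / (q / 6) = 6 / p * p ^+ 2 / q.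
    by move=> *; field; apply/andP.
  exact: F.
have -> : (2 * (Num.sqrt d * t)) ^+ 2 / (4 * (d / 6)) = 6 * t ^+ 2.
  by field: s2.
rewrite S /gauss_limit expr0n /= mulr0 oppr0 expR0 mulr1.
have s1 : Num.sqrt d != 0 by rewrite gt_eqF// sqrtr_gt0.
move: (Num.sqrt (6 / pi)) (expR _) (fourier_irwin_hall _ _) (2^-1 ^+ n).
clear S; move: p0 p1; move: (@pi R) => P p0 P0 c e f T H.
have sp : 0 <= Num.sqrt d / P by rewrite divr_ge0// ltW.
have := ler_wpM2l sp H; rewrite -[X in X * `|_|](ger0_norm sp) -normrM.
move=> {}H; apply: le_trans (_ : _ <= `|_|) _; last apply: (le_trans H).
  rewrite le_eqVlt; apply/orP; left; apply/eqP; congr `|_|.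
  by field: s2; rewrite ?P0 ?d1 ?s1.
rewrite le_eqVlt; apply/orP; left; apply/eqP.
by field: s2; rewrite ?P0 ?d1 ?s1.
Qed.

(** * Numerical bounds and the constants of the theorem *)

(** Ten Taylor terms of the cosine show cos u > 0 and nine show cos v < 0 for two adjacent decimals
    u and v, which therefore enclose pi / 2. *)
Lemma pi_bounds (R : realType) :
  3 + dec 141 592 652 < pi :> R /\ pi < 3 + dec 141 592 654 :> R.
Proof.
pose u : R := 1 + dec 570 796 326; pose v : R := 1 + dec 570 796 327.
have u0 : 0 <= u by rewrite /u /dec; lra.
have v0 : 0 <= v by rewrite /v /dec; lra.
have [cu _] := sin_cos_nested 9 u0; have [cv _] := sin_cos_nested 8 v0.
have Tu : 0 < trig_nested 10 0 (u ^+ 2) by rewrite /= /u /dec; lra.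
have Tv : trig_nested 9 0 (v ^+ 2) < 0 by rewrite /= /v /dec; lra.
move: cu cv; rewrite -(signr_odd _ 10) -(signr_odd _ 9) expr0 expr1 mul1r mulN1r.
rewrite oppr_ge0 subr_ge0 subr_le0 => cu cv.
have {cu}cu : 0 < cos u by exact: lt_le_trans cu.
have {cv}cv : cos v < 0 by exact: le_lt_trans cv _.
have p2 := pi_ge2 R.
split; rewrite ltNge; apply/negP => h.
  suff : 0 <= cos (pi - u) by rewrite cosB cospi sinpi mul0r addr0 mulN1r oppr_ge0 leNgt cu.
  by apply: cos_ge0_pihalf; rewrite /u; move: h; rewrite /dec; lra.
suff : 0 <= cos v by rewrite leNgt cv.
by apply: cos_ge0_pihalf; rewrite /v; move: h; rewrite /dec; lra.
Qed.

Lemma sqrt_le (R : realType) (b x : R) : 0 <= b -> x <= b ^+ 2 -> Num.sqrt x <= b.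
Proof.
by move=> b0 xb; rewrite -[b](ger0_norm b0) -sqrtr_sqr ler_wsqrtr.
Qed.

Lemma gauss_const_bounds (R : realType) :
  1 + dec 381 976 597 <= Num.sqrt (6 / pi) :> R /\
  Num.sqrt (6 / pi) <= 1 + dec 381 976 599 :> R.
Proof.
have [lo hi] := pi_bounds R; have p0 := pi_gt0 R; split.
  apply: sqrt_ge; first by rewrite divr_ge0 ?ltW.
  by rewrite ler_pdivlMr//; move: hi; clear; rewrite /dec; lra.
apply: sqrt_le; first by rewrite /dec; lra.
by rewrite ler_pdivrMr//; move: lo; clear; rewrite /dec; lra.
Qed.

Lemma gauss_limit_bounds (R : realType) n (t : R) : ~~ odd n ->
  (1 + dec 381 976 597) * exp_nested n 0 (6 * t ^+ 2) <= gauss_limit t /\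
  gauss_limit t <= (1 + dec 381 976 599) * exp_nested n.+1 0 (6 * t ^+ 2).
Proof.
move=> no; have [cl ch] := gauss_const_bounds R; rewrite /gauss_limit.
have x0 : 0 <= 6 * t ^+ 2 by rewrite mulr_ge0 ?sqr_ge0.
have c1 : 0 <= 1 + dec 381 976 597 :> R by rewrite /dec; lra.
have c2 : 0 <= 1 + dec 381 976 599 :> R by rewrite /dec; lra.
have := expRN_nested n x0; have := expRN_nested n.+1 x0.
rewrite -(signr_odd _ n) -(signr_odd _ n.+1) /= no (negbTE no) expr0 expr1.
rewrite mulN1r mul1r oppr_ge0 subr_ge0 subr_le0 => hi lo; split.
  by apply: le_trans (ler_wpM2l c1 lo) _; rewrite ler_wpM2r// expR_ge0.
by apply: le_trans _ (ler_wpM2l c2 hi); rewrite ler_wpM2r// expR_ge0.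
Qed.

Lemma gauss_limit_gt0 (R : realType) (t : R) : 0 < gauss_limit t.
Proof. by rewrite mulr_gt0 ?expR_gt0// sqrtr_gt0 divr_gt0// pi_gt0. Qed.

(** From phi(s) = phi(t) e^(6 (t^2 - s^2)) and e^z >= 1 + z, applied in both directions; s and t
    need not be ordered. *)
Lemma gauss_limit_sub (R : realType) (s t : R) :
  6 * gauss_limit t * (t ^+ 2 - s ^+ 2) <= gauss_limit s - gauss_limit t /\
  gauss_limit s - gauss_limit t <= 6 * gauss_limit s * (t ^+ 2 - s ^+ 2).
Proof.
have E (u v : R) : gauss_limit v = gauss_limit u * expR (6 * (u ^+ 2 - v ^+ 2)).
  by rewrite /gauss_limit -mulrA -expRD; congr (_ * expR _); ring.
have := gauss_limit_gt0 s; have := gauss_limit_gt0 t => t0 s0; split.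
  have := ler_wpM2l (ltW t0) (expR_ge1Dx (6 * (t ^+ 2 - s ^+ 2))).
  by rewrite -E; lra.
have := ler_wpM2l (ltW s0) (expR_ge1Dx (6 * (s ^+ 2 - t ^+ 2))).
by rewrite -E; lra.
Qed.

Lemma continuous_gauss_limit (R : realType) : continuous (@gauss_limit R).
Proof.
move=> x; rewrite /gauss_limit; apply: cvgM; first exact: cvg_cst.
exact: is_derive_continuous (is_derive_gauss 6) _.
Qed.

Lemma decreasing_root (R : realType) (f : R -> R) (a b : R) : a < b ->
  continuous f -> 0 < f a -> f b < 0 ->
  (forall x y, a < x -> x < y -> y < b -> f y < f x) ->
  exists! x, f x = 0 /\ a < x < b.
Proof.
move=> ab cf fa fb mf.
have [||c cab fc] := @IVT _ f a b 0 (ltW ab).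
- exact: continuous_subspaceT.
- by rewrite ge_min le_max (ltW fa) (ltW fb) orbT.
move: cab; rewrite in_itv /= => /andP[ac cb].
have ac' : a < c by rewrite lt_neqAle ac andbT; apply: contraTneq fa => ->; rewrite fc ltxx.
have cb' : c < b by rewrite lt_neqAle cb andbT; apply: contraTneq fb => <-; rewrite fc ltxx.
exists c; split; first by rewrite ac' cb'.
move=> x [fx /andP[ax xb]]; have [cx|xc|//] := ltgtP c x.
  by have := mf _ _ ac' cx xb; rewrite fx fc ltxx.
by have := mf _ _ ax xc cb'; rewrite fx fc ltxx.
Qed.

Lemma alpha2inf_exists (R : realType) : exists! a : R, is_alpha2inf a.
Proof.
pose f (t : R) := Num.sqrt 2 - 2 * t - gauss_limit t.
have [|||||c [[fc cab] cu]] := @decreasing_root R f (dec 017 367 900) (dec 017 368 000).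
- by rewrite /dec; lra.
- move=> x; apply: cvgB; last exact: continuous_gauss_limit.
  by apply: cvgB; [exact: cvg_cst|apply: cvgM; [exact: cvg_cst|exact: cvg_id]].
- have [_ g] := @gauss_limit_bounds R 4 (dec 017 367 900) isT.
  have s : 1 + dec 414 213 562 <= Num.sqrt 2 :> R by apply: sqrt_ge => //; rewrite /dec; lra.
  rewrite /f; move: (gauss_limit _) (Num.sqrt 2) g s => p q; rewrite /= /dec; lra.
- have [g _] := @gauss_limit_bounds R 4 (dec 017 368 000) isT.
  have s : Num.sqrt 2 <= 1 + dec 414 213 563 :> R.
    by apply: sqrt_le; rewrite /dec; lra.
  rewrite /f; move: (gauss_limit _) (Num.sqrt 2) g s => p q; rewrite /= /dec; lra.
- rewrite /dec => x y ax xy yb; have [_ g] := gauss_limit_sub x y.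
  have [_ h] := @gauss_limit_bounds R 0 x isT.
  have x0 : 0 <= x by lra.
  have p0 := gauss_limit_gt0 x.
  have p2 : gauss_limit x <= 2 by move: h; rewrite /= /dec; lra.
  rewrite /f; move: (gauss_limit x) (gauss_limit y) g p0 p2 => p q g p0 p2.
  (* phi loses at most 6 * 2 * 0.04 (y - x) = 0.48 (y - x), less than the 2 (y - x) lost by the
     line. *)
  have : p * ((y + x) * (y - x)) <= 2 * (4 / 100 * (y - x)).
    apply: ler_pM => //; [exact: ltW|by apply: mulr_ge0; lra|].
    by rewrite ler_wpM2r; lra.
  lra.
exists c; split; first by split=> //; apply/eqP; rewrite -subr_eq0; exact/eqP.
by move=> x [fx xab]; apply: cu; split=> //; rewrite /f fx subrr.
Qed.

Lemma sqrt2_bounds (R : realType) :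
  1 + dec 414 213 562 <= Num.sqrt 2 :> R /\ Num.sqrt 2 <= 1 + dec 414 213 563 :> R.
Proof. by split; [apply: sqrt_ge|apply: sqrt_le]; rewrite /dec; lra. Qed.

Lemma sqrt3_bounds (R : realType) :
  1 + dec 732 050 807 <= Num.sqrt 3 :> R /\ Num.sqrt 3 <= 1 + dec 732 050 808 :> R.
Proof. by split; [apply: sqrt_ge|apply: sqrt_le]; rewrite /dec; lra. Qed.

Lemma sqrt5_bounds (R : realType) :
  2 + dec 236 067 977 <= Num.sqrt 5 :> R /\ Num.sqrt 5 <= 2 + dec 236 067 978 :> R.
Proof. by split; [apply: sqrt_ge|apply: sqrt_le]; rewrite /dec; lra. Qed.

Lemma sqrt6_bounds (R : realType) :
  2 + dec 449 489 742 <= Num.sqrt 6 :> R /\ Num.sqrt 6 <= 2 + dec 449 489 743 :> R.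
Proof. by split; [apply: sqrt_ge|apply: sqrt_le]; rewrite /dec; lra. Qed.

Definition section3_inner (R : realType) (t : R) : R :=
  3 * Num.sqrt 3 / 4 - 3 * Num.sqrt 3 * t ^+ 2.

(** Both functions decrease, phi faster: with respect to t^2 its slope is at least 6 * 0.88 = 5.28
    in absolute value, against 3 sqrt 3 < 5.197. An inequality between them at s thus propagates to
    the right. *)
Lemma section3_inner_sub_gauss (R : realType) (s t : R) : 0 <= s -> s <= t ->
  t <= dec 240 000 000 ->
  (t - s) * (t + s) / 20 <= (section3_inner t - gauss_limit t) - (section3_inner s - gauss_limit s).
Proof.
move=> s0 st t2; have [g _] := gauss_limit_sub s t.
have [h _] := @gauss_limit_bounds R 2 t isT.
have [_ r3] := sqrt3_bounds R; rewrite /dec in r3 t2.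
have p1 : 88 / 100 <= gauss_limit t.
  have t4 : t ^+ 2 <= 576 / 10 ^+ 4 by nra.
  by apply: le_trans h; rewrite /= /dec; lra.
have d0 : 0 <= t ^+ 2 - s ^+ 2 by nra.
have := ler_wpM2r d0 p1; have := ler_wpM2r d0 r3.
rewrite /section3_inner; lra.
Qed.

Lemma continuous_section3_inner (R : realType) : continuous (@section3_inner R).
Proof.
move=> x; apply: cvgB; first exact: cvg_cst.
by apply: cvgM; [exact: cvg_cst|exact: exprn_continuous].
Qed.

Lemma alpha3inf_exists (R : realType) : exists! a : R, is_alpha3inf a.
Proof.
pose f (t : R) := gauss_limit t - section3_inner t.
have [|||||c [[fc cab] cu]] := @decreasing_root R f (dec 192 472 000) (dec 192 473 000).
- by rewrite /dec; lra.
- by move=> x; apply: cvgB; [exact: continuous_gauss_limit|exact: continuous_section3_inner].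
- have [g _] := @gauss_limit_bounds R 8 (dec 192 472 000) isT.
  have [s1 s2] := sqrt3_bounds R; rewrite /f /section3_inner.
  move: (gauss_limit _) (Num.sqrt 3) g s1 s2 => p q; rewrite /= /dec; lra.
- have [_ g] := @gauss_limit_bounds R 8 (dec 192 473 000) isT.
  have [s1 s2] := sqrt3_bounds R; rewrite /f /section3_inner.
  move: (gauss_limit _) (Num.sqrt 3) g s1 s2 => p q; rewrite /= /dec; lra.
- rewrite /dec => x y ax xy yb.
  have := @section3_inner_sub_gauss R x y; rewrite /dec => H.
  have {}H := H ltac:(lra) (ltW xy) ltac:(lra).
  have : 0 < (y - x) * (y + x) / 20 by rewrite divr_gt0// mulr_gt0//; lra.
  rewrite /f; lra.
exists c; split.
  by split=> //; apply/esym/eqP; rewrite -subr_eq0; exact/eqP.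
by move=> x [fx xab]; apply: cu; split=> //; rewrite /f /section3_inner fx subrr.
Qed.

(* Numerals are unary: [lra] cannot handle 17280 directly. *)
Lemma coef5E (R : realType) : 17280 = 17 * 10 ^+ 3 + 280 :> R.
Proof. by rewrite -natrX -!natrM -natrD. Qed.

(** The difference quotient of the quintic defining delta. On the tiny interval its three terms are
    about 154, -344 and 213, so crude bounds on P and Q are enough. *)
Lemma quintic_slope_gt0 (R : realType) (P Q x y : R) :
  P <= - 288 / 100 -> - 323 / 10 <= Q ->
  222 / 10 ^+ 3 + 924 / 10 ^+ 6 <= x <= 222 / 10 ^+ 3 + 925 / 10 ^+ 6 ->
  222 / 10 ^+ 3 + 924 / 10 ^+ 6 <= y <= 222 / 10 ^+ 3 + 925 / 10 ^+ 6 ->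
  0 < - 120 * P * (y + x) + 240 * Q * ((y + x) * (y ^+ 2 + x ^+ 2)) +
    (17 * 10 ^+ 3 + 280) * (y ^+ 4 + y ^+ 3 * x + y ^+ 2 * x ^+ 2 + y * x ^+ 3 + x ^+ 4).
Proof.
move=> P1 Q1 xr yr.
have c0 : 0 <= 17 * 10 ^+ 3 + 280 :> R by rewrite addr_ge0// mulr_ge0// exprn_ge0.
have x1 : (49 / 1000 + 69 / 10 ^+ 5) <= x ^+ 2 <= (49 / 1000 + 70 / 10 ^+ 5) by apply/andP; split; nra.
have y1 : (49 / 1000 + 69 / 10 ^+ 5) <= y ^+ 2 <= (49 / 1000 + 70 / 10 ^+ 5) by apply/andP; split; nra.
have z1 : (49 / 1000 + 69 / 10 ^+ 5) <= y * x <= (49 / 1000 + 70 / 10 ^+ 5) by apply/andP; split; nra.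
have b1 : 120 * 288 / 100 * (y + x) <= - 120 * P * (y + x).
    have s0 : 0 <= y + x by clear - xr yr; lra.
    by have := ler_wpM2r s0 P1; clear; lra.
have b2 : - 240 * (323 / 10) * (446 / 1000 * ((99 / 1000 + 4 / 10 ^+ 4))) <=
      240 * Q * ((y + x) * (y ^+ 2 + x ^+ 2)).
    have m : (y + x) * (y ^+ 2 + x ^+ 2) <= 446 / 1000 * (99 / 1000 + 4 / 10 ^+ 4).
      by apply: ler_pM; clear - xr yr x1 y1; lra.
    have m0 : 0 <= (y + x) * (y ^+ 2 + x ^+ 2).
      by apply: mulr_ge0; clear - xr yr x1 y1; lra.
    move: (_ * (y ^+ 2 + x ^+ 2)) m m0 => M m m0.
    by have := ler_wpM2r m0 Q1; clear - m; lra.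
have b3 : 5 * ((49 / 1000 + 69 / 10 ^+ 5)) ^+ 2 <=
      y ^+ 4 + y ^+ 3 * x + y ^+ 2 * x ^+ 2 + y * x ^+ 3 + x ^+ 4.
    rewrite (_ : _ + x ^+ 4 = y ^+ 2 * y ^+ 2 + y ^+ 2 * (y * x) + y ^+ 2 * x ^+ 2 +
      (y * x) * x ^+ 2 + x ^+ 2 * x ^+ 2); last by ring.
    move: (x ^+ 2) (y ^+ 2) (y * x) x1 y1 z1 => A B C x1 y1 z1.
    have L (l U V : R) : 0 <= l -> l <= U -> l <= V -> l ^+ 2 <= U * V.
      by move=> l0 u v; rewrite expr2; exact: ler_pM.
    have l0 : 0 <= 49 / 1000 + 69 / 10 ^+ 5 :> R by lra.
    case/andP: x1 y1 z1 => x2 _ /andP[y2 _] /andP[z2 _]; clear - L l0 x2 y2 z2.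
    move: (_ + 69 / _) l0 x2 y2 z2 => l l0 x2 y2 z2.
    rewrite (_ : 5 * l ^+ 2 = l ^+ 2 + l ^+ 2 + l ^+ 2 + l ^+ 2 + l ^+ 2); last by ring.
    by do 4 (apply: lerD; last exact: L); exact: L.
apply: lt_le_trans (lerD (lerD b1 b2) (ler_wpM2l c0 b3)).
clear - xr yr; lra.
Qed.

Lemma delta_exists (R : realType) : exists! a : R, is_delta a.
Proof.
have [s1 s2] := sqrt5_bounds R; have [s3 s4] := sqrt6_bounds R.
(* The quintic increases here; its opposite fits [decreasing_root]. *)
pose f (t : R) := - (575 * Num.sqrt 5 - 528 * Num.sqrt 6
    - 120 * (25 * Num.sqrt 5 - 24 * Num.sqrt 6) * t ^+ 2
    + 240 * (25 * Num.sqrt 5 - 36 * Num.sqrt 6) * t ^+ 4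
    + 17280 * t ^+ 5).
have [|||||c [[fc cab] cu]] := @decreasing_root R f (dec 222 924 000) (dec 222 925 000).
- by clear; rewrite /dec; lra.
- move=> x; apply: cvgN; apply: cvgD; last first.
    by apply: cvgM; [exact: cvg_cst|exact: exprn_continuous].
  apply: cvgD; last by apply: cvgM; [exact: cvg_cst|exact: exprn_continuous].
  apply: cvgB; first exact: cvg_cst.
  by apply: cvgM; [exact: cvg_cst|exact: exprn_continuous].
- rewrite /f coef5E; move: (Num.sqrt 5) (Num.sqrt 6) s1 s2 s3 s4; clear => p q; rewrite /dec; lra.
- rewrite /f coef5E; move: (Num.sqrt 5) (Num.sqrt 6) s1 s2 s3 s4; clear => p q; rewrite /dec; lra.
- rewrite /dec => x y ax xy yb; rewrite /f coef5E -subr_gt0; clear f.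
  move: (Num.sqrt 5) (Num.sqrt 6) s1 s2 s3 s4 => p q; rewrite /dec => s1 s2 s3 s4.
  pose P := 25 * p - 24 * q; pose Q := 25 * p - 36 * q.
  have P1 : P <= - 288 / 100 by rewrite /P; lra.
  have Q1 : - 323 / 10 <= Q by rewrite /Q; lra.
  rewrite -/P -/Q (_ : _ - _ = (y - x) * (- 120 * P * (y + x) +
    240 * Q * ((y + x) * (y ^+ 2 + x ^+ 2)) +
    (17 * 10 ^+ 3 + 280) * (y ^+ 4 + y ^+ 3 * x + y ^+ 2 * x ^+ 2 + y * x ^+ 3 + x ^+ 4))); last by ring.
  by apply: mulr_gt0; [lra|apply: quintic_slope_gt0 => //; lra].
exists c; split.
  by split=> //; apply: oppr_inj; rewrite oppr0.
by move=> x [fx xab]; apply: cu; split=> //; rewrite /f fx oppr0.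
Qed.

Lemma alpha23_bounds (R : realType) : dec 641 788 000 < alpha23 R < dec 641 789 000.
Proof.
have [s1 s2] := sqrt6_bounds R; have [s3 s4] := sqrt3_bounds R.
have s0 : 0 < 6 * Num.sqrt 3 :> R by rewrite mulr_gt0// sqrtr_gt0.
have r1 : 0 <= 6 * Num.sqrt 6 - 14 :> R by move: s1; clear; rewrite /dec; lra.
have a1 : dec 834 828 360 <= Num.sqrt (6 * Num.sqrt 6 - 14) :> R.
  by apply: sqrt_ge => //; move: s1; clear; rewrite /dec; lra.
have a2 : Num.sqrt (6 * Num.sqrt 6 - 14) <= dec 834 828 500 :> R.
  by apply: sqrt_le; move: s2; clear; rewrite /dec; lra.
rewrite /alpha23 ltr_pdivlMr// ltr_pdivrMr//; apply/andP.
move: a1 a2 s3 s4; rewrite /dec; split; lra.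
Qed.

Lemma alpha13_bounds (R : realType) : dec 239 895 000 < alpha13 R < dec 239 896 000.
Proof.
have [s3 s4] := sqrt3_bounds R.
have a1 : 1 + dec 439 373 000 <= Num.sqrt (9 - 4 * Num.sqrt 3) :> R.
  by apply: sqrt_ge; move: s3 s4; clear; rewrite /dec; lra.
have a2 : Num.sqrt (9 - 4 * Num.sqrt 3) <= 1 + dec 439 375 000 :> R.
  by apply: sqrt_le; move: s3 s4; clear; rewrite /dec; lra.
by rewrite /alpha13 /dec; move: a1 a2; clear; rewrite /dec; lra.
Qed.

(** * Comparison of the dimensions *)

Lemma diag_volume1 (R : realType) (t : R) : 0 <= t ->
  diag_volume 1 t = (if t <= 1 / 2 then 1 else 0)%:E :> \bar R.
Proof.
move=> t0; rewrite diag_volumeE// slice_volume0 sqrtr1 !mul1r mul1e indicE; congr EFin.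
rewrite mem_setE in_itv /=.
have -> : (0 <= 2^-1 + t <= 1) = (t <= 2^-1) by apply/andP/idP => [[_]|h]; [|split]; lra.
by case: ifP.
Qed.

Lemma diag_volumeSS (R : realType) n (t : R) : 0 <= t ->
  diag_volume n.+2 t = (diag_density n t)%:E.
Proof. by move=> t0; rewrite diag_volumeE// slice_volumeE. Qed.

Lemma diag_density0 (R : realType) (t : R) : 0 <= t <= dec 707 000 000 ->
  diag_density 0 t = Num.sqrt 2 - 2 * t.
Proof.
move=> /andP[t0 t1]; have [_ r2] := sqrt2_bounds R.
have r0 : 0 <= Num.sqrt 2 :> R := sqrtr_ge0 2.
have r22 : Num.sqrt 2 ^+ 2 = 2 :> R by rewrite sqr_sqrtr.
have x0 : 0 <= Num.sqrt 2 * t by exact: mulr_ge0.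
have x1 : Num.sqrt 2 * t <= 1.
  have := ler_pM r0 t0 r2 t1; rewrite /dec; lra.
rewrite /diag_density irwin_hall1 divff//.
rewrite [Num.max (_ - 1) 0]max_l; last lra.
rewrite [Num.max (_ - 2) 0]max_r; last lra.
rewrite max_l; last lra.
by ring: r22.
Qed.

Lemma irwin_hall2 (R : realType) (s : R) : irwin_hall 2 s =
  (pospow 2 s - 3 * pospow 2 (s - 1) + 3 * pospow 2 (s - 2) - pospow 2 (s - 3)) / 2.
Proof.
rewrite /irwin_hall !big_ord_recl big_ord0 /= /bump /= !bin0 !bin1 binn.
rewrite (_ : 'C(3, 2) = 3)// (_ : 2`! = 2)// subr0; congr (_ / _).
rewrite (_ : (1 + (1 + 0))%N = 2)// (_ : (1 + (1 + (1 + 0)))%N = 3)// addn0; ring.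
Qed.

(** The section is a hexagon up to the level 2 of the coordinate sum, which is 2 sqrt 3 t = 1;
    beyond, it is the triangle of [section3_outer]. *)
Lemma diag_density1_inner (R : realType) (t : R) : 0 <= t -> 2 * Num.sqrt 3 * t <= 1 ->
  diag_density 1 t = section3_inner t.
Proof.
move=> t0 t1; have r0 : 0 <= Num.sqrt 3 :> R := sqrtr_ge0 3.
have r3 : Num.sqrt 3 ^+ 2 = 3 :> R by rewrite sqr_sqrtr.
have x0 : 0 <= Num.sqrt 3 * t by exact: mulr_ge0.
rewrite /diag_density irwin_hall2 [pospow 2 (_ - 3)]pospow_le; last lra.
rewrite [pospow 2 (_ - 2)]pospow_le; last lra.
rewrite !pospow_ge; [|lra|lra].
by rewrite /section3_inner; field: r3.
Qed.

Definition section3_outer (R : realType) (t : R) : R :=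
  9 * Num.sqrt 3 / 8 - 9 / 2 * t + 3 * Num.sqrt 3 / 2 * t ^+ 2.

Lemma diag_density1_outer (R : realType) (t : R) :
  1 <= 2 * Num.sqrt 3 * t <= 3 -> diag_density 1 t = section3_outer t.
Proof.
move=> t1; have r0 : 0 <= Num.sqrt 3 :> R := sqrtr_ge0 3.
have r3 : Num.sqrt 3 ^+ 2 = 3 :> R by rewrite sqr_sqrtr.
rewrite /diag_density irwin_hall2 [pospow 2 (_ - 3)]pospow_le; last lra.
rewrite !pospow_ge; [|lra|lra|lra].
by rewrite /section3_outer; field: r3.
Qed.

(** * Dimensions at least 21 against the Gaussian limit *)

(** It holds from d = n + 2 = 21 on, 40 * 20^3 being larger than 2^18; afterwards doubling beats the
    growth of the cube. *)
Lemma cube_le_exp2 (R : realType) n : (19 <= n)%N -> 40 * n.+2%:R ^+ 3 <= 2 ^+ n :> R.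
Proof.
elim: n => // n ih; rewrite leq_eqVlt => /predU1P[<-|n19]; first by lra.
have {}ih := ih n19; have d21 : 21 <= n.+2%:R :> R by rewrite ler_nat.
rewrite [2 ^+ n.+1]exprS -[n.+3%:R]natr1; move: (2 ^+ n) n.+2%:R ih d21 => p d ih d21.
have : 0 <= d ^+ 2 * (d - 21) by rewrite mulr_ge0 ?sqr_ge0//; lra.
have : 0 <= d * (d - 21) by rewrite mulr_ge0//; lra.
lra.
Qed.

(** The moments contribute less than 0.3851 to the constant. From sqrt d <= d / 4 and 40 d^3 <= 2^n
    the tail is at most 1 / (160 d^2), which fits in the remainder up to 0.391. *)
Lemma diag_density_asympt (R : realType) n (t : R) : (19 <= n)%N ->
  let d : R := n.+2%:R in
  `|diag_density n t -
    gauss_limit t * (1 - (3 - 72 * t ^+ 2 + 144 * t ^+ 4) / (20 * d))| <=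
  Num.sqrt (6 / pi) * (391 / 1000) / d ^+ 2.
Proof.
cbv zeta => n19; have [c _] := gauss_const_bounds R.
have := @diag_density_approx R n t (leq_trans _ n19); cbv zeta => /(_ isT) H.
apply: le_trans H _; rewrite /gauss_limit expr0n /= mulr0 oppr0 expR0 mulr1.
have ps := cube_le_exp2 R n19; have d21 : 21 <= n.+2%:R :> R by rewrite ler_nat.
have p0 : 0 < 2 ^+ n :> R by exact: exprn_gt0.
rewrite exprVn; move: (Num.sqrt (6 / pi)) (2 ^+ n) n.+2%:R c ps d21 p0 => q p d c ps d21 p0.
have d0 : 0 < d by lra.
have s : Num.sqrt d <= d / 4 by apply: sqrt_le; [lra|nra].
have d20 : 0 < d ^+ 2 by exact: exprn_gt0.
have sp : Num.sqrt d * p^-1 <= (1 / 160) / d ^+ 2.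
  apply: le_trans (ler_wpM2r _ s) _; first by rewrite invr_ge0 ltW.
  rewrite ler_pdivrMr// mulrAC ler_pdivlMr//; lra.
apply: le_trans (lerD (lexx _) sp) _.
rewrite -mulrDl ler_wpM2r ?invr_ge0 ?(ltW d20)//.
by move: c; rewrite /dec; lra.
Qed.

(** One factor 1 / d of the error is bounded by 1/21, giving 391 / 21000; what the first correction
    does not compensate is k, and the other factor 1 / d becomes 1/21 as well. *)
Lemma diag_density_large (R : realType) n (t k : R) : (19 <= n)%N -> 0 <= k ->
  391 / 21000 - expR (- (6 * t ^+ 2)) * (3 - 72 * t ^+ 2 + 144 * t ^+ 4) / 20 <= k ->
  diag_density n t <= gauss_limit t + Num.sqrt (6 / pi) * k / 21.
Proof.
move=> n19 k0 hk; have := @diag_density_asympt R n t n19; cbv zeta.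
have d21 : 21 <= n.+2%:R :> R by rewrite ler_nat.
rewrite /gauss_limit ler_norml => /andP[_].
have c0 := sqrtr_ge0 (6 / pi : R).
move: (expR _) (3 - _ + _) (Num.sqrt (6 / pi)) n.+2%:R d21 c0 hk => e P c d d21 c0 hk H.
have d0 : 0 < d by exact: lt_le_trans d21.
have cd : 0 <= c / d by rewrite divr_ge0// ltW.
have dk : 391 / 1000 / d - e * P / 20 <= k.
  apply: le_trans hk; rewrite lerD2r ler_pdivrMr//; lra.
have ck : c * k / d <= c * k / 21.
  by rewrite ler_wpM2l ?mulr_ge0// lef_pV2 ?posrE//; lra.
have := ler_wpM2l cd dk; move: H; move: (diag_density n t) => g H.
have -> : c / d * k = c * k / d by ring.
have -> : c / d * (391 / 1000 / d - e * P / 20) = c * (391 / 1000) / d ^+ 2 - c * e * P / (20 * d).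
  by field; rewrite gt_eqF.
by move: H ck; rewrite mulrBr mulr1 [c * e * (_ / _)]mulrA; clear; lra.
Qed.

Lemma expRN6_ge (R : realType) (s t : R) : 0 <= t <= s ->
  exp_nested 4 0 (6 * s ^+ 2) <= expR (- (6 * t ^+ 2)).
Proof.
move=> /andP[t0 ts]; have x0 : 0 <= 6 * s ^+ 2 by rewrite mulr_ge0 ?sqr_ge0.
have := expRN_nested 4 x0; rewrite -(signr_odd _ 4) expr0 mul1r subr_ge0 => /le_trans; apply.
by rewrite ler_expR lerN2 ler_wpM2l// ler_sqr2.
Qed.

(** Up to 0.194 the correction polynomial is at least 0.494, and the correction absorbs the whole
    error: 0.797 * 0.494 / 20 > 391 / 21000. *)
Lemma large_dim_le_gauss (R : realType) n (t : R) : (19 <= n)%N ->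
  0 <= t <= dec 194 000 000 -> diag_density n t <= gauss_limit t.
Proof.
move=> n19 tr; have := @diag_density_large R n t 0 n19 (lexx _).
rewrite mulr0 mul0r addr0; apply.
have := expRN6_ge tr; move: tr; rewrite (even_powers t) /dec => /andP[t0 t1] e.
have e1 : 797 / 1000 <= expR (- (6 * t ^+ 2)) by apply: le_trans e; rewrite /=; lra.
have w1 : t ^+ 2 <= 37 / 1000 + 636 / 10 ^+ 6 by nra.
have w0 := sqr_ge0 t.
have P1 : 494 / 1000 <= 3 - 72 * t ^+ 2 + 144 * (t ^+ 2) ^+ 2.
  by move: (t ^+ 2) w0 w1 => w w0 w1; nra.
have := ler_pM (_ : 0 <= 797 / 1000 :> R) (_ : 0 <= 494 / 1000 :> R) e1 P1.
by clear; move=> H; have {H} := H ltac:(lra) ltac:(lra); lra.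
Qed.

Lemma large_dim_le_gauss200 (R : realType) n (t : R) : (19 <= n)%N ->
  0 <= t <= dec 200 000 000 -> diag_density n t <= gauss_limit t + dec 000 400 000.
Proof.
move=> n19 tr.
have k0 : 0 <= 52 / 10 ^+ 4 :> R by lra.
have [_ c] := gauss_const_bounds R.
apply: le_trans (diag_density_large n19 k0 _) _; last by move: c; rewrite /dec; lra.
have := expRN6_ge tr; move: tr; rewrite (even_powers t) /dec => /andP[t0 t1] e.
have e1 : 786 / 1000 <= expR (- (6 * t ^+ 2)) by apply: le_trans e; rewrite /=; lra.
have w1 : t ^+ 2 <= 4 / 100 by nra.
have w0 := sqr_ge0 t.
have P1 : 350 / 1000 <= 3 - 72 * t ^+ 2 + 144 * (t ^+ 2) ^+ 2.
  by move: (t ^+ 2) w0 w1 => w w0 w1; nra.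
have := ler_pM (_ : 0 <= 786 / 1000 :> R) (_ : 0 <= 350 / 1000 :> R) e1 P1.
by clear; move=> H; have {H} := H ltac:(lra) ltac:(lra); lra.
Qed.

(** The correction polynomial may be negative here but stays above -0.67, and 1.382 * 0.0522 / 21 <
    0.0035. *)
Lemma large_dim_le_gauss240 (R : realType) n (t : R) : (19 <= n)%N ->
  0 <= t <= dec 239 900 000 -> diag_density n t <= gauss_limit t + dec 003 500 000.
Proof.
move=> n19 tr.
have k0 : 0 <= 522 / 10 ^+ 4 :> R by lra.
have [_ c] := gauss_const_bounds R.
apply: le_trans (diag_density_large n19 k0 _) _; last by move: c; rewrite /dec; lra.
move: tr; rewrite (even_powers t) /dec => /andP[t0 t1].
have w1 : t ^+ 2 <= 576 / 10 ^+ 4 by nra.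
have w0 := sqr_ge0 t.
have e0 := expR_ge0 (- (6 * t ^+ 2)).
have e1 : expR (- (6 * t ^+ 2)) <= 1.
  by rewrite -[leRHS](@expR0 R) ler_expR; lra.
have P1 : - 67 / 100 <= 3 - 72 * t ^+ 2 + 144 * (t ^+ 2) ^+ 2.
  move: (t ^+ 2) w0 w1 => w w0 w1.
  have : 0 <= (576 / 10 ^+ 4 - w) * (72 - 144 * (w + 576 / 10 ^+ 4)) by rewrite mulr_ge0; lra.
  lra.
have := ler_wpM2l e0 P1; lra.
Qed.

(* With x = 6 t^2 this reads 4 x^2 - 12 x + 3 >= - 11/5 e^x, which follows from
   e^x >= (1 + x/4)^4. *)
Lemma large_dim_le (R : realType) n (t : R) : (19 <= n)%N ->
  diag_density n t <= gauss_limit t + dec 008 500 000.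
Proof.
move=> n19.
have k0 : 0 <= 1287 / 10 ^+ 4 :> R by lra.
have [_ c] := gauss_const_bounds R.
apply: le_trans (diag_density_large n19 k0 _) _; last by move: c; rewrite /dec; lra.
rewrite (even_powers t).
have x0 : 0 <= 6 * t ^+ 2 by rewrite mulr_ge0 ?sqr_ge0.
set x := 6 * t ^+ 2 in x0 *.
have e : (1 + x / 4) ^+ 4 <= expR x.
  have -> : expR x = expR (x / 4) ^+ 4 by rewrite -expRM_natl; congr expR; field.
  have x4 : 0 <= x / 4 by lra.
  by apply: lerXn2r; rewrite ?nnegrE ?expR_ge0 ?expR_ge1Dx//; lra.
have h : - 11 / 5 * expR x <= 4 * x ^+ 2 - 12 * x + 3.
  have x3 : 0 <= x ^+ 3 by exact: exprn_ge0.
  have x5 : 0 <= x ^+ 4 by exact: exprn_ge0.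
  have := sqr_ge0 (x - 1016 / 1000); lra.
have E : expR (- x) * expR x = 1 by rewrite -expRD addNr expR0.
have := ler_wpM2l (expR_ge0 (- x)) h.
rewrite (_ : _ * (- 11 / 5 * _) = - 11 / 5 * (expR (- x) * expR x)); last by ring.
rewrite E (_ : 3 - _ + _ = 4 * x ^+ 2 - 12 * x + 3); last by rewrite /x; ring.
lra.
Qed.

Lemma section3_inner_ge_gauss (R : realType) (s e t : R) : 0 <= s -> s <= t ->
  t <= dec 240 000 000 -> gauss_limit s + e <= section3_inner s ->
  gauss_limit t + e <= section3_inner t.
Proof.
move=> s0 st t2; have := section3_inner_sub_gauss s0 st t2.
have : 0 <= (t - s) * (t + s) / 20 by rewrite divr_ge0// mulr_ge0 ?subr_ge0 ?addr_ge0 ?(le_trans s0).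
lra.
Qed.

(** Relay points: the margin of I_3 over phi at 0.194, then at 0.2, covers the excess allowed to
    high dimensions on the interval that follows. *)
Lemma section3_inner_ge_gauss_at (R : realType) :
  gauss_limit (dec 194 000 000) + dec 000 400 000 <= section3_inner (dec 194 000 000) :> R /\
  gauss_limit (dec 200 000 000) + dec 003 500 000 <= section3_inner (dec 200 000 000) :> R.
Proof.
have [r _] := sqrt3_bounds R; split; rewrite /section3_inner.
  have [_ h] := @gauss_limit_bounds R 4 (dec 194 000 000) isT.
  by move: (gauss_limit _) (Num.sqrt 3) h r => g q; rewrite /= /dec; lra.
have [_ h] := @gauss_limit_bounds R 4 (dec 200 000 000) isT.
by move: (gauss_limit _) (Num.sqrt 3) h r => g q; rewrite /= /dec; lra.
Qed.

Lemma gauss_limit_le (R : realType) (s t : R) : 0 <= s <= t -> gauss_limit t <= gauss_limit s.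
Proof.
move=> /andP[s0 st]; have [h _] := gauss_limit_sub s t.
have := gauss_limit_gt0 t => p; rewrite -subr_ge0; apply: le_trans h.
by apply: mulr_ge0; [rewrite mulr_ge0// ltW|rewrite subr_ge0 ler_sqr2].
Qed.

Lemma gauss_limit_le1 (R : realType) (t : R) : dec 239 800 000 <= t ->
  gauss_limit t + dec 008 500 000 <= 1.
Proof.
move=> t1; have s0 : 0 <= (dec 239 800 000 : R) <= t by apply/andP; split=> //; rewrite /dec; lra.
have := gauss_limit_le s0; have [_ h] := @gauss_limit_bounds R 4 (dec 239 800 000) isT.
move: h; rewrite /=; move: (gauss_limit (dec _ _ _)) => g; rewrite /dec; lra.
Qed.

(** Both sides decrease, so on [a, b] it suffices to compare phi(a) with the line at b. The mesh is
    refined to the right, where the gap shrinks. *)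
Lemma gauss_limit_le_section2 (R : realType) (t : R) :
  dec 500 000 000 <= t <= dec 641 790 000 ->
  gauss_limit t + dec 008 500 000 <= Num.sqrt 2 - 2 * t.
Proof.
move=> /andP[t1 t2]; have [r _] := sqrt2_bounds R.
have P (a b g : R) : 0 <= a -> gauss_limit a <= g ->
    g + dec 008 500 000 <= 1 + dec 414 213 562 - 2 * b -> a <= t -> t <= b ->
    gauss_limit t + dec 008 500 000 <= Num.sqrt 2 - 2 * t.
  move=> a0 ag gb at_ tb; have s0 : 0 <= a <= t by apply/andP.
  by have := gauss_limit_le s0; move: r ag gb; rewrite /dec; lra.
have Q (a b g : R) : 0 <= a ->
    (1 + dec 381 976 599) * exp_nested 13 0 (6 * a ^+ 2) <= g ->
    g + dec 008 500 000 <= 1 + dec 414 213 562 - 2 * b -> a <= t -> t <= b ->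
    gauss_limit t + dec 008 500 000 <= Num.sqrt 2 - 2 * t.
  move=> a0 H; apply: P => //; apply: le_trans H.
  by have [_ h] := @gauss_limit_bounds R 12 a isT.
have [h1|/ltW h1] := leP t (dec 540 000 000).
  by apply: (Q (dec 500 000 000) (dec 540 000 000) (dec 312 000 000)) => //;
    clear; rewrite /dec /=; lra.
have [h2|/ltW h2] := leP t (dec 575 000 000).
  by apply: (Q (dec 540 000 000) (dec 575 000 000) (dec 242 000 000)) => //;
    clear; rewrite /dec /=; lra.
have [h3|/ltW h3] := leP t (dec 600 000 000).
  by apply: (Q (dec 575 000 000) (dec 600 000 000) (dec 192 000 000)) => //;
    clear; rewrite /dec /=; lra.
have [h4|/ltW h4] := leP t (dec 620 000 000).
  by apply: (Q (dec 600 000 000) (dec 620 000 000) (dec 161 000 000)) => //;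
    clear; rewrite /dec /=; lra.
have [h5|/ltW h5] := leP t (dec 632 000 000).
  by apply: (Q (dec 620 000 000) (dec 632 000 000) (dec 139 500 000)) => //;
    clear; rewrite /dec /=; lra.
have [h6|/ltW h6] := leP t (dec 638 000 000).
  by apply: (Q (dec 632 000 000) (dec 638 000 000) (dec 127 500 000)) => //;
    clear; rewrite /dec /=; lra.
by apply: (Q (dec 638 000 000) (dec 641 790 000) (dec 121 500 000)) => //;
  clear; rewrite /dec /=; lra.
Qed.

Lemma gauss_limit_le_section3_outer (R : realType) (t : R) :
  dec 641 780 000 <= t <= dec 646 080 000 ->
  gauss_limit t + dec 008 500 000 <= section3_outer t.
Proof.
move=> tr; have s0 : 0 <= (dec 641 780 000 : R) <= t.
  by case/andP: tr => t1 _; apply/andP; split=> //; rewrite /dec; lra.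
have := gauss_limit_le s0; have [_ h] := @gauss_limit_bounds R 12 (dec 641 780 000) isT.
have {}h : gauss_limit (dec 641 780 000) <= dec 116 800 000 :> R.
  by apply: le_trans h _; clear; rewrite /dec /=; lra.
move: h; move: (gauss_limit (dec _ _ _)) => g h gt.
have [r3 r3'] := sqrt3_bounds R.
have : dec 125 600 000 <= section3_outer t; last by move: h gt; rewrite /dec; lra.
case/andP: tr; rewrite /section3_outer; move: (Num.sqrt 3) r3 r3' => q; rewrite /dec => r3 r3' t1 t2.
have a : 0 <= (q - (1 + 732 / 10 ^+ 3 + 5 / 10 ^+ 5)) * (9 / 8 + 3 / 2 * t ^+ 2).
  by apply: mulr_ge0; [lra|have := sqr_ge0 t; lra].
(* Replaces t^2 by its tangent at the right end 0.64608. *)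
have := sqr_ge0 (t - (646 / 10 ^+ 3 + 80 / 10 ^+ 6)).
lra.
Qed.

Lemma diag_volumes_ubound (R : realType) (t m : R) : 0 <= t -> 0 <= m ->
  (t <= 1 / 2 -> 1 <= m) -> diag_density 0 t <= m -> diag_density 1 t <= m ->
  (forall n, n \in small_dims -> diag_density n t <= m) ->
  (forall n, (19 <= n)%N -> diag_density n t <= m) ->
  ubound (diag_volumes t) m%:E.
Proof.
move=> t0 m0 m1 g0 g1 gs gl _ [[|[|n]] //= _ <-].
  by rewrite diag_volume1// lee_fin; case: ifP.
rewrite diag_volumeSS// lee_fin.
have [n19|n19] := leqP 19 n; first exact: gl.
case: n n19 => [//|[//|n]] n19; apply: gs.
by rewrite mem_iota /= !ltnS in n19 *.
Qed.

(** [alpha23] is the larger root of the quadratic I_3 - I_2; the identity sqrt 6 = sqrt 2 sqrt 3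
    matches its discriminant with the closed form. *)
Lemma section3_outerE (R : realType) (t : R) : section3_outer t - (Num.sqrt 2 - 2 * t) =
  3 * Num.sqrt 3 / 2 * ((t - alpha23 R) *
    (t - (5 - 2 * Num.sqrt (6 * Num.sqrt 6 - 14)) / (6 * Num.sqrt 3))).
Proof.
have [s1 _] := sqrt6_bounds R.
have r1 : 0 <= 6 * Num.sqrt 6 - 14 :> R by move: s1; clear; rewrite /dec; lra.
have a2 := sqr_sqrtr r1; have r3 : Num.sqrt 3 ^+ 2 = 3 :> R by rewrite sqr_sqrtr.
have q0 : Num.sqrt 3 != 0 :> R by rewrite gt_eqF// sqrtr_gt0.
have r6 : Num.sqrt 6 = Num.sqrt 2 * Num.sqrt 3 :> R.
  by rewrite -sqrtrM//; congr Num.sqrt; ring.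
rewrite /section3_outer /alpha23; move: (Num.sqrt (_ - 14)) a2 => a; rewrite r6.
by move: (Num.sqrt 3) (Num.sqrt 2) q0 r3 => q p q0 r3 a2; field: r3 a2.
Qed.

Lemma section3_inner_alpha13 (R : realType) : section3_inner (alpha13 R) = 1.
Proof.
have [_ s2] := sqrt3_bounds R.
have r1 : 0 <= 9 - 4 * Num.sqrt 3 :> R by move: s2; clear; rewrite /dec; lra.
have a2 := sqr_sqrtr r1; have r3 : Num.sqrt 3 ^+ 2 = 3 :> R by rewrite sqr_sqrtr.
rewrite /section3_inner /alpha13; move: (Num.sqrt (9 - _)) a2 => a a2.
move: (Num.sqrt 3) a2 r3 => q a2 r3.
by field: a2 r3.
Qed.

Lemma section3_inner_le (R : realType) (s t : R) : 0 <= s <= t ->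
  section3_inner t <= section3_inner s.
Proof.
by move=> /andP[s0 st]; rewrite /section3_inner lerD2l lerN2 ler_wpM2l ?ler_sqr2.
Qed.

Lemma gauss_const_le (R : realType) : 1 + dec 381 976 000 <= Num.sqrt (6 / pi) :> R.
Proof. by have [h _] := gauss_const_bounds R; apply: le_trans h; rewrite /dec; lra. Qed.

Lemma diag_density1_small (R : realType) (t : R) : 0 <= t <= dec 240 000 000 ->
  diag_density 1 t = section3_inner t.
Proof.
have [_ s2] := sqrt3_bounds R => /andP[t0 t1]; apply: diag_density1_inner => //.
by have := ler_wpM2r t0 s2; move: t1; clear; rewrite /dec; lra.
Qed.

(** * The maximum or supremum on each range of t *)

Lemma maximum_dim2_small (R : realType) (a t : R) : is_alpha2inf a -> 0 <= t <= a ->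
  is_maximum (diag_volumes t) (diag_volume 2 t).
Proof.
move=> [ea /andP[a1 a2]] /andP[t0 ta]; split; first by exists 2%N.
have [s1 _] := sqrt2_bounds R; have [_ s3] := sqrt3_bounds R.
have [p1 p2] : 1 + dec 379 000 000 <= Num.sqrt 2 - 2 * t /\ t <= dec 020 000 000.
  by move: s1 a2 ta; rewrite /dec; split; lra.
have g0 : diag_density 0 t = Num.sqrt 2 - 2 * t.
  by apply: diag_density0; rewrite t0; move: p2; clear; rewrite /dec; lra.
have gp : gauss_limit t <= Num.sqrt 2 - 2 * t.
  have [_ g] := gauss_limit_sub t a; have p0 := gauss_limit_gt0 t.
  have [_ h] := @gauss_limit_bounds R 0 t isT.
  have q2 : gauss_limit t <= 2 by move: h; rewrite /= /dec; lra.
  have : gauss_limit t * ((a + t) * (a - t)) <= 2 * (4 / 100 * (a - t)).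
    apply: ler_pM => //; [exact: ltW|by apply: mulr_ge0; lra|].
    by rewrite ler_wpM2r; move: a2 ta; clear; rewrite /dec; lra.
  by move: g ea; lra.
rewrite diag_volumeSS// g0; apply: diag_volumes_ubound => //.
- by move: p1; clear; rewrite /dec; lra.
- by move: p1; clear; rewrite /dec; lra.
- by rewrite g0.
- rewrite diag_density1_small; last by rewrite t0; move: p2; clear; rewrite /dec; lra.
  have := sqr_ge0 t => w0; have := mulr_ge0 (sqrtr_ge0 3) w0.
  by rewrite /section3_inner; move: p1 s3; clear; rewrite /dec; lra.
- move=> n ns; apply: le_trans gp; apply: diag_density_le_gauss => //.
    exact: gauss_const_le.
  by rewrite t0; move: p2; clear; rewrite /dec; lra.
- move=> n n19; apply: le_trans gp; apply: large_dim_le_gauss => //.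
  by rewrite t0; move: p2; clear; rewrite /dec; lra.
Qed.

Lemma section3_outer_alpha23 (R : realType) (t : R) : 1 / 2 <= t ->
  (t <= alpha23 R -> section3_outer t <= Num.sqrt 2 - 2 * t) /\
  (alpha23 R <= t -> Num.sqrt 2 - 2 * t <= section3_outer t).
Proof.
move=> t1; have := section3_outerE t; set b := (5 - _) / _ => E.
have s0 : 0 < 6 * Num.sqrt 3 :> R by rewrite mulr_gt0// sqrtr_gt0.
have bt : 0 <= t - b.
  rewrite subr_ge0 (le_trans _ t1)// /b ler_pdivrMr//.
  have [s3 _] := sqrt3_bounds R; have := sqrtr_ge0 (6 * Num.sqrt 6 - 14 : R).
  by move: s3; clear; rewrite /dec; lra.
have c : 0 <= 3 * Num.sqrt 3 / 2 :> R by lra.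
rewrite -[section3_outer t <= _]subr_le0 -[_ <= section3_outer t]subr_ge0 E; split=> h.
  by rewrite mulr_ge0_le0// mulr_le0_ge0// subr_le0.
by rewrite !mulr_ge0// subr_ge0.
Qed.

Lemma diag_density1_large (R : realType) (t : R) : dec 500 000 000 <= t <= dec 700 000 000 ->
  diag_density 1 t = section3_outer t.
Proof.
have [s1 s2] := sqrt3_bounds R => /andP[t1 t2]; apply: diag_density1_outer.
have t0 : 0 <= t by move: t1; clear; rewrite /dec; lra.
have := ler_wpM2r t0 s1; have := ler_wpM2r t0 s2.
by move: t1 t2; clear; rewrite /dec; lra.
Qed.

Lemma maximum_dim2_large (R : realType) (t : R) : 1 / 2 < t <= alpha23 R ->
  is_maximum (diag_volumes t) (diag_volume 2 t).
Proof.
move=> /andP[t1 t2]; split; first by exists 2%N.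
have /andP[_ b] := alpha23_bounds R; have [s1 _] := sqrt2_bounds R.
have tr : dec 500 000 000 <= t <= dec 641 790 000.
  by move: t1 t2 b; clear; rewrite /dec; lra.
have t0 : 0 <= t by lra.
have g0 : diag_density 0 t = Num.sqrt 2 - 2 * t.
  by apply: diag_density0; rewrite t0; move: tr; clear; rewrite /dec; lra.
rewrite diag_volumeSS// g0; apply: diag_volumes_ubound => //.
- by move: tr s1; clear; rewrite /dec; lra.
- by move=> h; lra.
- by rewrite g0.
- rewrite diag_density1_large; last by move: tr; clear; rewrite /dec; lra.
  by have [H _] := section3_outer_alpha23 (ltW t1); exact: H.
- by move=> n ns; exact: diag_density_le2.
- by move=> n n19; apply: le_trans (large_dim_le _ n19) (gauss_limit_le_section2 tr).
Qed.

Lemma maximum_dim3_small (R : realType) (a t : R) : is_alpha3inf a -> a <= t <= alpha13 R ->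
  is_maximum (diag_volumes t) (diag_volume 3 t).
Proof.
move=> [ea /andP[a1 a2]] /andP[at_ t1]; split; first by exists 3%N.
have /andP[_ b] := alpha13_bounds R.
have tr : dec 192 000 000 <= t <= dec 239 900 000.
  by move: a1 at_ t1 b; clear; rewrite /dec; lra.
have a0 : 0 <= a by move: a1; clear; rewrite /dec; lra.
have t0 : 0 <= t by exact: le_trans at_.
have g1 : diag_density 1 t = section3_inner t.
  by apply: diag_density1_small; rewrite t0; move: tr; clear; rewrite /dec; lra.
have m1 : 1 <= section3_inner t.
  by rewrite -section3_inner_alpha13 section3_inner_le// t0.
have gp : gauss_limit t <= section3_inner t.
  rewrite -[leLHS]addr0; apply: section3_inner_ge_gauss a0 at_ _ _.
    by case/andP: tr => _; rewrite /dec; lra.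
  by rewrite addr0 (ea : section3_inner a = _).
rewrite diag_volumeSS// g1; apply: diag_volumes_ubound => //.
- by lra.
- rewrite diag_density0; last by rewrite t0; move: tr; clear; rewrite /dec; lra.
  have [_ s2] := sqrt2_bounds R; have [s3 _] := sqrt3_bounds R.
  (* Bounds t^2 by its chord on [0.192, 0.24], which makes the comparison with I_2 linear in t. *)
  have h : 0 <= (t - dec 192 000 000) * (dec 240 000 000 - t).
    by apply: mulr_ge0; move: tr; clear; rewrite /dec; lra.
  have t2 : 0 <= 1 / 4 - t ^+ 2 by move: tr; rewrite /dec; nra.
  have := ler_wpM2r t2 s3; rewrite /section3_inner.
  by move: h s2 tr; clear; rewrite /dec; lra.
- by rewrite g1.
- move=> n ns; have [h|/ltW h] := leP t (dec 194 000 000).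
    apply: le_trans gp; apply: diag_density_le_gauss => //; first exact: gauss_const_le.
    by rewrite t0.
  apply: diag_density_le3in => //; rewrite h.
  by case/andP: tr.
- move=> n n19; have [h|/ltW h] := leP t (dec 194 000 000).
    by apply: le_trans (large_dim_le_gauss n19 _) gp; rewrite t0.
  have t240 : t <= dec 240 000 000 by case/andP: tr => _; rewrite /dec; lra.
  have [g194 g200] := section3_inner_ge_gauss_at R.
  have [h2|/ltW h2] := leP t (dec 200 000 000).
    apply: le_trans (large_dim_le_gauss200 n19 _) (section3_inner_ge_gauss _ h t240 g194).
      by rewrite t0.
    by clear; rewrite /dec; lra.
  apply: le_trans (large_dim_le_gauss240 n19 _) (section3_inner_ge_gauss _ h2 t240 g200).
    by rewrite t0; case/andP: tr.
  by clear; rewrite /dec; lra.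
Qed.

Lemma maximum_dim3_large (R : realType) (t : R) : alpha23 R <= t <= dec 646 070 000 ->
  is_maximum (diag_volumes t) (diag_volume 3 t).
Proof.
move=> /andP[t1 t2]; split; first by exists 3%N.
have /andP[b _] := alpha23_bounds R; have [s1 _] := sqrt2_bounds R.
have tr : dec 641 780 000 <= t <= dec 646 080 000.
  by move: t1 t2 b; clear; rewrite /dec; lra.
have t0 : 0 <= t by move: tr; clear; rewrite /dec; lra.
have h2 : Num.sqrt 2 - 2 * t <= section3_outer t.
  have h : 1 / 2 <= t by move: tr; clear; rewrite /dec; lra.
  by have [_ H] := section3_outer_alpha23 h; exact: H.
have g1 : diag_density 1 t = section3_outer t.
  by apply: diag_density1_large; move: tr; clear; rewrite /dec; lra.
rewrite diag_volumeSS// g1; apply: diag_volumes_ubound => //.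
- by move: h2 tr s1; clear; rewrite /dec; lra.
- by move: tr; clear; rewrite /dec; lra.
- by rewrite diag_density0// t0; move: tr; clear; rewrite /dec; lra.
- by rewrite g1.
- by move=> n ns; exact: diag_density_le3out.
- by move=> n n19; apply: le_trans (large_dim_le _ n19) (gauss_limit_le_section3_outer tr).
Qed.

Lemma maximum_dim1 (R : realType) (t : R) : alpha13 R <= t <= 1 / 2 ->
  is_maximum (diag_volumes t) (diag_volume 1 t).
Proof.
move=> /andP[t1 t2]; split; first by exists 1%N.
have /andP[b _] := alpha13_bounds R; have [_ s2] := sqrt2_bounds R.
have t3 : dec 239 895 000 <= t by exact: le_trans (ltW b) t1.
have t0 : 0 <= t by move: t3; clear; rewrite /dec; lra.
have [s3 s4] := sqrt3_bounds R.
have q3 : Num.sqrt 3 ^+ 2 = 3 :> R by rewrite sqr_sqrtr.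
rewrite diag_volume1// t2; apply: diag_volumes_ubound => //.
- rewrite diag_density0; last by rewrite t0; move: t2; clear; rewrite /dec; lra.
  by move: s2 t3; clear; rewrite /dec; lra.
- have [h|/ltW h] := leP (2 * Num.sqrt 3 * t) 1.
    rewrite diag_density1_inner// -section3_inner_alpha13 section3_inner_le// t1 andbT.
    by move: b; clear; rewrite /dec; lra.
  have h3 := ler_wpM2r t0 s4; rewrite diag_density1_outer; last first.
    by rewrite h /=; move: h3 t2; clear; rewrite /dec; lra.
  (* The area of a triangle, a perfect square in t; this form gives the bound by 1 at once. *)
  rewrite (_ : section3_outer t = Num.sqrt 3 / 2 * (3 / 2 - Num.sqrt 3 * t) ^+ 2); last first.
    by rewrite /section3_outer; field: q3.
  have y : (3 / 2 - Num.sqrt 3 * t) ^+ 2 <= 1 ^+ 2.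
    by apply: ler_sqr2; move: h3 t2; rewrite /dec; lra.
  rewrite expr1n in y; rewrite -[leRHS](mulr1 1); apply: ler_pM; rewrite ?sqr_ge0// ?divr_ge0 ?sqrtr_ge0//.
  by move: s4; clear; rewrite /dec; lra.
- by move=> n ns; apply: diag_density_le1 => //; move: t2 t3; clear; rewrite /dec; lra.
- move=> n n19; apply: le_trans (large_dim_le _ n19) (gauss_limit_le1 _).
  by move: t3; clear; rewrite /dec; lra.
Qed.

Lemma supremum_gauss (R : realType) (a b t : R) : is_alpha2inf a -> is_alpha3inf b ->
  a <= t <= b -> ereal_sup (diag_volumes t) = (gauss_limit t)%:E.
Proof.
move=> [ea /andP[a1 a2]] [eb /andP[b1 b2]] /andP[at_ tb].
have a0 : 0 <= a by move: a1; clear; rewrite /dec; lra.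
have t0 : 0 <= t by exact: le_trans at_.
have t1 : t <= dec 193 000 000 by move: tb b2; clear; rewrite /dec; lra.
have p0 := gauss_limit_gt0 t.
apply/eqP; rewrite eq_le; apply/andP; split.
  apply: ub_ereal_sup; apply: diag_volumes_ubound => //; first exact: ltW.
  - move=> _; have st : 0 <= t <= (dec 193 000 000 : R) by rewrite t0.
    have := gauss_limit_le st; have [h _] := @gauss_limit_bounds R 2 (dec 193 000 000) isT.
    by move: h; rewrite /=; move: (gauss_limit (dec _ _ _)) => g; rewrite /dec; lra.
  - rewrite diag_density0; last by rewrite t0; move: t1; clear; rewrite /dec; lra.
    have [_ g] := gauss_limit_sub a t; have q0 := gauss_limit_gt0 a.
    have [_ h] := @gauss_limit_bounds R 0 a isT.
    have q2 : gauss_limit a <= 139 / 100 by move: h; clear; rewrite /= /dec; lra.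
    (* phi loses at most 6 * 1.39 * 0.22 (t - a) < 2 (t - a), so it stays above the line to the
       right of a. *)
    have : gauss_limit a * ((t + a) * (t - a)) <= 139 / 100 * (22 / 100 * (t - a)).
      apply: ler_pM => //; [exact: ltW|by apply: mulr_ge0; clear - a0 at_; lra|].
      by apply: ler_wpM2r; clear - at_ a2 t1; move: a2 t1; rewrite /dec; lra.
    by move: g ea at_; clear; lra.
  - rewrite diag_density1_small; last by rewrite t0; move: t1; clear; rewrite /dec; lra.
    have b240 : b <= dec 240 000 000 by move: b2; clear; rewrite /dec; lra.
    have := section3_inner_sub_gauss t0 tb b240; rewrite (eb : section3_inner b = _).
    have : 0 <= (b - t) * (b + t) / 20.
      by rewrite divr_ge0// mulr_ge0 ?subr_ge0 ?addr_ge0 ?(le_trans t0 tb).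
    by clear; lra.
  - move=> n ns; apply: diag_density_le_gauss => //; first exact: gauss_const_le.
    by rewrite t0; move: t1; clear; rewrite /dec; lra.
  - move=> n n19; apply: large_dim_le_gauss => //.
    by rewrite t0; move: t1; clear; rewrite /dec; lra.
apply/lee_addgt0Pr => e e0.
pose P := 3 - 72 * t ^+ 2 + 144 * t ^+ 4; pose c : R := Num.sqrt (6 / pi).
(* M / d bounds the first correction and the error together; d is then taken large enough for M / d
   <= e. *)
pose M := gauss_limit t * `|P| / 20 + c.
have c0 : 0 <= c := sqrtr_ge0 _.
have M0 : 0 <= M by rewrite addr_ge0// divr_ge0// mulr_ge0// ltW.
pose n := maxn 19 (Num.bound (M / e)).
have n19 : (19 <= n)%N by exact: leq_maxl.
have nM : M / e <= n.+2%:R.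
  have := archi_boundP (divr_ge0 M0 (ltW e0)) => /ltW/le_trans; apply.
  by rewrite ler_nat; apply: leq_trans (leq_maxr 19 _) _; rewrite -/n -addn2 leq_addr.
have S : (diag_volume n.+2 t <= ereal_sup (diag_volumes t))%E.
  by apply: ereal_sup_ubound; exists n.+2.
apply: (@le_trans _ _ (diag_volume n.+2 t + e%:E)%E); last by rewrite leeD2r.
rewrite diag_volumeSS// -EFinD lee_fin.
have := @diag_density_asympt R n t n19; cbv zeta; rewrite ler_norml -/P -/c => /andP[H _].
have d21 : 21 <= n.+2%:R :> R by rewrite ler_nat.
move: (n.+2%:R : R) (diag_density n t) nM H d21 => d g nM H d21.
have d0 : 0 < d by lra.
have Md : M / d <= e by rewrite ler_pdivrMr// mulrC -ler_pdivrMr.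
have l1 : c * (391 / 1000) / d ^+ 2 <= c / d.
  rewrite expr2 invfM mulrA ler_wpM2r ?invr_ge0 ?(ltW d0)//.
  by rewrite ler_pdivrMr// ler_wpM2l//; lra.
have l2 : gauss_limit t * P / (20 * d) <= gauss_limit t * `|P| / 20 / d.
  rewrite invfM mulrA ler_wpM2r ?invr_ge0 ?(ltW d0)// ler_wpM2r//.
  by rewrite ler_wpM2l ?ler_norm// ltW.
move: Md H; rewrite /M mulrDl mulrBr mulr1 [gauss_limit t * (_ / _)]mulrA; lra.
Qed.

Theorem theorem4p4 (R : realType) :
  [/\ exists! a : R, is_alpha2inf a,
      exists! a : R, is_alpha3inf a
    & exists! t : R, is_delta t] /\
  (dec 641 788 000 < alpha23 R < dec 641 789 000) /\
  (dec 239 895 000 < alpha13 R < dec 239 896 000) /\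
  (forall alpha2inf alpha3inf delta : R,
    is_alpha2inf alpha2inf -> is_alpha3inf alpha3inf -> is_delta delta ->
    [/\ (* (i) *)
        forall t : R,
          0 <= t <= alpha2inf \/ 1 / 2 < t <= alpha23 R ->
          is_maximum (diag_volumes t) (diag_volume 2 t),
        (* (ii) *)
        forall t : R,
          [\/ alpha3inf <= t <= dec 209 160 000,
              delta <= t <= alpha13 R
            | alpha23 R <= t <= dec 646 070 000] ->
          is_maximum (diag_volumes t) (diag_volume 3 t),
        (* (iii) *)
        forall t : R,
          alpha13 R <= t <= 1 / 2 ->
          is_maximum (diag_volumes t) (diag_volume 1 t)
      & (* (iv) *)
        forall t : R,
          alpha2inf <= t <= alpha3inf ->
          ereal_sup (diag_volumes t) = (gauss_limit t)%:E]).
Proof.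
split; first by split; [exact: alpha2inf_exists|exact: alpha3inf_exists|exact: delta_exists].
split; first exact: alpha23_bounds.
split; first exact: alpha13_bounds.
move=> a b delta ha hb hd; have /andP[m13 M13] := alpha13_bounds R.
split=> t.
- by case; [exact: maximum_dim2_small|exact: maximum_dim2_large].
(* The decimal bounds on the constants place the first two ranges inside the interval from
   [alpha3inf] to [alpha13]. *)
- have [_ /andP[b1 b2]] := hb; have [_ /andP[d1 d2]] := hd.
  case=> [/andP[t1 t2]|/andP[t1 t2]|]; last exact: maximum_dim3_large.
    by apply: (maximum_dim3_small hb); rewrite t1; move: t2 m13; rewrite /dec; lra.
  by apply: (maximum_dim3_small hb); rewrite t2 andbT; move: b2 d1 t1; rewrite /dec; lra.
- exact: maximum_dim1.
- exact: supremum_gauss ha hb.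
Qed.
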